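(* Let $n\ge1$ and let $\mathbb B_n$ be the unit ball of $\mathbb C^n$. The following are equivalent: (i) the Corona Property holds for $H^\infty(\mathbb B_n)$; (ii) the Bergman space $A^2(\mathbb B_n)$ satisfies the Convex Poisson Property; (iii) the Hardy space $H^2(\mathbb B_n)$ satisfies the Convex Poisson Property.
   Context: Let $\Omega=\mathbb B_n$. $H^\infty(\Omega)$ is the algebra of bounded holomorphic functions. $A^2(\Omega)$ is the space of holomorphic $f$ with $\|f\|^2=\int_\Omega|f|^2d\mu<\infty$, $\mu$ normalized Lebesgue measure on $\Omega$. $H^2(\Omega)$ is the Hardy space with norm $\|f\|^2=\int_{\partial\Omega}|f|^2d\mu$ (boundary values), $\mu$ normalized surface measure on $\partial\Omega$. For $\mathcal H$ either space, $k_a$ is the reproducing kernel at $a\in\Omega$, $\widetilde{k_a}=k_a/\sqrt{k_a(a)}$. For $M\ge1$, $\mathbf a=(a_1,\dots,a_M)\in\Omega^M$ and $\theta=(\theta_0,\dots,\theta_M)\in[0,1]^{M+1}$ with $\sum_m\theta_m=1$, put $$\|h\|_{\mathcal H^{\mathbf a,\theta}}^2=\int|h|^2\Big(\theta_0+\sum_{m=1}^M\theta_m|\widetilde{k_{a_m}}|^2\Big)d\mu .$$ Corona data: $N\ge1$, $c>0$, and $\varphi_1,\dots,\varphi_N\in H^\infty(\Omega)$ with $1\ge\max_\ell|\varphi_\ell(z)|^2\ge c^2>0$ for all $z\in\Omega$. Corona Property for $H^\infty(\Omega)$: for all corona data there are $C>0$ and $f_1,\dots,f_N\in H^\infty(\Omega)$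 with $\max_\ell|f_\ell(z)|^2\le C^2$ and $\sum_\ell\varphi_\ell(z)f_\ell(z)=1$ for all $z\in\Omega$. Convex Poisson Property for $\mathcal H$: for all corona data there is $C>0$ such that for all $M\ge1$, all $\mathbf a=(a_1,\dots,a_M)\in\Omega^M$ and all $\theta=(\theta_0,\dots,\theta_M)\in[0,1]^{M+1}$ with $\sum_{m=0}^M\theta_m=1$ there are $f_1,\dots,f_N\in\mathcal H$ with $\sum_\ell\|f_\ell\|_{\mathcal H^{\mathbf a,\theta}}^2\le C^2$ and $\sum_\ell\varphi_\ell f_\ell=1$ on $\Omega$. *)

(* Defs.v *)
From HB Require Import structures.
From mathcomp Require Import all_boot all_order all_algebra.
From mathcomp Require Import all_classical all_reals all_analysis measurable_realfun.
From mathcomp Require Import complex.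

Set Implicit Arguments.
Unset Strict Implicit.
Unset Printing Implicit Defensive.

Import Order.TTheory GRing.Theory Num.Theory numFieldNormedType.Exports.
Local Open Scope classical_set_scope.
Local Open Scope ring_scope.

(* |w|^2 as an element of R (the norm `|w| of R[i] is R[i]-valued). *)
Definition sqmod (R : realType) (w : R[i]) : R := Normc.normc w ^+ 2.

Definition unit_ball (R : realType) (n : nat) : set 'rV[R[i]]_n :=
  [set z | \sum_(i < n) sqmod (z ord0 i) < 1].

(* [measurableTypeR R] is the copy of R on which the library defines
   [lebesgue_measure]. *)
Notation plane R := (measurableTypeR R * measurableTypeR R)%type.

Section real_coordinates.
Variables (R : realType) (n : nat).

(* Integrals over C^n are taken on the space (R * R)^n of real and imaginary
   parts, which carries the product Borel sigma-algebra; [complex_point] is the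
   bijection onto C^n. *)
Definition complex_point (t : n.-tuple (plane R)) : 'rV[R[i]]_n :=
  \row_(i < n) ((tnth t i).1 +i* (tnth t i).2)%C.

Definition sqnorm (t : n.-tuple (plane R)) : R :=
  \sum_(i < n) ((tnth t i).1 ^+ 2 + (tnth t i).2 ^+ 2).

Definition coord_ball : set (n.-tuple (plane R)) := [set t | sqnorm t < 1].

Definition coord_sphere : set (n.-tuple (plane R)) := [set t | sqnorm t = 1].

(* t / |t|, and 0 at 0 *)
Definition radial_proj (t : n.-tuple (plane R)) : n.-tuple (plane R) :=
  [tuple ((tnth t i).1 / Num.sqrt (sqnorm t),
          (tnth t i).2 / Num.sqrt (sqnorm t)) | i < n].

Lemma sqnorm_ge0 t : 0 <= sqnorm t.
Proof. by apply: sumr_ge0 => i _; rewrite addr_ge0 ?sqr_ge0. Qed.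

Lemma measurable_sqnorm : measurable_fun setT sqnorm.
Proof.
apply: measurable_sum => i; apply: measurable_funD; apply: measurable_funX.
  exact: measurableT_comp (measurable_tnth i).
exact: measurableT_comp (measurable_tnth i).
Qed.

Lemma measurable_coord_ball : measurable coord_ball.
Proof.
rewrite (_ : coord_ball = setT `&` sqnorm @^-1` `]-oo, 1[).
  by apply: measurable_sqnorm => //; exact: measurable_itv.
by rewrite setTI; apply/seteqP; split=> t /=; rewrite in_itv.
Qed.

Lemma measurable_radial_proj : measurable_fun setT radial_proj.
Proof.
apply/measurable_fun_tnthP => i.
rewrite (_ : _ \o _ = fun t : n.-tuple (plane R) =>
  ((tnth t i).1 / Num.sqrt (sqnorm t), (tnth t i).2 / Num.sqrt (sqnorm t))).
  have mV : measurable_fun setT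
      (fun t : n.-tuple (plane R) => (Num.sqrt (sqnorm t))^-1).
    rewrite (_ : (fun _ => _) = (fun x : R => x `^ (- 2^-1)) \o sqnorm).
      exact: measurableT_comp (measurable_powR _) measurable_sqnorm.
    by apply/funext => t /=; rewrite powRN powR12_sqrt ?sqnorm_ge0.
  apply/measurable_fun_pairP; split; apply: measurable_funM => //.
    exact: measurableT_comp (measurable_tnth i).
  exact: measurableT_comp (measurable_tnth i).
by apply/funext => t /=; rewrite tnth_mktuple.
Qed.

End real_coordinates.


Section lebesgue.
Variable R : realType.

Definition image_measure d1 d2 (T1 : measurableType d1) (T2 : measurableType d2)
    (m : {measure set T1 -> \bar R}) (f : T1 -> T2)
    (mf : measurable_fun setT f) : {measure set T2 -> \bar R} :=
  measure_function_pushforward__canonical__measure_function_Measure m mf.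

Definition cons_coord (n : nat)
    (p : n.-tuple (plane R) * measurableTypeR R * measurableTypeR R) :
    n.+1.-tuple (plane R) :=
  [tuple of (p.1.2, p.2) :: p.1.1].

Lemma measurable_cons_coord (n : nat) : measurable_fun setT (@cons_coord n).
Proof.
apply: measurable_cons.
  apply: measurable_fun_pair => //.
  exact: (@measurableT_comp _ _ _ _ _ _ snd _ fst).
exact: (@measurableT_comp _ _ _ _ _ _ fst _ fst).
Qed.

(* Lebesgue measure on C^n = R^(2n), as an iterated product measure. *)
Fixpoint lebesgue (n : nat) : {measure set (n.-tuple (plane R)) -> \bar R} :=
  match n with
  | 0 => dirac [tuple]
  | k.+1 => image_measure
      ((lebesgue k \x @lebesgue_measure R) \x @lebesgue_measure R)%E
      (@measurable_cons_coord k)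
  end.

Variable n : nat.

Lemma inv_volume_ge0 : 0 <= (fine (lebesgue n (@coord_ball R n)))^-1.
Proof. by rewrite invr_ge0 fine_ge0. Qed.

(* Lebesgue measure restricted to the ball, divided by the volume. *)
Definition ball_measure : {measure set (n.-tuple (plane R)) -> \bar R} :=
  mscale (NngNum inv_volume_ge0)
    (mrestr (lebesgue n) (@measurable_coord_ball R n)).

(* The normalized surface measure assigns to E the proportion of the volume of
   the ball that lies in the cone over E (integration in polar coordinates). *)
Definition sphere_measure : {measure set (n.-tuple (plane R)) -> \bar R} :=
  image_measure ball_measure (@measurable_radial_proj R n).

End lebesgue.

Section function_spaces.
Variables (R : realType) (n : nat).

(* A function on the ball is a total function on C^n whose values outside the
   ball are never used. *)
Local Notation cfun := ('rV[R[i]]_n -> R[i]).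
Local Notation coords := (n.-tuple (plane R)).

Definition holomorphic (f : cfun) : Prop :=
  forall z : 'rV[R[i]]_n, unit_ball z -> differentiable (f : _ -> R[i]^o) (z : 'rV[(R[i] : numFieldType)]_n).

Definition Hinfty : set cfun :=
  [set f | holomorphic f /\
    exists B : R, forall z : 'rV[R[i]]_n, unit_ball z -> Normc.normc (f z) <= B].

(* A space of holomorphic functions on the ball with its L^2 norm: [fs_val f] is
   the function integrated over [fs_dom] in place of f. *)
Record fspace := FSpace {
  fs_mem : set cfun;
  fs_dom : set coords;
  fs_measure : {measure set coords -> \bar R};
  fs_val : cfun -> coords -> R[i]
}.

Definition bergman : fspace := {|
  fs_mem := [set f | holomorphic f /\
    (\int[ball_measure R n]_(t in @coord_ball R n)
       (sqmod (f (complex_point t)))%:E < +oo)%E];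
  fs_dom := @coord_ball R n;
  fs_measure := ball_measure R n;
  fs_val := fun f t => f (complex_point t)
|}.

(* g is the boundary function of f: the dilates f(r .) tend to g in L^2 of the
   sphere as r tends to 1 from below. *)
Definition is_boundary_value (f : cfun) (g : coords -> R[i]) : Prop :=
  [/\ measurable_fun setT (fun t => complex.Re (g t)),
      measurable_fun setT (fun t => complex.Im (g t)) &
      (\int[sphere_measure R n]_(t in @coord_sphere R n)
         (sqmod (f (r%:C%C *: complex_point t) - g t))%:E)%E @[r --> (1 : R)^'-]
        --> 0%E].

Definition boundary_value (f : cfun) : coords -> R[i] :=
  xget (fun=> 0) [set g | is_boundary_value f g].

Definition hardy : fspace := {|
  fs_mem := [set f | holomorphic f /\
    exists B : R, forall r : R, 0 < r < 1 ->
      (\int[sphere_measure R n]_(t in @coord_sphere R n)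
         (sqmod (f (r%:C%C *: complex_point t)))%:E <= B%:E)%E];
  fs_dom := @coord_sphere R n;
  fs_measure := sphere_measure R n;
  fs_val := boundary_value
|}.

Section kernels.
Variable H : fspace.

Definition inner (f g : cfun) : R[i] :=
  let h t := fs_val H f t * (fs_val H g t)^*%C in
  (Rintegral (fs_measure H) (fs_dom H) (fun t => complex.Re (h t)) +i*
   Rintegral (fs_measure H) (fs_dom H) (fun t => complex.Im (h t)))%C.

Definition is_reproducing_kernel (a : 'rV[R[i]]_n) (k : cfun) : Prop :=
  fs_mem H k /\ forall f, fs_mem H f -> f a = inner f k.

Definition reproducing_kernel (a : 'rV[R[i]]_n) : cfun :=
  xget (fun=> 0) [set k | is_reproducing_kernel a k].

Definition normalized_kernel (a : 'rV[R[i]]_n) : cfun :=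
  fun z => reproducing_kernel a z / sqrtC (reproducing_kernel a a).

Definition weighted_sqnorm (M : nat) (a : 'I_M -> 'rV[R[i]]_n)
    (theta : 'I_M.+1 -> R) (h : cfun) : \bar R :=
  (\int[fs_measure H]_(t in fs_dom H)
     (sqmod (fs_val H h t) *
      (theta ord0 + \sum_(m < M) theta (lift ord0 m) *
         sqmod (fs_val H (normalized_kernel (a m)) t))%R)%:E)%E.

End kernels.

Definition corona_data (N : nat) (c : R) (phi : 'I_N -> cfun) : Prop :=
  [/\ (0 < N)%N, 0 < c, forall l, Hinfty (phi l) &
      forall z : 'rV[R[i]]_n, unit_ball z ->
        c ^+ 2 <= \big[Num.max/0]_(l < N) sqmod (phi l z) <= 1].

Definition corona_property : Prop :=
  forall (N : nat) (c : R) (phi : 'I_N -> cfun), corona_data c phi ->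
  exists (C : R) (f : 'I_N -> cfun),
    [/\ 0 < C, forall l, Hinfty (f l) &
        forall z : 'rV[R[i]]_n, unit_ball z ->
          \big[Num.max/0]_(l < N) sqmod (f l z) <= C ^+ 2 /\
          \sum_(l < N) phi l z * f l z = 1].

Definition convex_poisson_property (H : fspace) : Prop :=
  forall (N : nat) (c : R) (phi : 'I_N -> cfun), corona_data c phi ->
  exists C : R, 0 < C /\
  forall (M : nat) (a : 'I_M -> 'rV[R[i]]_n) (theta : 'I_M.+1 -> R),
    (0 < M)%N -> (forall m, unit_ball (a m)) ->
    (forall m, 0 <= theta m <= 1) -> \sum_(m < M.+1) theta m = 1 ->
  exists f : 'I_N -> cfun,
    [/\ forall l, fs_mem H (f l),
        (\sum_(l < N) weighted_sqnorm H a theta (f l) <= (C ^+ 2)%:E)%E &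
        forall z : 'rV[R[i]]_n, unit_ball z -> \sum_(l < N) phi l z * f l z = 1].

End function_spaces.

(* Main.v *)
(* Both Poisson properties are equivalent to the Corona Property because each of
   the two spaces H is a Hilbert space of holomorphic functions in which
     |f(a)|^2 k_a(a) <= int |f|^2 |k_a|^2                                       (J)
   for all f in H and all points a.

   Bounded corona solutions satisfy the weighted bounds since normalized kernels
   have norm one. Conversely, fix finitely many points. The bounds for all convex
   weights and a minimax argument give a single solution f = (f_l) of
   sum phi_l f_l = 1 whose norm and whose integrals of |f_l|^2 |k_a|^2 / k_a(a)
   at these points are bounded by a constant, so by (J) the values of f at these
   points are bounded too. The limit of these solutions along an ultrafilter on
   the finite sets of points is a bounded holomorphic solution.

   (J) is the Cauchy-Schwarz inequality for f(a) k_a(a) = <f k_a, k_a> when f k_a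
   is in H. In the Bergman space there is nothing to prove otherwise. In the Hardy
   space, f k_a is always in H because k_a is bounded: dilation by a number rho < 1
   is self-adjoint, hence k_(rho a') is the dilate of k_(a'). Boundary values exist
   since the mean squares N of f on the spheres satisfy
   ||f_r - f_s||^2 = N(r) + N(s) - 2 N(sqrt (r s)) and N increases. *)

Require Import Defs.
From HB Require Import structures.
From mathcomp Require Import all_boot all_order all_algebra.
From mathcomp Require Import all_classical all_reals all_analysis measurable_realfun.
From mathcomp Require Import complex ring lra.
Set Implicit Arguments.
Unset Strict Implicit.
Unset Printing Implicit Defensive.
Import Order.TTheory GRing.Theory Num.Theory numFieldNormedType.Exports.
Local Open Scope classical_set_scope.
Local Open Scope ring_scope.

(** * Complex numbers *)

(** Integrals over the ball and the sphere are never computed. Both measures come from Lebesgue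
    measure on the ball, which is invariant under z -> e^(i th) z, so an inequality between means
    over all circles { e^(i th) z } integrates to an inequality over the ball or the sphere. On one
    such circle f is a function of one variable, and what is needed there (the sub-mean value
    property, growth of the mean of |f|^2 with the radius, pairings that depend only on the product
    of the radii) comes from one fact: the real part of a holomorphic function has the same mean
    over concentric circles. This is Goursat's theorem for a rectangle, carried over by the
    exponential. The weight theta_0 keeps the norms of the solutions bounded and so bounds the
    solutions locally uniformly. This is what makes the limit along the ultrafilter, which is only a
    pointwise limit, holomorphic. The minimax argument is not applied to the integrals themselves,
    which may be infinite and are convex rather than affine in f, but to the set of their upper
    bounds. *)

Local Notation normc := Normc.normc.

Section complex_modulus.
Variable R : realType.
Implicit Types (x y z w : R[i]) (e : R).

Lemma normC_normc x : `|x| = (normc x)%:C%C.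
Proof. by []. Qed.

Lemma sqmodE x : sqmod x = complex.Re x ^+ 2 + complex.Im x ^+ 2.
Proof.
by case: x => a b; rewrite /sqmod /= sqr_sqrtr// addr_ge0// sqr_ge0.
Qed.

Lemma normc_ge0 x : 0 <= normc x.
Proof. by case: x => a b; rewrite /= sqrtr_ge0. Qed.

Lemma sqmod_ge0 x : 0 <= sqmod x.
Proof. exact: sqr_ge0. Qed.

Lemma sqmodM x y : sqmod (x * y) = sqmod x * sqmod y.
Proof. by rewrite /sqmod Normc.normcM exprMn. Qed.

Lemma sqmod_normc x : normc x = Num.sqrt (sqmod x).
Proof. by rewrite /sqmod sqrtr_sqr ger0_norm// normc_ge0. Qed.

Lemma normc_real (r : R) : normc (r%:C%C) = `|r|.
Proof. by rewrite /= expr0n/= addr0 sqrtr_sqr. Qed.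

Lemma sqmod_real (r : R) : sqmod (r%:C%C) = r ^+ 2.
Proof. by rewrite /sqmod normc_real real_normK// num_real. Qed.

Lemma normc_conj x : normc (x^*%C) = normc x.
Proof. by case: x => a b; rewrite /= sqrrN. Qed.

Lemma normc_geRe x : `|complex.Re x| <= normc x.
Proof.
case: x => a b /=; rewrite -[leLHS]ger0_norm// -sqrtr_sqr; apply: ler_wsqrtr.
by rewrite real_normK ?num_real// lerDl sqr_ge0.
Qed.

Lemma normc_geIm x : `|complex.Im x| <= normc x.
Proof.
case: x => a b /=; rewrite -[leLHS]ger0_norm// -sqrtr_sqr; apply: ler_wsqrtr.
by rewrite real_normK ?num_real// lerDr sqr_ge0.
Qed.

Lemma normc_le_ReIm x : normc x <= `|complex.Re x| + `|complex.Im x|.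
Proof.
rewrite sqmod_normc -[leRHS]ger0_norm ?addr_ge0// -sqrtr_sqr; apply: ler_wsqrtr.
rewrite sqmodE -(real_normK (num_real (complex.Re x))).
rewrite -(real_normK (num_real (complex.Im x))).
by have := mulr_ge0 (normr_ge0 (complex.Re x)) (normr_ge0 (complex.Im x)); nra.
Qed.

Lemma normc_eq0 x : normc x = 0 -> x = 0.
Proof. exact: Normc.eq0_normc. Qed.

Lemma normcD x y : normc (x + y) <= normc x + normc y.
Proof. exact: le_normcD. Qed.

Lemma normcB x y : normc (x - y) <= normc x + normc y.
Proof. by rewrite -(normcN y); exact: normcD. Qed.

Lemma normc_distC x y : normc (x - y) = normc (y - x).
Proof. by rewrite -normcN opprB. Qed.

Lemma normcX x k : normc (x ^+ k) = normc x ^+ k.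
Proof.
elim: k => [|k ih]; first by rewrite !expr0 Normc.normc1.
by rewrite !exprS Normc.normcM ih.
Qed.

Lemma ReD x y : complex.Re (x + y) = complex.Re x + complex.Re y.
Proof. by case: x; case: y. Qed.
Lemma ImD x y : complex.Im (x + y) = complex.Im x + complex.Im y.
Proof. by case: x; case: y. Qed.
Lemma ReN x : complex.Re (- x) = - complex.Re x.
Proof. by case: x. Qed.
Lemma ImN x : complex.Im (- x) = - complex.Im x.
Proof. by case: x. Qed.
Lemma ReM x y : complex.Re (x * y) =
  complex.Re x * complex.Re y - complex.Im x * complex.Im y.
Proof. by case: x; case: y. Qed.
Lemma ImM x y : complex.Im (x * y) =
  complex.Re x * complex.Im y + complex.Im x * complex.Re y.
Proof. by case: x; case: y. Qed.
Lemma Re_conj x : complex.Re (x^*%C) = complex.Re x.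
Proof. by case: x. Qed.
Lemma Im_conj x : complex.Im (x^*%C) = - complex.Im x.
Proof. by case: x. Qed.

Lemma conjcM x y : (x * y)^*%C = x^*%C * y^*%C.
Proof. exact: rmorphM. Qed.
Lemma conjcD x y : (x + y)^*%C = x^*%C + y^*%C.
Proof. exact: rmorphD. Qed.

Definition ReImE := (ReD, ImD, ReN, ImN, ReM, ImM, Re_conj, Im_conj).

Lemma complex_ext x y : complex.Re x = complex.Re y ->
  complex.Im x = complex.Im y -> x = y.
Proof. by case: x => a b; case: y => c d /= -> ->. Qed.

Lemma sqmodD_le2 x y : sqmod (x + y) <= 2 * sqmod x + 2 * sqmod y.
Proof.
rewrite !sqmodE !ReImE.
have := sqr_ge0 (complex.Re x - complex.Re y).
have := sqr_ge0 (complex.Im x - complex.Im y); nra.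
Qed.

(** The cross term is bounded by the weighted inequality 2uv <= e u^2 + v^2 / e. With e the ratio of
    two norms this becomes Minkowski's inequality in [enormD]. *)
Lemma sqmodD_eps x y e : 0 < e ->
  sqmod (x + y) <= (1 + e) * sqmod x + (1 + e^-1) * sqmod y.
Proof.
move=> e0; rewrite !sqmodE !ReImE.
set a := complex.Re x; set b := complex.Im x.
set c := complex.Re y; set d := complex.Im y.
have h u v : 2 * (u * v) <= e * u ^+ 2 + e^-1 * v ^+ 2.
  have -> : e * u ^+ 2 + e^-1 * v ^+ 2 = e^-1 * (e * u - v) ^+ 2 + 2 * (u * v).
    by field; rewrite gt_eqF.
  by rewrite lerDr mulr_ge0 ?sqr_ge0// invr_ge0 ltW.
have := h a c; have := h b d; lra.
Qed.

Lemma sqmodN x : sqmod (- x) = sqmod x.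
Proof. by rewrite /sqmod normcN. Qed.

Lemma sqmod_polar x y :
  sqmod (x + y) = sqmod x + sqmod y + 2 * complex.Re (x * y^*%C).
Proof. by rewrite !sqmodE !ReImE; ring. Qed.

Lemma sqmod0 : sqmod (0 : R[i]) = 0.
Proof. by rewrite /sqmod Normc.normc0 expr0n. Qed.

Lemma sqmod1 : sqmod (1 : R[i]) = 1.
Proof. by rewrite /sqmod Normc.normc1 expr1n. Qed.

Lemma sqmod_eq0 x : sqmod x = 0 -> x = 0.
Proof. by move/eqP; rewrite sqrf_eq0 => /eqP; exact: normc_eq0. Qed.

Lemma sqmod_le_normc x e : 0 <= e -> (sqmod x <= e ^+ 2) = (normc x <= e).
Proof. by move=> e0; rewrite /sqmod ler_sqr// nnegrE normc_ge0. Qed.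

(** The unit number u = conj x / |x| turns x into |x|. This reduces bounds on complex numbers to
    bounds on real parts, to which circle means and the real mean value theorem apply. *)
Lemma normc_le_dual x (b : R) :
  (forall u, normc u = 1 -> complex.Re (u * x) <= b) -> normc x <= b.
Proof.
move=> H; have [x0|x0] := eqVneq x 0.
  by rewrite {1}x0 Normc.normc0; apply: le_trans (H 1 (Normc.normc1 _)); rewrite x0 mulr0.
have nx : 0 < normc x.
  by rewrite lt0r normc_ge0 andbT; apply: contra x0 => /eqP/normc_eq0 ->.
pose u : R[i] := x^*%C / (normc x)%:C%C.
have hu : u * x = (normc x)%:C%C.
  rewrite /u mulrAC [_ * x]mulrC.
  have -> : x * x^*%C = (normc x)%:C%C * (normc x)%:C%C.
    have : normc x ^+ 2 = complex.Re x ^+ 2 + complex.Im x ^+ 2 := sqmodE x.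
    move: (normc x) => r hr; apply: complex_ext; rewrite !ReImE /=; last by ring.
    move: hr; set u1 := complex.Re x; set u2 := complex.Im x => hr; nra.
  by rewrite mulfK// eq_complex /= negb_and gt_eqF.
have := H u; rewrite hu /=; apply.
rewrite /u Normc.normcM Normc.normcV normc_conj normc_real ger0_norm ?normc_ge0//.
by rewrite divff// gt_eqF.
Qed.

End complex_modulus.

(** * Complex differentiability with real epsilon and delta *)

Section differentiable_epsilon.
Variables (R : realType) (V : normedModType R[i]).
Implicit Types (f : V -> R[i]^o).

(** Norms over [R[i]] have values in [R[i]], but a positive element of [R[i]] has imaginary part
    zero, so real radii suffice. *)
Lemma nbhs0P_real (P : V -> Prop) :
  (\forall h \near (0 : V), P h) <->
  exists2 d : R, 0 < d & forall h : V, `|h| < d%:C%C -> P h.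
Proof.
split.
  move=> /nbhs_ballP[e /= e0 He].
  have ee : e = (complex.Re e)%:C%C.
    by rewrite RRe_real// realE (ltW e0).
  exists (complex.Re e); first by rewrite -ltcR -ee.
  move=> h hh; apply: He; rewrite -ball_normE /ball_ /= sub0r normrN.
  by rewrite ee.
move=> [d d0 Hd]; apply/nbhs_ballP; exists (d%:C%C) => /=; first by rewrite ltcR.
by move=> h; rewrite -ball_normE /ball_ /= sub0r normrN => ?; exact: Hd.
Qed.

Lemma differentiable_epsP f (x : V) :
  differentiable f x <->
  exists L : {linear V -> R[i]^o}, continuous L /\
   forall e : R, 0 < e -> exists2 d : R, 0 < d &
     forall h : V, `|h| < d%:C%C ->
       (normc (f (x + h) - f x - L h))%:C%C <= e%:C%C * `|h|.
Proof.
split.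
  move=> df; exists ('d f x); split; first exact: diff_continuous.
  move=> e e0; have /diff_locallyP[_ /eqaddoP] := df.
  have ec : 0 < (e%:C%C : R[i]) by rewrite ltcR.
  move=> /(_ _ ec) /nbhs0P_real[d d0 Hd]; exists d => // h /Hd.
  by rewrite /= !fctE /= [h + x]addrC -normC_normc opprD addrA.
move=> [L [cL H]].
have E : f \o shift x = cst (f x) + (L : V -> R[i]^o) +o_ (0 : V) id.
  apply/eqaddoP => e e0; apply/nbhs0P_real.
  have ee : e = (complex.Re e)%:C%C by rewrite RRe_real// realE (ltW e0).
  have [|d d0 Hd] := H (complex.Re e); first by rewrite -ltcR -ee.
  exists d => // h /Hd; rewrite -ee /= !fctE /= [h + x]addrC -normC_normc.
  by rewrite opprD addrA.
have dL := diff_unique cL E.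
by apply/diff_locallyP; rewrite dL; split.
Qed.

Lemma linear_le_continuous (L : {linear V -> R[i]^o}) (K : R) :
  (forall h, (normc (L h))%:C%C <= K%:C%C * `|h|) -> continuous L.
Proof.
move=> LK; apply/linear_bounded_continuous/linear_boundedP.
exists `|K|%:C%C; split; first by rewrite ger0_real// ler0c.
move=> r /ltW Kr h; apply: le_trans (LK h) _.
apply: ler_wpM2r => //; apply: le_trans Kr.
by rewrite lecR ler_norm.
Qed.

End differentiable_epsilon.

Section near_real.
Variables (R : realType).

Lemma near_normedP (V : normedModType R[i]) (x : V) (P : V -> Prop) :
  (\forall y \near x, P y) <->
  exists2 d : R, 0 < d & forall y : V, `|y - x| < d%:C%C -> P y.
Proof.
split.
  move=> /nbhs_ballP[e /= e0 He].
  have ee : e = (complex.Re e)%:C%C by rewrite RRe_real// realE (ltW e0).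
  exists (complex.Re e); first by rewrite -ltcR -ee.
  by move=> y hy; apply: He; rewrite -ball_normE /ball_ /= ee distrC.
move=> [d d0 Hd]; apply/nbhs_ballP; exists (d%:C%C) => /=; first by rewrite ltcR.
by move=> y; rewrite -ball_normE /ball_ /= distrC => ?; exact: Hd.
Qed.

Lemma near_complexP (x : R[i]) (P : R[i] -> Prop) :
  (\forall y \near (x : R[i]^o), P y) <->
  exists2 d : R, 0 < d & forall y, normc (y - x) < d -> P y.
Proof.
split=> [/near_normedP[d d0 Hd]|[d d0 Hd]].
  by exists d => // y; rewrite -ltcR; exact: Hd.
by apply/near_normedP; exists d => // y hy; apply: Hd; rewrite -ltcR.
Qed.

Lemma cvg_complexP (T : Type) (F : set_system T) (f : T -> R[i]) (l : R[i]) :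
  Filter F -> (f @ F --> (l : R[i]^o)) <->
  forall e : R, 0 < e -> \forall x \near F, normc (f x - l) <= e.
Proof.
move=> FF; split=> [h0 e e0|h].
  have h := (@cvgrPdist_le _ _ _ F _ (f : T -> R[i]^o) (l : R[i]^o)).1 h0.
  have := h FF e%:C%C; rewrite ltcR => /(_ e0); apply: filterS => x.
  by rewrite distrC normC_normc lecR.
apply: ((@cvgrPdist_le _ _ _ F _ (f : T -> R[i]^o) (l : R[i]^o)).2 _) => e e0.
have ee : e = (complex.Re e)%:C%C by rewrite RRe_real// realE (ltW e0).
move: e0; rewrite ee ltcR => /h; apply: filterS => x.
by rewrite distrC normC_normc lecR.
Qed.

End near_real.

(** * Goursat's theorem for rectangles *)

Section segment_integral.
Variable R : realType.
Local Notation mu := (@lebesgue_measure R).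
Implicit Types (f g : R -> R) (a b c x y e : R).

Definition segint f a b : R := (\int[mu]_(x in `[a, b]) f x)%R.

(** Continuity relative to the segment, spelled out so that restriction to a subsegment is
    immediate; [segcont_integrable] translates it into the subspace topology. *)
Definition segcont f a b := forall x, a <= x <= b -> forall e, 0 < e ->
  exists2 d : R, 0 < d & forall y, a <= y <= b -> `|y - x| < d -> `|f y - f x| <= e.

Lemma segcont_integrable f a b : segcont f a b ->
  mu.-integrable `[a, b] (EFin \o f).
Proof.
move=> fc; apply: continuous_compact_integrable; first exact: segment_compact.
apply/subspace_continuousP => x; rewrite /= in_itv /= => xab.
apply/cvgrPdist_le => e e0; have [d d0 H] := fc x xab e e0.
apply/nbhs_ballP; exists d => //= y; rewrite /ball /= => xy; rewrite in_itv /= => yab.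
by rewrite distrC; apply: H => //; rewrite distrC.
Qed.

Lemma segcont_sub f a b c d : a <= c -> d <= b -> segcont f a b -> segcont f c d.
Proof.
move=> ac db H x /andP[cx xd] e e0.
have [|k k0 Hk] := H x _ e e0; first by rewrite (le_trans ac)//= (le_trans xd).
exists k => // y /andP[cy yd]; apply: Hk.
by rewrite (le_trans ac)//= (le_trans yd).
Qed.

Lemma segint_split f a b m : a <= m <= b -> segcont f a b ->
  segint f a b = segint f a m + segint f m b.
Proof.
move=> /andP[am mb] fc.
have fi := segcont_integrable fc.
rewrite /segint -(@Rintegral_itv_obnd_cbnd _ m (BRight b)); last first.
  apply: integrableS fi => //.
  by move=> y /=; rewrite !in_itv /= => /andP[/ltW/(le_trans am) -> ->].
rewrite -[X in _ = _ + X](@Rintegral_itvB R f (BLeft a) (BRight b) m) //.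
by rewrite addrC subrK.
Qed.

Lemma segcontD f g a b : segcont f a b -> segcont g a b ->
  segcont (fun x => f x + g x) a b.
Proof.
move=> fc gc x xab e e0; have e2 : 0 < e / 2 by rewrite divr_gt0.
have [d d0 Hd] := fc x xab _ e2; have [k k0 Hk] := gc x xab _ e2.
exists (Num.min d k); first by rewrite lt_min d0.
move=> y yab; rewrite lt_min => /andP[/(Hd y yab) h1 /(Hk y yab) h2].
by rewrite opprD addrACA (le_trans (ler_normD _ _))//; lra.
Qed.

Lemma segcontN f a b : segcont f a b -> segcont (fun x => - f x) a b.
Proof.
move=> fc x xab e e0; have [d d0 Hd] := fc x xab e e0.
by exists d => // y yab /(Hd y yab); rewrite -opprD normrN.
Qed.

Lemma segcont_cst (k : R) a b : segcont (fun=> k) a b.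
Proof. by move=> x _ e e0; exists 1 => // y _ _; rewrite subrr normr0 ltW. Qed.

Lemma segcontZ k f a b : segcont f a b -> segcont (fun x => k * f x) a b.
Proof.
move=> fc x xab e e0; have k0 : 0 < `|k| + 1 by rewrite ltr_wpDl.
have [d d0 Hd] := fc x xab (e / (`|k| + 1)) (divr_gt0 e0 k0).
exists d => // y yab /(Hd y yab) h; rewrite -mulrBr normrM.
rewrite (le_trans (ler_wpM2l (normr_ge0 k) h))//.
rewrite mulrCA ler_piMr ?ltW// ltr_pdivrMr ?mul1r//; lra.
Qed.

Lemma segint_near f a b k e : a <= b -> segcont f a b ->
  (forall x, a <= x <= b -> `|f x - k| <= e) ->
  `|segint f a b - k * (b - a)| <= e * (b - a).
Proof.
move=> ab fc H; have fi := segcont_integrable fc.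
have cstint r : mu.-integrable `[a, b] (EFin \o (fun=> r)).
  exact/segcont_integrable/segcont_cst.
have E r : \int[mu]_(x in `[a, b]) r = r * (b - a).
  rewrite Rintegral_cst//= lebesgue_measure_itv /= lte_fin.
  case: ltgtP ab => [ab _|//|-> _] /=; first by [].
  by rewrite subrr mulr0.
have h : segint f a b <= (k + e) * (b - a).
  rewrite -E; apply: le_Rintegral => // x; rewrite /= in_itv /= => /H.
  by rewrite ler_distl => /andP[].
have h' : (k - e) * (b - a) <= segint f a b.
  rewrite -E; apply: le_Rintegral => // x; rewrite /= in_itv /= => /H.
  by rewrite ler_distl => /andP[].
by rewrite ler_norml; apply/andP; split; lra.
Qed.

Lemma segintD f g a b : segcont f a b -> segcont g a b ->
  segint (fun x => f x + g x) a b = segint f a b + segint g a b.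
Proof.
by move=> fc gc; rewrite /segint RintegralD//; exact: segcont_integrable.
Qed.

Lemma segintZ k f a b : segcont f a b ->
  segint (fun x => k * f x) a b = k * segint f a b.
Proof. by move=> fc; rewrite /segint RintegralZl//; exact: segcont_integrable. Qed.

Lemma segintB f g a b : segcont f a b -> segcont g a b ->
  segint (fun x => f x - g x) a b = segint f a b - segint g a b.
Proof.
by move=> fc gc; rewrite /segint RintegralB//; exact: segcont_integrable.
Qed.

Lemma eq_segint f g a b : (forall x, a <= x <= b -> f x = g x) ->
  segint f a b = segint g a b.
Proof.
move=> H; apply: eq_Rintegral => x; rewrite inE /= in_itv /=; exact: H.
Qed.

Lemma segint_le f g a b : segcont f a b -> segcont g a b ->
  (forall x, a <= x <= b -> f x <= g x) -> segint f a b <= segint g a b.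
Proof.
by move=> fc gc H; apply: le_Rintegral => //; exact: segcont_integrable.
Qed.

End segment_integral.

Section bisection.
Variable R : realType.
Implicit Types (a b c d x y e : R).

Let mid a b := (a + b) / 2.

(** If P failed, it would fail on a quarter of the rectangle, then on a quarter of that quarter, and
    so on. These nested rectangles shrink to a point (x, y), where the local hypothesis contradicts
    the failure. *)
Lemma bisection (P : R -> R -> R -> R -> Prop) a b c d : a <= b -> c <= d ->
  (forall a b c d, a <= b -> c <= d ->
    P a (mid a b) c (mid c d) -> P (mid a b) b c (mid c d) ->
    P a (mid a b) (mid c d) d -> P (mid a b) b (mid c d) d -> P a b c d) ->
  (forall x y, a <= x <= b -> c <= y <= d -> exists2 e : R, 0 < e &
    forall a' b' c' d', a <= a' -> b' <= b -> c <= c' -> d' <= d ->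
      a' <= x <= b' -> c' <= y <= d' -> b' - a' <= e -> d' - c' <= e ->
      P a' b' c' d') -> P a b c d.
Proof.
move=> ab cd Pglue Ploc; apply: contrapT => nP.
pose rect := (R * R * R * R)%type.
pose Pr (r : rect) := P r.1.1.1 r.1.1.2 r.1.2 r.2.
pose ok (r : rect) := r.1.1.1 <= r.1.1.2 /\ r.1.2 <= r.2.
have half u v : u <= v -> (u <= mid u v /\ mid u v <= v) /\
    (mid u v - u = (v - u) / 2 /\ v - mid u v = (v - u) / 2).
  by rewrite /mid => uv; split; split; lra.
(* The claim is made for every r, with r itself as a dummy witness when the premises fail, so that
   [choice] yields a total function to iterate. *)
have step (r : rect) : exists r' : rect, ok r -> ~ Pr r -> [/\ ok r', ~ Pr r',
    r.1.1.1 <= r'.1.1.1 /\ r'.1.1.2 <= r.1.1.2,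
    r.1.2 <= r'.1.2 /\ r'.2 <= r.2 &
    r'.1.1.2 - r'.1.1.1 = (r.1.1.2 - r.1.1.1) / 2 /\
    r'.2 - r'.1.2 = (r.2 - r.1.2) / 2].
  have [okr|] := pselect (ok r); last by exists r.
  have [Pr'|nPr] := pselect (Pr r); first by exists r.
  case: r okr nPr => [[[a0 b0] c0] d0] [/= ab0 cd0] nPr.
  have [[h1 h2] [h3 h4]] := half _ _ ab0; have [[k1 k2] [k3 k4]] := half _ _ cd0.
  apply: contrapT => nex; apply: nPr; apply: Pglue => //;
    apply: contrapT => nQ; apply: nex.
  - by exists (a0, mid a0 b0, c0, mid c0 d0) => _ _; split.
  - by exists (mid a0 b0, b0, c0, mid c0 d0) => _ _; split.
  - by exists (a0, mid a0 b0, mid c0 d0, d0) => _ _; split.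
  - by exists (mid a0 b0, b0, mid c0 d0, d0) => _ _; split.
have [next Hnext] := choice step.
pose s k := iter k next (a, b, c, d).
have sok k : ok (s k) /\ ~ Pr (s k).
  elim: k => [//|k [okk nPk]]; rewrite /s /=.
  by have [] := Hnext _ okk nPk.
have sS k := let: conj o p := sok k in Hnext (s k) o p.
have sl k : (s k).1.1.2 - (s k).1.1.1 = (b - a) / 2 ^+ k /\
            (s k).2 - (s k).1.2 = (d - c) / 2 ^+ k.
  elim: k => [|k [ih1 ih2]]; first by rewrite expr0 !divr1.
  have [_ _ _ _ [-> ->]] := sS k.
  by rewrite ih1 ih2 exprSr; split; rewrite invfM mulrA.
have mono k j : (s k).1.1.1 <= (s (k + j)%N).1.1.1 /\
   (s (k + j)%N).1.1.2 <= (s k).1.1.2 /\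
   (s k).1.2 <= (s (k + j)%N).1.2 /\ (s (k + j)%N).2 <= (s k).2.
  elim: j => [|j [i1 [i2 [i3 i4]]]]; first by rewrite addn0.
  rewrite addnS; have [_ _ [j1 j2] [j3 j4] _] := sS (k + j)%N.
  by split; [|split; [|split]]; [exact: le_trans j1|exact: le_trans i2
    |exact: le_trans j3|exact: le_trans i4].
have cross k l : (s k).1.1.1 <= (s l).1.1.2 /\ (s k).1.2 <= (s l).2.
  have [m1 [_ [m3 _]]] := mono k l; have [_ [m2 [_ m4]]] := mono l k.
  have [[q1 q2] _] := sok (k + l)%N; rewrite addnC in m2 m4.
  by split; [exact: le_trans m1 (le_trans q1 m2)|exact: le_trans m3 (le_trans q2 m4)].
(* The common point is the supremum of the left edges and of the lower edges; [cross] says that each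
   left edge is below every right edge. *)
pose A := [set (s k).1.1.1 | k in setT]; pose B := [set (s k).1.2 | k in setT].
have supA : has_sup A.
  by split; [exists (s 0).1.1.1; exists 0%N|exists (s 0).1.1.2 => _ [k _ <-];
    case: (cross k 0)].
have supB : has_sup B.
  by split; [exists (s 0).1.2; exists 0%N|exists (s 0).2 => _ [k _ <-];
    case: (cross k 0)].
pose x := sup A; pose y := sup B.
have xk k : (s k).1.1.1 <= x <= (s k).1.1.2.
  apply/andP; split; first by apply: ub_le_sup; [case: supA|exists k].
  by apply: ge_sup; [case: supA|move=> _ [l _ <-]; case: (cross l k)].
have yk k : (s k).1.2 <= y <= (s k).2.
  apply/andP; split; first by apply: ub_le_sup; [case: supB|exists k].
  by apply: ge_sup; [case: supB|move=> _ [l _ <-]; case: (cross l k)].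
have [e e0 He] := Ploc x y (xk 0%N) (yk 0%N).
have small t : 0 <= t -> exists k0, forall k, (k0 <= k)%N -> t / 2 ^+ k <= e.
  move=> t0; exists (Num.trunc (t / e)).+1 => k kk.
  rewrite ler_pdivrMr ?exprn_gt0// mulrC -ler_pdivrMr//.
  have : t / e < (Num.trunc (t / e)).+1%:R by exact: truncnS_gt.
  move=> /ltW/le_trans; apply; rewrite -natrX ler_nat.
  by rewrite (leq_trans kk)// ltnW// ltn_expl.
have [k1 K1] := small _ (ltac:(by rewrite subr_ge0) : 0 <= b - a).
have [k2 K2] := small _ (ltac:(by rewrite subr_ge0) : 0 <= d - c).
pose k := maxn k1 k2.
have [_ nPk] := sok k; apply: nPk.
have [m1 [m2 [m3 m4]]] := mono 0%N k; rewrite add0n in m1 m2 m3 m4.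
have [l1 l2] := sl k.
apply: He => //; first by rewrite l1 K1// leq_maxl.
by rewrite l2 K2// leq_maxr.
Qed.

End bisection.

Section goursat.
Variable R : realType.
Implicit Types (P Q : R -> R -> R) (a b c d x y e : R).

(** The integral of P dx + Q dy counterclockwise around the rectangle. Opposite edges are paired,
    since the differences of their integrands are what differentiability controls. *)
Definition bdint P Q a b c d : R :=
  segint (fun x => P x c - P x d) a b + segint (fun y => Q b y - Q a y) c d.

(* The form P dx + Q dy has a symmetric derivative at (x0, y0). *)
Definition closed_form_at P Q a b c d x0 y0 := exists al be ga : R,
  forall e, 0 < e -> exists2 k : R, 0 < k & forall x y,
   a <= x <= b -> c <= y <= d -> `|x - x0| <= k -> `|y - y0| <= k ->
   `|P x y - P x0 y0 - al * (x - x0) - be * (y - y0)|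
      <= e * (`|x - x0| + `|y - y0|) /\
   `|Q x y - Q x0 y0 - be * (x - x0) - ga * (y - y0)|
      <= e * (`|x - x0| + `|y - y0|).

Variables (P Q : R -> R -> R) (a b c d : R).
Hypotheses (ab : a <= b) (cd : c <= d).
Hypothesis closedPQ : forall x y, a <= x <= b -> c <= y <= d ->
  closed_form_at P Q a b c d x y.

Let near_bound (al be u v e k l: R) : `|u| <= l -> `|v| <= l -> 0 < e ->
  l * (`|al| + `|be| + 2 * e) <= k ->
  forall w, `|w - al * u - be * v| <= e * (`|u| + `|v|) -> `|w| <= k.
Proof.
move=> ul vl e0 kE w h.
rewrite (_ : w = (w - al * u - be * v) + (al * u + be * v)); last by ring.
apply: le_trans (ler_normD _ _) _.
apply: le_trans (lerD h (ler_normD _ _)) _; rewrite !normrM.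
have := ler_wpM2l (normr_ge0 al) ul; have := ler_wpM2l (normr_ge0 be) vl.
have := ler_wpM2l (ltW e0) ul; have := ler_wpM2l (ltW e0) vl; lra.
Qed.

Let cont0 x y e : a <= x <= b -> c <= y <= d -> 0 < e ->
  exists2 k : R, 0 < k & forall x' y', a <= x' <= b -> c <= y' <= d ->
   `|x' - x| <= k -> `|y' - y| <= k ->
   `|P x' y' - P x y| <= e /\ `|Q x' y' - Q x y| <= e.
Proof.
move=> xab ycd e0; have [al [be [ga /(_ _ ltr01)[k k0 Hk]]]] := closedPQ xab ycd.
pose S := `|al| + `|be| + `|ga| + 2.
have S0 : 0 < S by rewrite ltr_wpDl// !addr_ge0.
exists (Num.min k (e / S)); first by rewrite lt_min k0 divr_gt0.
move=> x' y' x'ab y'cd; rewrite !le_min => /andP[x1 x2] /andP[y1 y2].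
have [h1 h2] := Hk x' y' x'ab y'cd x1 y1.
have eS : e / S * S = e by rewrite divfK// gt_eqF.
have eS0 : 0 <= e / S by rewrite divr_ge0// ltW.
have le1 : e / S * (`|al| + `|be| + 2 * 1) <= e.
  rewrite -[leRHS]eS; apply: ler_wpM2l => //; rewrite /S.
  by have := normr_ge0 ga; lra.
have le2 : e / S * (`|be| + `|ga| + 2 * 1) <= e.
  rewrite -[leRHS]eS; apply: ler_wpM2l => //; rewrite /S.
  by have := normr_ge0 al; lra.
by split; [exact: (near_bound x2 y2 ltr01 le1)|exact: (near_bound x2 y2 ltr01 le2)].
Qed.

Lemma closed_form_segcont x y : a <= x <= b -> c <= y <= d ->
  [/\ segcont (P^~ y) a b, segcont (Q x) c d, segcont (Q^~ y) a b & segcont (P x) c d].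
Proof.
move=> xab ycd; split=> [u uab|v vcd|u uab|v vcd] e e0.
- have [k k0 H] := cont0 uab ycd e0; exists k => // u' u'ab uk.
  by case: (H u' y u'ab ycd (ltW uk)) => //; rewrite subrr normr0 ltW.
- have [k k0 H] := cont0 xab vcd e0; exists k => // u' u'ab uk.
  by case: (H x u' xab u'ab _ (ltW uk)) => //; rewrite subrr normr0 ltW.
- have [k k0 H] := cont0 uab ycd e0; exists k => // u' u'ab uk.
  by case: (H u' y u'ab ycd (ltW uk)) => //; rewrite subrr normr0 ltW.
- have [k k0 H] := cont0 xab vcd e0; exists k => // u' u'ab uk.
  by case: (H x u' xab u'ab _ (ltW uk)) => //; rewrite subrr normr0 ltW.
Qed.

Let segc x y : a <= x <= b -> c <= y <= d ->
  segcont (P^~ y) a b /\ segcont (Q x) c d.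
Proof. by move=> h k; case: (closed_form_segcont h k). Qed.

(** Each inner edge is traversed twice, in opposite directions. *)
Let bdint_glue a' b' c' d' : a <= a' -> a' <= b' -> b' <= b ->
    c <= c' -> c' <= d' -> d' <= d ->
  let m := (a' + b') / 2 in let n := (c' + d') / 2 in
  bdint P Q a' b' c' d' = (bdint P Q a' m c' n + bdint P Q m b' c' n) +
    (bdint P Q a' m n d' + bdint P Q m b' n d').
Proof.
move=> aa ab' bb cc cd' dd m n.
have am : a' <= m by rewrite /m; lra.
have mb : m <= b' by rewrite /m; lra.
have cn : c' <= n by rewrite /n; lra.
have nd : n <= d' by rewrite /n; lra.
have I u : a' <= u <= b' -> a <= u <= b.
  by move=> /andP[? ?]; rewrite (le_trans aa)//= (le_trans _ bb).
have J u : c' <= u <= d' -> c <= u <= d.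
  by move=> /andP[? ?]; rewrite (le_trans cc)//= (le_trans _ dd).
have a0 : a <= a by []. have c0 : c <= c by [].
have Ia : a <= a <= b by rewrite lexx ab.
have Ic : c <= c <= d by rewrite lexx cd.
have sP u v y : a' <= u -> v <= b' -> c' <= y <= d' -> segcont (P^~ y) u v.
  move=> ? ? /J yy; have [+ _] := segc Ia yy; apply: segcont_sub.
    exact: le_trans aa _.
  exact: le_trans _ bb.
have sQ u v x : c' <= u -> v <= d' -> a' <= x <= b' -> segcont (Q x) u v.
  move=> ? ? /I xx; have [_ +] := segc xx Ic; apply: segcont_sub.
    exact: le_trans cc _.
  exact: le_trans _ dd.
have [ya yn yd] : [/\ c' <= c' <= d', c' <= n <= d' & c' <= d' <= d'].
  by rewrite !lexx cd' cn nd.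
have [xa xm xb] : [/\ a' <= a' <= b', a' <= m <= b' & a' <= b' <= b'].
  by rewrite !lexx ab' am mb.
rewrite /bdint !segintB; do ?[by apply: sP|by apply: sQ].
rewrite (@segint_split _ (P^~ c') a' b' m)//; last exact: sP.
rewrite (@segint_split _ (P^~ d') a' b' m)//; last exact: sP.
rewrite (@segint_split _ (Q b') c' d' n)//; last exact: sQ.
rewrite (@segint_split _ (Q a') c' d' n)//; last exact: sQ.
ring.
Qed.

(** The squared half-perimeter takes the place of the area in Goursat's argument: it is the sum of
    its values on the four quarters, so a bound by e times it passes from the quarters to the whole.
    On a small rectangle the bound comes from the first-order expansion of the form. *)
Lemma goursat_rectangle : bdint P Q a b c d = 0.
Proof.
suff H e : 0 < e -> `|bdint P Q a b c d| <= e * ((b - a) + (d - c)) ^+ 2.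
  apply/eqP; rewrite -normr_le0; apply/ler_addgt0Pr => e e0; rewrite add0r.
  pose S := ((b - a) + (d - c)) ^+ 2 + 1.
  have S0 : 0 < S by rewrite ltr_wpDl// sqr_ge0.
  apply: le_trans (H (e / S) (divr_gt0 e0 S0)) _.
  rewrite mulrAC ler_pdivrMr// ler_wpM2l ?ltW// /S; lra.
move=> e0.
pose G a' b' c' d' := a <= a' -> b' <= b -> c <= c' -> d' <= d ->
  `|bdint P Q a' b' c' d'| <= e * ((b' - a') + (d' - c')) ^+ 2.
suff : G a b c d by apply.
apply: bisection => //.
  move=> a' b' c' d' ab' cd' g1 g2 g3 g4 aa bb cc dd.
  rewrite bdint_glue//.
  move: g1 g2 g3 g4; rewrite /G; set m := (a' + b') / 2; set n := (c' + d') / 2.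
  have am : a' <= m by rewrite /m; lra.
  have mb : m <= b' by rewrite /m; lra.
  have cn : c' <= n by rewrite /n; lra.
  have nd : n <= d' by rewrite /n; lra.
  have h1 := le_trans aa am. have h2 := le_trans mb bb.
  have h3 := le_trans cc cn. have h4 := le_trans nd dd.
  move=> /(_ aa h2 cc h4) g1 /(_ h1 bb cc h4) g2 /(_ aa h2 h3 dd) g3.
  move=> /(_ h1 bb h3 dd) g4.
  have e1 : m - a' = (b' - a') / 2 by rewrite /m; lra.
  have e2 : b' - m = (b' - a') / 2 by rewrite /m; lra.
  have e3 : n - c' = (d' - c') / 2 by rewrite /n; lra.
  have e4 : d' - n = (d' - c') / 2 by rewrite /n; lra.
  rewrite e1 e3 in g1; rewrite e2 e3 in g2; rewrite e1 e4 in g3; rewrite e2 e4 in g4.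
  apply: le_trans (ler_normD _ _) _.
  apply: le_trans (lerD (ler_normD _ _) (ler_normD _ _)) _.
  apply: le_trans (lerD (lerD g1 g2) (lerD g3 g4)) _.
  by rewrite le_eqVlt; apply/orP; left; apply/eqP; field.
move=> x0 y0 x0ab y0cd; have [al [be [ga H]]] := closedPQ x0ab y0cd.
have e2 : 0 < e / 2 by rewrite divr_gt0.
have [k k0 Hk] := H _ e2; exists k => //.
move=> a' b' c' d' aa bb cc dd /andP[ax xb] /andP[cy yd] wk hk _ _ _ _.
set w := b' - a' in wk *; set h := d' - c' in hk *.
have ab' : a' <= b' by exact: le_trans ax xb.
have cd' : c' <= d' by exact: le_trans cy yd.
have w0 : 0 <= w by rewrite subr_ge0.
have h0 : 0 <= h by rewrite subr_ge0.
have I u : a' <= u <= b' -> a <= u <= b.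
  by move=> /andP[? ?]; rewrite (le_trans aa)//= (le_trans _ bb).
have J u : c' <= u <= d' -> c <= u <= d.
  by move=> /andP[? ?]; rewrite (le_trans cc)//= (le_trans _ dd).
have Ix u : a' <= u <= b' -> `|u - x0| <= w.
  by move=> /andP[? ?]; rewrite ler_norml /w; apply/andP; split; lra.
have Jy u : c' <= u <= d' -> `|u - y0| <= h.
  by move=> /andP[? ?]; rewrite ler_norml /h; apply/andP; split; lra.
have [ya yd'] : c' <= c' <= d' /\ c' <= d' <= d' by rewrite !lexx cd'.
have [xa xb'] : a' <= a' <= b' /\ a' <= b' <= b' by rewrite !lexx ab'.
have Ia : a <= a <= b by rewrite lexx ab.
have Ic : c <= c <= d by rewrite lexx cd.
have near x y : a' <= x <= b' -> c' <= y <= d' ->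
  `|P x y - P x0 y0 - al * (x - x0) - be * (y - y0)| <= e / 2 * (w + h) /\
  `|Q x y - Q x0 y0 - be * (x - x0) - ga * (y - y0)| <= e / 2 * (w + h).
  move=> xx yy.
  have [g1 g2] := Hk x y (I _ xx) (J _ yy) (le_trans (Ix _ xx) wk) (le_trans (Jy _ yy) hk).
  have le : e / 2 * (`|x - x0| + `|y - y0|) <= e / 2 * (w + h).
    by apply: ler_wpM2l; [exact: ltW|apply: lerD; [exact: Ix|exact: Jy]].
  by split; [exact: le_trans g1 le|exact: le_trans g2 le].
have tri (u v E : R) : `|u| <= E -> `|v| <= E -> `|u - v| <= E + E.
  by move=> ? ?; apply: le_trans (ler_normB _ _) _; exact: lerD.
have sP y : c' <= y <= d' -> segcont (P^~ y) a' b'.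
  by move=> /J yy; have [+ _] := segc Ia yy; exact: segcont_sub.
have sQ x : a' <= x <= b' -> segcont (Q x) c' d'.
  by move=> /I xx; have [_ +] := segc xx Ic; exact: segcont_sub.
(* On two opposite edges the affine parts of the form differ by a constant, - be h for P and be w
   for Q. Integrated over lengths w and h these cancel because both expansions have the same
   coefficient be. *)
have B1 : `|segint (fun x => P x c' - P x d') a' b' - (- (be * h)) * w|
   <= e * (w + h) * w.
  apply: segint_near => //.
    by apply: segcontD; [exact: sP|apply: segcontN; exact: sP].
  move=> x xx; have [n1 _] := near x c' xx ya; have [n2 _] := near x d' xx yd'.
  have := tri _ _ _ n1 n2.
  rewrite (_ : _ - _ - (_ - _ - _ - _) = P x c' - P x d' - - (be * h)).
    by move=> /le_trans; apply; lra.
  by rewrite /h; ring.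
have B2 : `|segint (fun y => Q b' y - Q a' y) c' d' - (be * w) * h|
   <= e * (w + h) * h.
  apply: segint_near => //.
    by apply: segcontD; [exact: sQ|apply: segcontN; exact: sQ].
  move=> y yy; have [_ n1] := near b' y xb' yy; have [_ n2] := near a' y xa yy.
  have := tri _ _ _ n1 n2.
  rewrite (_ : _ - _ - (_ - _ - _ - _) = Q b' y - Q a' y - be * w).
    by move=> /le_trans; apply; lra.
  by rewrite /w; ring.
rewrite /bdint.
set A := segint _ _ _ in B1 *; set B := segint _ _ _ in B2 *.
rewrite (_ : A + B = (A - - (be * h) * w) + (B - be * w * h)); last by ring.
apply: le_trans (ler_normD _ _) _; apply: le_trans (lerD B1 B2) _.
by rewrite le_eqVlt; apply/orP; left; apply/eqP; ring.
Qed.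

End goursat.

(** * Holomorphic functions of one variable *)

Section real_derivative.
Variable R : realType.
Implicit Types (f : R -> R) (x d e : R).

Lemma is_derive_epsP f x d : is_derive x 1 f d <->
  forall e, 0 < e -> exists2 k : R, 0 < k & forall h, `|h| < k ->
    `|f (x + h) - f x - d * h| <= e * `|h|.
Proof.
split.
  move=> [df dE] e e0; move/derivable1_diffP : (df) => dff.
  have /diff_locallyP[_ /eqaddoP/(_ _ e0)/nbhs_ballP[k /= k0 Hk]] := dff.
  exists k => // h hk; have := Hk h; rewrite /ball /= sub0r normrN => /(_ hk).
  rewrite !fctE /= [h + x]addrC deriv1E// derive1E dE opprD addrA.
  by rewrite -[h *: d]/(h * d) mulrC.
move=> H.
have E : h^-1 *: ((f \o shift x) (h *: 1) - f x) @[h --> 0^'] --> d.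
  apply/cvgrPdist_le => e e0; have [k k0 Hk] := H e e0.
  apply/nbhs_ballP; exists k => //= h; rewrite /ball /= sub0r normrN => hk h0.
  have {}Hk := Hk h hk; rewrite -[h *: 1]/(h * 1) mulr1 [h + x]addrC.
  have h0' : 0 < `|h| by rewrite normr_gt0.
  rewrite -(ler_pM2l h0') -normrM [leRHS]mulrC; apply: le_trans Hk.
  rewrite -normrN le_eqVlt; apply/orP; left; apply/eqP; congr (`| _ |).
  by rewrite -[_ *: (_ - _)]/(_ * (_ - _)); field.
by split; [exact: cvgP E|exact: cvg_lim E].
Qed.

Lemma expR0_eps e : 0 < e -> exists2 k : R, 0 < k & forall h : R, `|h| < k ->
  `|expR h - 1 - h| <= e * `|h|.
Proof.
move=> e0; have /is_derive_epsP/(_ e e0)[k k0 Hk] := is_derive_expR (0 : R).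
by exists k => // h /Hk; rewrite add0r expR0 mul1r.
Qed.

Lemma cos0_eps e : 0 < e -> exists2 k : R, 0 < k & forall h : R, `|h| < k ->
  `|cos h - 1| <= e * `|h|.
Proof.
move=> e0; have /is_derive_epsP/(_ e e0)[k k0 Hk] := is_derive_cos (0 : R).
by exists k => // h /Hk; rewrite add0r cos0 sin0 oppr0 mul0r subr0.
Qed.

Lemma sin0_eps e : 0 < e -> exists2 k : R, 0 < k & forall h : R, `|h| < k ->
  `|sin h - h| <= e * `|h|.
Proof.
move=> e0; have /is_derive_epsP/(_ e e0)[k k0 Hk] := is_derive_sin (0 : R).
by exists k => // h /Hk; rewrite add0r cos0 sin0 subr0 mul1r.
Qed.

End real_derivative.

Notation cdiff g w := (differentiable (g : _^o -> _^o) (w : _^o)).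

Section complex_derivative.
Variable R : realType.
Local Notation C := R[i].
Implicit Types (g : C -> C) (w d h : C).

Lemma scalelc_continuous (d : C) : continuous ( *:%R^~ d : C^o -> C^o).
Proof. exact: scalel_continuous. Qed.

Definition has_cderiv g w d := forall e : R, 0 < e -> exists2 k : R, 0 < k &
  forall h, normc h < k -> normc (g (w + h) - g w - h * d) <= e * normc h.

Lemma cdiffP g w : cdiff g w <-> exists d, has_cderiv g w d.
Proof.
split.
  move=> /differentiable_epsP[L [_ H]]; exists (L (1 : C^o)) => e /H[k k0 Hk].
  exists k => // h hk; rewrite -lecR.
  have hk' : (normc h)%:C%C < k%:C%C :> C by rewrite ltcR.
  have := Hk (h : C^o) hk'; rewrite rmorphM /=.
  suff -> : L h = h * L (1 : C^o) by [].
  by rewrite -[in LHS](mulr1 h) -[h * 1]/(h *: (1 : C^o)) linearZ.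
move=> [d Hd]; apply/differentiable_epsP.
have lf : linear ( *:%R^~ d : C^o -> C^o).
  by move=> a u v /=; rewrite scalerDl scalerA.
pose L : {linear C^o -> C^o} :=
  HB.pack ( *:%R^~ d : C^o -> C^o) (GRing.isLinear.Build _ _ _ _ _ lf).
exists L; split; first exact: scalelc_continuous.
move=> e /Hd[k k0 Hk]; exists k => // h.
rewrite -[`|h|]/((normc h)%:C%C) ltcR => /Hk.
by rewrite -lecR rmorphM.
Qed.

Lemma has_cderivE g w d : has_cderiv g w d -> cdiff g w.
Proof. by move=> H; apply/cdiffP; exists d. Qed.

Lemma has_cderiv_cont g w d : has_cderiv g w d -> forall e : R, 0 < e ->
  exists2 k : R, 0 < k & forall h, normc h < k -> normc (g (w + h) - g w) <= e.
Proof.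
move=> H e e0; have [k k0 Hk] := H 1 ltr01.
have S0 : 0 < normc d + 1 by rewrite ltr_wpDl ?normc_ge0.
exists (Num.min k (e / (normc d + 1))); first by rewrite lt_min k0 divr_gt0.
move=> h; rewrite lt_min => /andP[/Hk h1 h2].
rewrite (_ : _ - _ = (g (w + h) - g w - h * d) + h * d); last by rewrite subrK.
apply: le_trans (normcD _ _) _; rewrite Normc.normcM.
move: h2; rewrite ltr_pdivlMr// => h2.
have := normc_ge0 h; have := normc_ge0 d; nra.
Qed.

Lemma cdiff_id w : cdiff id w.
Proof.
apply: (@has_cderivE _ _ 1) => e e0; exists 1 => // h _.
by rewrite /= mulr1 [w + h]addrC addrK subrr Normc.normc0 mulr_ge0 ?normc_ge0 ?ltW.
Qed.

End complex_derivative.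

Section cis.
Variable R : realType.
Local Notation C := R[i].
Implicit Types (t x : R) (z w h : C).

Definition cis t : C := (cos t +i* sin t)%C.
Definition cexp z : C := (expR (complex.Re z))%:C%C * cis (complex.Im z).

Lemma normc_cis t : normc (cis t) = 1.
Proof. by rewrite /cis /= cos2Dsin2 sqrtr1. Qed.

Lemma cisD t u : cis (t + u) = cis t * cis u.
Proof.
by apply: complex_ext; rewrite ReImE /=; [exact: cosD|rewrite sinD addrC].
Qed.

Lemma cis_2pi t : cis (t + pi *+ 2) = cis t.
Proof. by rewrite /cis cosD2pi sinD2pi. Qed.

Lemma cis0 : cis 0 = 1.
Proof. by rewrite /cis cos0 sin0. Qed.

Lemma cisN t : cis (- t) = (cis t)^*%C.
Proof. by rewrite /cis cosN sinN. Qed.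

Lemma cis_neq0 t : cis t != 0.
Proof.
apply/eqP => h; have := normc_cis t; rewrite h Normc.normc0 => /eqP.
by rewrite eq_sym oner_eq0.
Qed.

Lemma cexpD z w : cexp (z + w) = cexp z * cexp w.
Proof.
rewrite /cexp !ReImE expRD cisD rmorphM.
by rewrite mulrACA.
Qed.

Lemma cexpE x t : cexp (x +i* t)%C = (expR x)%:C%C * cis t.
Proof. by []. Qed.

Lemma normc_cexp z : normc (cexp z) = expR (complex.Re z).
Proof. by rewrite /cexp Normc.normcM normc_real normc_cis mulr1 ger0_norm// expR_ge0. Qed.

(** Multiplicativity reduces the derivative of the exponential to the point 0, where it follows from
    the first-order expansions of exp, cos and sin. *)
Lemma cexp0_deriv : has_cderiv cexp 0 1.
Proof.
move=> e e0.
(* The error consists of three remainders of size e1 N and three products of size 2 e1 N, which is 9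
   e1 N in all and thus below e N. *)
have [e1 [e10 e11 e1e]] : exists e1 : R, [/\ 0 < e1, e1 <= 1 & e1 <= e / 10].
  exists (Num.min 1 (e / 10)); split; first by rewrite lt_min ltr01 divr_gt0.
    by rewrite ge_min lexx.
  by rewrite ge_min lexx orbT.
have [k k0 Hk] := expR0_eps e10; have [l l0 Hl] := cos0_eps e10.
have [m m0 Hm] := sin0_eps e10.
exists (Num.min (Num.min k l) (Num.min m e1)).
  by rewrite !lt_min k0 l0 m0 e10.
move=> z; rewrite !lt_min => /andP[/andP[hk hl] /andP[hm h1]].
set x := complex.Re z; set t := complex.Im z; set N := normc z in hk hl hm h1 *.
have xN : `|x| <= N by exact: normc_geRe.
have tN : `|t| <= N by exact: normc_geIm.
have N0 : 0 <= N by exact: normc_ge0.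
have hx := Hk x (le_lt_trans xN hk).
have hc := Hl t (le_lt_trans tN hl).
have hs := Hm t (le_lt_trans tN hm).
have hx' : `|expR x - 1 - x| <= e1 * N by apply: le_trans hx _; rewrite ler_pM2l.
have hc' : `|cos t - 1| <= e1 * N by apply: le_trans hc _; rewrite ler_pM2l.
have hs' : `|sin t - t| <= e1 * N by apply: le_trans hs _; rewrite ler_pM2l.
have eN : e1 * N <= N by exact: ler_piMl.
have ex1 : `|expR x - 1| <= 2 * N.
  rewrite (_ : expR x - 1 = (expR x - 1 - x) + x); last by rewrite subrK.
  by apply: le_trans (ler_normD _ _) _; lra.
have e1N : N * N <= e1 * N by rewrite ler_wpM2r// ltW.
have -> : cexp (0 + z) - cexp 0 - z * 1 =
  Complex ((expR x - 1 - x) + (cos t - 1) + (expR x - 1) * (cos t - 1))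
   ((sin t - t) + (expR x - 1) * (sin t - t) + (expR x - 1) * t).
  by rewrite add0r mulr1 /cexp /= expR0 cis0 -/x -/t; apply: complex_ext;
    rewrite !ReImE /= -/x -/t; ring.
apply: le_trans (normc_le_ReIm _) _ => /=.
have A1 : `|(expR x - 1) * (cos t - 1)| <= 2 * (e1 * N).
  rewrite normrM; apply: le_trans (ler_pM _ _ ex1 hc') _ => //.
  have := ltW h1; nra.
have A2 : `|(expR x - 1) * (sin t - t)| <= 2 * (e1 * N).
  rewrite normrM; apply: le_trans (ler_pM _ _ ex1 hs') _ => //.
  have := ltW h1; nra.
have A3 : `|(expR x - 1) * t| <= 2 * (e1 * N).
  rewrite normrM; apply: le_trans (ler_pM _ _ ex1 tN) _ => //.
  by rewrite -mulrA ler_pM2l.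
apply: le_trans (lerD (ler_normD _ _) (ler_normD _ _)) _.
have B1 := ler_normD (expR x - 1 - x) (cos t - 1).
have B2 := ler_normD (sin t - t) ((expR x - 1) * (sin t - t)).
have : 10 * e1 * N <= e * N by rewrite ler_wpM2r//; lra.
have : 0 <= e1 * N by rewrite mulr_ge0// ltW.
move: A1 A2 A3 B1 B2 hx' hc' hs'; clear; lra.
Qed.

Lemma cdiff_cexp z : cdiff cexp z.
Proof.
apply: (@has_cderivE _ _ _ (cexp z)) => e e0.
have z0 : 0 < normc (cexp z) by rewrite normc_cexp expR_gt0.
have [k k0 Hk] := cexp0_deriv (divr_gt0 e0 z0); exists k => // h /Hk.
rewrite add0r mulr1 => H.
have -> : cexp (z + h) - cexp z - h * cexp z = cexp z * (cexp h - cexp 0 - h).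
  rewrite cexpD.
  have -> : cexp 0 = 1 by rewrite /cexp /= expR0 cis0 mulr1.
  ring.
rewrite Normc.normcM mulrC -ler_pdivlMr//.
by apply: le_trans H _; rewrite mulrAC.
Qed.

Lemma continuous_Re : continuous (@complex.Re R : C^o -> R^o).
Proof.
move=> z; apply: (@cvgrPdist_le R R^o C^o (nbhs z) _ _ _).2 => e e0.
apply/near_complexP; exists e => // w h.
by rewrite distrC -ReN -ReD (le_trans (normc_geRe _))//; exact: ltW.
Qed.

Lemma continuous_Im : continuous (@complex.Im R : C^o -> R^o).
Proof.
move=> z; apply: (@cvgrPdist_le R R^o C^o (nbhs z) _ _ _).2 => e e0.
apply/near_complexP; exists e => // w h.
by rewrite distrC -ImN -ImD (le_trans (normc_geIm _))//; exact: ltW.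
Qed.

Lemma cvg_complex (T : Type) (F : set_system T) (f g : T -> R) (a b : R) :
  Filter F -> f @ F --> a -> g @ F --> b ->
  (fun y => (f y +i* g y)%C) @ F --> ((a +i* b)%C : C^o).
Proof.
move=> FF cf cg; apply/cvg_complexP => e e0.
have e2 : 0 < e / 2 by rewrite divr_gt0.
near=> y; apply: le_trans (normc_le_ReIm _) _ => /=.
rewrite [leRHS]splitr lerD// distrC; near: y.
  by move/cvgrPdist_le : cf; apply.
by move/cvgrPdist_le : cg; apply.
Unshelve. all: by end_near. Qed.

Lemma segcont_continuous (f : R -> R) a b :
  (forall t, {for t, continuous f}) -> segcont f a b.
Proof.
move=> fc t _ e e0; have /cvgrPdist_le/(_ e e0)/nbhs_ballP[d /= d0 Hd] := fc t.
exists d => // u _ ut; rewrite distrC; apply: Hd.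
by rewrite /ball /= distrC.
Qed.

End cis.

Section cdiff_rules.
Variable R : realType.
Local Notation C := R[i].
Implicit Types (g h : C -> C) (w d : C).

Lemma cdiffM g h w : cdiff g w -> cdiff h w -> cdiff (fun z => g z * h z) w.
Proof. move=> dg dh; exact: (differentiableM dg dh). Qed.

Lemma cdiffV g w : cdiff g w -> g w != 0 -> cdiff (fun z => (g z)^-1) w.
Proof. move=> dg h; exact: (@differentiableV C C^o g w dg h). Qed.

Lemma cdiff_cst (a : C) w : cdiff (fun=> a) w.
Proof. exact: (@differentiable_cst C C^o C^o a w). Qed.

Lemma cdiffD g h w : cdiff g w -> cdiff h w -> cdiff (fun z => g z + h z) w.
Proof. move=> dg dh; exact: (differentiableD dg dh). Qed.

Lemma cdiffB g h w : cdiff g w -> cdiff h w -> cdiff (fun z => g z - h z) w.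
Proof. move=> dg dh; exact: (differentiableB dg dh). Qed.

Lemma cdiff_comp g h w : cdiff h w -> cdiff g (h w) -> cdiff (fun z => g (h z)) w.
Proof. move=> dg dh; exact: (differentiable_comp dg dh). Qed.

Lemma cdiff_cont g w : cdiff g w -> {for w, continuous (g : C^o -> C^o)}.
Proof. exact: differentiable_continuous. Qed.

(** Reflection in the real axis conjugates the derivative. It makes the conjugated factor of a
    pairing holomorphic in [pairing_le]. *)
Lemma cdiff_conj g w : cdiff g (w^*%C) -> cdiff (fun z => (g (z^*%C))^*%C) w.
Proof.
move=> /cdiffP[d Hd]; apply/cdiffP; exists (d^*%C) => e /Hd[k k0 Hk].
exists k => // h hk; have := Hk (h^*%C); rewrite normc_conj => /(_ hk).
rewrite -[X in X <= _ -> _]normc_conj !rmorphB !rmorphM /= conjcK.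
by rewrite -rmorphD.
Qed.

Lemma has_cderiv_unique g w d d' : has_cderiv g w d -> has_cderiv g w d' -> d = d'.
Proof.
move=> H H'; apply/eqP; rewrite -subr_eq0; apply/eqP/normc_eq0/eqP.
rewrite -normr_le0 ger0_norm ?normc_ge0//; apply/ler_addgt0Pr => e e0.
have e2 : 0 < e / 2 by rewrite divr_gt0.
have [k k0 Hk] := H _ e2; have [l l0 Hl] := H' _ e2; rewrite add0r.
pose r := Num.min k l / 2.
have m0 : 0 < Num.min k l by rewrite lt_min k0.
have r0 : 0 < r by rewrite divr_gt0.
have rm : r < Num.min k l by rewrite /r; lra.
have nr : normc (r%:C%C) = r by rewrite normc_real gtr0_norm.
have h1 := Hk r%:C%C; have h2 := Hl r%:C%C.
rewrite nr in h1 h2; move: rm; rewrite lt_min => /andP[/h1 {}h1 /h2 {}h2].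
rewrite -(ler_pM2l r0) -{1}nr -Normc.normcM.
have -> : r%:C%C * (d - d') = (g (w + r%:C%C) - g w - r%:C%C * d') -
   (g (w + r%:C%C) - g w - r%:C%C * d) by ring.
apply: le_trans (normcB _ _) _; lra.
Qed.

Lemma has_cderivB g h w d d' : has_cderiv g w d -> has_cderiv h w d' ->
  has_cderiv (fun z => g z - h z) w (d - d').
Proof.
move=> H H' e e0; have e2 : 0 < e / 2 by rewrite divr_gt0.
have [k k0 Hk] := H _ e2; have [l l0 Hl] := H' _ e2.
exists (Num.min k l); first by rewrite lt_min k0.
move=> x; rewrite lt_min => /andP[/Hk {}Hk /Hl {}Hl].
have -> : g (w + x) - h (w + x) - (g w - h w) - x * (d - d') =
  (g (w + x) - g w - x * d) - (h (w + x) - h w - x * d') by ring.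
apply: le_trans (normcB _ _) _; lra.
Qed.

Lemma has_cderiv_scale (u : C) w : has_cderiv (fun z => z * u) w u.
Proof.
move=> e e0; exists 1 => // h _.
rewrite mulrDl [_ + h * u]addrC addrK subrr Normc.normc0.
by rewrite mulr_ge0 ?normc_ge0 ?ltW.
Qed.

Lemma has_cderiv_shift g w v d : has_cderiv g (w + v) d ->
  has_cderiv (fun z => g (z + v)) w d.
Proof.
move=> H e /H[k k0 Hk]; exists k => // h /Hk.
by rewrite (addrAC w v h).
Qed.

End cdiff_rules.

(** * Means of holomorphic functions over circles *)

Section strip.
Variable R : realType.
Local Notation C := R[i].
Variables (H : C -> C) (a b : R).
Hypothesis ab : a <= b.
Hypothesis dH : forall z, a <= complex.Re z <= b -> cdiff H z.
Hypothesis Hper : forall x t, H (x +i* (t + pi *+ 2))%C = H (x +i* t)%C.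

(** Goursat for Im H dx + Re H dy, the imaginary part of H dz. The horizontal edges cancel by
    periodicity, so the integrals over the two vertical edges agree. *)
Lemma strip_mean :
  segint (fun t => complex.Re (H (b +i* t)%C)) 0 (pi *+ 2) =
  segint (fun t => complex.Re (H (a +i* t)%C)) 0 (pi *+ 2).
Proof.
pose P x t := complex.Im (H (x +i* t)%C); pose Q x t := complex.Re (H (x +i* t)%C).
have p0 : (0 : R) <= pi *+ 2 by rewrite mulrn_wge0// pi_ge0.
have cl x y : a <= x <= b -> 0 <= y <= pi *+ 2 ->
    closed_form_at P Q a b 0 (pi *+ 2) x y.
  move=> xab yp; have /cdiffP[D HD] := dH (xab : a <= complex.Re (x +i* y)%C <= b).
  (* The Cauchy-Riemann equations: the real and imaginary parts of D h share the coefficient Re D,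
     as [closed_form_at] requires. *)
  exists (complex.Im D), (complex.Re D), (- complex.Im D) => e e0.
  have [k k0 Hk] := HD e e0; exists (k / 3); first by rewrite divr_gt0.
  move=> x' y' _ _ hx hy.
  pose h : C := ((x' - x) +i* (y' - y))%C.
  have nh : normc h <= `|x' - x| + `|y' - y| by exact: normc_le_ReIm.
  have hk : normc h < k by apply: le_lt_trans nh _; lra.
  have := Hk h hk.
  have -> : (x +i* y)%C + h = (x' +i* y')%C.
    by apply: complex_ext; rewrite !ReImE /=; ring.
  set E := (X in normc X) => hE.
  have hE' : normc E <= e * (`|x' - x| + `|y' - y|).
    by apply: le_trans hE _; rewrite ler_pM2l.
  split.
    apply: le_trans hE'; apply: le_trans (normc_geIm _).
    rewrite /E !ReImE /= -/(P x y) -/(P x' y').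
    by rewrite le_eqVlt; apply/orP; left; apply/eqP; congr (`|_|); ring.
  apply: le_trans hE'; apply: le_trans (normc_geRe _).
  rewrite /E !ReImE /= -/(Q x y) -/(Q x' y').
  by rewrite le_eqVlt; apply/orP; left; apply/eqP; congr (`|_|); ring.
have := goursat_rectangle ab p0 cl; rewrite /bdint.
have -> : segint (fun x => P x 0 - P x (pi *+ 2)) a b = segint (fun=> 0) a b.
  apply: eq_segint => x _; rewrite /P -[pi *+ 2 in X in _ - X]add0r Hper subrr.
  by [].
have -> : segint (fun=> 0) a b = 0 :> R.
  have z0 x : a <= x <= b -> `|(0 : R) - 0| <= 0 by rewrite subrr normr0.
  have := segint_near ab (@segcont_cst R 0 a b) z0.
  by rewrite !mul0r subr0 normr_le0 => /eqP.
rewrite add0r segintB; last 2 first.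
- by have [] := closed_form_segcont cl (_ : a <= b <= b) (_ : 0 <= 0 <= pi *+ 2);
    rewrite ?lexx ?ab.
- by have [] := closed_form_segcont cl (_ : a <= a <= b) (_ : 0 <= 0 <= pi *+ 2);
    rewrite ?lexx ?ab.
by move/eqP; rewrite subr_eq0 => /eqP.
Qed.

End strip.

Section circle_mean.
Variable R : realType.
Local Notation C := R[i].
Implicit Types (u v : R -> R) (g h G : C -> C) (r s t e : R) (w d : C).

Definition cmean u : R := (pi *+ 2)^-1 * segint u 0 (pi *+ 2).
Definition circ r t : C := r%:C%C * cis t.

Let p0 : (0 : R) < pi *+ 2. Proof. by rewrite mulrn_wgt0// pi_gt0. Qed.

Local Notation ccont u := (segcont u 0 (pi *+ 2)).

Lemma cmean_near u k e : ccont u ->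
  (forall t, `|u t - k| <= e) -> `|cmean u - k| <= e.
Proof.
move=> uc H; have := segint_near (ltW p0) uc (fun t _ => H t).
rewrite subr0 => h; rewrite -(ler_pM2r p0) -[X in _ * X](gtr0_norm p0) -normrM.
apply: le_trans h; rewrite le_eqVlt; apply/orP; left; apply/eqP; congr (`|_|).
by rewrite mulrBl /cmean mulrAC mulVf ?gt_eqF// mul1r.
Qed.

Lemma cmean_cst k : cmean (fun=> k) = k.
Proof.
apply/eqP; rewrite -subr_eq0 -normr_le0; apply: cmean_near.
  exact: segcont_cst.
by move=> t; rewrite subrr normr0.
Qed.

Lemma cmean_le u v : ccont u -> ccont v -> (forall t, u t <= v t) ->
  cmean u <= cmean v.
Proof.
move=> uc vc H; rewrite /cmean ler_pM2l ?invr_gt0//.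
by apply: segint_le.
Qed.

Lemma cmeanD u v : ccont u -> ccont v ->
  cmean (fun t => u t + v t) = cmean u + cmean v.
Proof. by move=> uc vc; rewrite /cmean segintD// mulrDr. Qed.

Lemma cmeanB u v : ccont u -> ccont v ->
  cmean (fun t => u t - v t) = cmean u - cmean v.
Proof. by move=> uc vc; rewrite /cmean segintB// mulrBr. Qed.

Lemma cmeanZ k u : ccont u -> cmean (fun t => k * u t) = k * cmean u.
Proof. by move=> uc; rewrite /cmean segintZ// mulrCA. Qed.

Lemma eq_cmean u v : u =1 v -> cmean u = cmean v.
Proof. by move=> uv; congr cmean; apply/funext. Qed.

Lemma normc_circ r t : 0 <= r -> normc (circ r t) = r.
Proof.
by move=> r0; rewrite /circ Normc.normcM normc_real normc_cis mulr1 ger0_norm.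
Qed.

Lemma continuous_circ r : continuous (circ r : R -> C^o).
Proof.
move=> t; rewrite /circ /cis.
have -> : (fun x : R => r%:C%C * (cos x +i* sin x)%C) =
          (fun x => ((r * cos x) +i* (r * sin x))%C).
  by apply/funext => x; apply: complex_ext; rewrite !ReImE /=; ring.
by apply: cvg_complex; apply: cvgM; try exact: cvg_cst;
  [exact: continuous_cos|exact: continuous_sin].
Qed.

Lemma circ_continuous (T : topologicalType) (F : C -> T) r :
  0 <= r -> (forall w, normc w = r -> {for w, continuous (F : C^o -> T)}) ->
  forall t, {for t, continuous (fun t => F (circ r t))}.
Proof.
move=> r0 cF t; apply: (@continuous_comp R C^o T (circ r) F).
  exact: continuous_circ.
by apply: cF; rewrite normc_circ.
Qed.

Lemma circ_segcont (F : C -> R) r a b :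
  0 <= r -> (forall w, normc w = r -> {for w, continuous (F : C^o -> R)}) ->
  segcont (fun t => F (circ r t)) a b.
Proof. by move=> r0 cF; apply/segcont_continuous/circ_continuous. Qed.

Lemma continuous_Re_cdiff g w : cdiff g w ->
  {for w, continuous ((fun z => complex.Re (g z)) : C^o -> R)}.
Proof.
move=> /cdiff_cont dg; apply: (@continuous_comp C^o C^o R g (@complex.Re R)) => //.
exact: continuous_Re.
Qed.

(** The exponential maps vertical segments of length 2 pi onto circles, so this is [strip_mean] for
    G composed with it, between the abscissas ln r1 and ln r2. *)
Lemma annulus_mean G r1 r2 : 0 < r1 -> r1 <= r2 ->
  (forall w, r1 <= normc w <= r2 -> cdiff G w) ->
  cmean (fun t => complex.Re (G (circ r1 t))) =
  cmean (fun t => complex.Re (G (circ r2 t))).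
Proof.
move=> r10 r12 dG; have r20 := lt_le_trans r10 r12.
rewrite /cmean; congr (_ * _).
have E r : 0 < r -> (fun t => complex.Re (G (circ r t))) =
   (fun t => complex.Re ((G \o @cexp R) ((ln r) +i* t)%C)).
  by move=> r0; apply/funext => t /=; rewrite cexpE lnK ?posrE.
have e1 : expR (ln r1) = r1 by rewrite lnK ?posrE.
have e2 : expR (ln r2) = r2 by rewrite lnK ?posrE.
rewrite (E _ r10) (E _ r20); apply: esym.
apply: (@strip_mean R (G \o @cexp R) (ln r1) (ln r2)).
- by rewrite ler_ln ?posrE.
- move=> z /andP[h1 h2]; apply: (@cdiff_comp _ G (@cexp R)); first exact: cdiff_cexp.
  by apply: dG; rewrite normc_cexp -e1 -e2 !ler_expR h1.
- by move=> x t /=; rewrite !cexpE cis_2pi.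
Qed.

(** Only a limit d at 0 is asked of G, which is what difference quotients have. The circle is shrunk
    until G is close to d on it. *)
Lemma mean_value G r d : 0 < r ->
  (forall w, 0 < normc w <= r -> cdiff G w) ->
  (forall e, 0 < e -> exists2 k : R, 0 < k & forall w, 0 < normc w < k ->
      normc (G w - d) <= e) ->
  cmean (fun t => complex.Re (G (circ r t))) = complex.Re d.
Proof.
move=> r0 dG H; apply/eqP; rewrite -subr_eq0 -normr_le0.
apply/ler_addgt0Pr => e e0; rewrite add0r.
have [k k0 Hk] := H e e0.
pose s := Num.min r (k / 2).
have s0 : 0 < s by rewrite lt_min r0 divr_gt0.
have sr : s <= r by rewrite ge_min lexx.
have sk : s < k by rewrite gt_min; apply/orP; right; lra.
rewrite -(annulus_mean s0 sr); last first.
  by move=> w /andP[sw wr]; apply: dG; rewrite wr (lt_le_trans s0).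
apply: cmean_near.
  apply: (circ_segcont (F := fun w => complex.Re (G w))); first exact: ltW.
  by move=> w ws; apply: continuous_Re_cdiff; apply: dG; rewrite ws s0.
move=> t; rewrite -ReN -ReD; apply: le_trans (normc_geRe _) _; apply: Hk.
by rewrite normc_circ ?(ltW s0)// s0.
Qed.

End circle_mean.

(** * Cauchy and Taylor estimates on a disc *)

Section disk_estimates.
Variable R : realType.
Local Notation C := R[i].
Implicit Types (g h G : C -> C) (r s t e B : R) (w d : C).
Local Notation ccont u := (segcont u 0 (pi *+ 2)).

Lemma circ_Re_ccont g r : 0 <= r -> (forall w, normc w = r -> cdiff g w) ->
  ccont (fun t => complex.Re (g (circ r t))).
Proof.
move=> r0 dg; apply: (circ_segcont (F := fun w => complex.Re (g w))) => // w wr.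
by apply: continuous_Re_cdiff; exact: dg.
Qed.

Lemma segcontM (u v : R -> R) : (forall t, {for t, continuous u}) ->
  (forall t, {for t, continuous v}) -> ccont (fun t => u t * v t).
Proof.
move=> cu cv; apply: segcont_continuous => t; apply: cvgM; [exact: cu|exact: cv].
Qed.

Lemma circ_pair_ccont g h r s : 0 <= r -> 0 <= s ->
  (forall w, normc w = r -> cdiff g w) -> (forall w, normc w = s -> cdiff h w) ->
  ccont (fun t => complex.Re (g (circ r t) * (h (circ s t))^*%C)).
Proof.
move=> r0 s0 dg dh.
have cR (f : C -> C) q : 0 <= q -> (forall w, normc w = q -> cdiff f w) -> forall t,
    {for t, continuous (fun t => complex.Re (f (circ q t)))} /\
    {for t, continuous (fun t => complex.Im (f (circ q t)))}.
  move=> q0 df t; split.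
    apply: (circ_continuous (F := fun w => complex.Re (f w))) => // w wr.
    by apply: continuous_Re_cdiff; exact: df.
  apply: (circ_continuous (F := fun w => complex.Im (f w))) => // w wr.
  apply: (@continuous_comp C^o C^o R f (@complex.Im R)); last exact: continuous_Im.
  by apply: cdiff_cont; exact: df.
have -> : (fun t => complex.Re (g (circ r t) * (h (circ s t))^*%C)) = (fun t =>
    complex.Re (g (circ r t)) * complex.Re (h (circ s t)) +
    complex.Im (g (circ r t)) * complex.Im (h (circ s t))).
  by apply/funext => t; rewrite !ReImE mulrN opprK.
by apply: segcontD; apply: segcontM => t; have [? ?] := cR g r r0 dg t;
  have [? ?] := cR h s s0 dh t.
Qed.

Lemma circ_sqmod_ccont g r : 0 <= r -> (forall w, normc w = r -> cdiff g w) ->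
  ccont (fun t => sqmod (g (circ r t))).
Proof.
move=> r0 dg.
have -> : (fun t => sqmod (g (circ r t))) =
  (fun t => complex.Re (g (circ r t) * (g (circ r t))^*%C)).
  by apply/funext => t; rewrite sqmodE !ReImE; ring.
exact: circ_pair_ccont.
Qed.

(** Since |g - g(0)|^2 >= 0, the function |g|^2 dominates 2 Re (conj g(0) g) - |g(0)|^2, whose mean
    over the circle is |g(0)|^2. *)
Lemma submean_sqmod g r : 0 < r -> (forall w, normc w <= r -> cdiff g w) ->
  sqmod (g 0) <= cmean (fun t => sqmod (g (circ r t))).
Proof.
move=> r0 dg.
have dg' u w : 0 < normc w <= r -> cdiff (fun z => u * g z) w.
  by move=> /andP[_ wr]; apply: cdiffM; [exact: cdiff_cst|exact: dg].
have mv : cmean (fun t => complex.Re ((g 0)^*%C * g (circ r t))) =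
    complex.Re ((g 0)^*%C * g 0).
  apply: (mean_value (G := fun z => (g 0)^*%C * g z) r0 (dg' _)).
  move=> e e0; have /cdiffP[D HD] : cdiff g 0 by apply: dg; rewrite Normc.normc0 ltW.
  have n0 : 0 < normc (g 0) + 1 by rewrite ltr_wpDl ?normc_ge0.
  have [k k0 Hk] := has_cderiv_cont HD (divr_gt0 e0 n0).
  exists k => // w /andP[_ /Hk]; rewrite add0r => hw.
  rewrite -mulrBr Normc.normcM normc_conj.
  apply: le_trans (ler_wpM2l (normc_ge0 _) hw) _.
  rewrite mulrCA ler_piMr ?(ltW e0)// ler_pdivrMr// mul1r; lra.
have key : forall t, 2 * complex.Re ((g 0)^*%C * g (circ r t)) - sqmod (g 0) <=
    sqmod (g (circ r t)).
  move=> t; have := sqmod_ge0 (g (circ r t) - g 0).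
  rewrite !sqmodE !ReImE; lra.
have c1 : ccont (fun t => complex.Re ((g 0)^*%C * g (circ r t))).
  apply: (@circ_Re_ccont (fun z => (g 0)^*%C * g z)); first exact: ltW.
  by move=> w wr; apply: dg'; rewrite wr r0 /=.
have c2 : ccont (fun t => sqmod (g (circ r t))).
  by apply: circ_sqmod_ccont; [exact: ltW|move=> w wr; apply: dg; rewrite wr].
have c3 : ccont (fun t => 2 * complex.Re ((g 0)^*%C * g (circ r t)) - sqmod (g 0)).
  by apply: segcontD; [exact: segcontZ|exact: segcont_cst].
have := cmean_le c3 c2 key.
rewrite cmeanB ?cmean_cst ?cmeanZ ?mv//; last 2 first.
- exact: segcontZ.
- exact: segcont_cst.
apply: le_trans; rewrite !sqmodE !ReImE; lra.
Qed.

(** The mean value property is applied to the difference quotient (g w - g 0) / w, which tends to d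
    at 0. The factor 2 stems from the subtracted g 0. *)
Lemma cauchy_deriv g r B d : 0 < r -> (forall w, normc w <= r -> cdiff g w) ->
  (forall w, normc w <= r -> normc (g w) <= B) -> has_cderiv g 0 d ->
  normc d <= 2 * B / r.
Proof.
move=> r0 dg gB Hd; apply: normc_le_dual => u u1.
pose G w := u * ((g w - g 0) / w).
have dG w : 0 < normc w <= r -> cdiff G w.
  move=> /andP[w0 wr]; apply: cdiffM; first exact: cdiff_cst.
  apply: cdiffM; first by apply: cdiffB; [exact: dg|exact: cdiff_cst].
  apply: cdiffV; first exact: cdiff_id.
  by apply: contraTneq w0 => ->; rewrite Normc.normc0 ltxx.
rewrite -(mean_value r0 dG (d := u * d)); last first.
  move=> e /Hd[k k0 Hk]; exists k => // w /andP[w0 /Hk]; rewrite add0r => h.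
  have wn0 : w != 0 by apply: contraTneq w0 => ->; rewrite Normc.normc0 ltxx.
  rewrite /G -mulrBr Normc.normcM u1 mul1r.
  have -> : (g w - g 0) / w - d = (g w - g 0 - w * d) / w by field.
  by rewrite Normc.normcM Normc.normcV ler_pdivrMr.
have bd t : `|complex.Re (G (circ r t))| <= 2 * B / r.
  apply: le_trans (normc_geRe _) _; rewrite /G !Normc.normcM u1 mul1r.
  rewrite Normc.normcV normc_circ ?(ltW r0)//. rewrite ler_pM2r ?invr_gt0//.
  apply: le_trans (normcB _ _) _.
  have := gB (circ r t); rewrite normc_circ ?(ltW r0)// => /(_ (lexx _)).
  have := gB 0; rewrite Normc.normc0 => /(_ (ltW r0)); lra.
apply: le_trans (ler_norm _) _; rewrite -[X in `|X|]subr0; apply: cmean_near.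
  apply: circ_Re_ccont; first exact: ltW.
  by move=> w wr; apply: dG; rewrite wr r0 /=.
by move=> t; rewrite subr0.
Qed.

(** The real mean value theorem for t -> Re (u g(w0 + t w)), for each unit number u. *)
Lemma segment_lipschitz g w0 w (D : R -> C) L :
  (forall t, 0 <= t <= 1 -> has_cderiv g (w0 + t%:C%C * w) (D t)) ->
  (forall t, 0 <= t <= 1 -> normc (D t) <= L) ->
  normc (g (w0 + w) - g w0) <= L * normc w.
Proof.
move=> HD DL; apply: normc_le_dual => u u1.
pose p t := complex.Re (u * g (w0 + t%:C%C * w)).
pose dp t := complex.Re (u * (D t * w)).
have hp t : 0 <= t <= 1 -> is_derive t 1 p (dp t).
  move=> t01; apply/is_derive_epsP => e e0.
  have w1 : 0 < normc w + 1 by rewrite ltr_wpDl ?normc_ge0.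
  have [k k0 Hk] := HD t t01 _ (divr_gt0 e0 w1).
  exists (k / (normc w + 1)); first by rewrite divr_gt0.
  move=> h; rewrite ltr_pdivlMr// => hk.
  have nh : normc (h%:C%C * w) <= `|h| * (normc w + 1).
    by rewrite Normc.normcM normc_real ler_wpM2l// lerDl.
  have := Hk (h%:C%C * w) (le_lt_trans nh hk) => {}Hk.
  have -> : p (t + h) - p t - dp t * h = complex.Re (u * (
     g (w0 + t%:C%C * w + h%:C%C * w) - g (w0 + t%:C%C * w) - (h%:C%C * w) * D t)).
    rewrite /p /dp (_ : w0 + (t + h)%:C%C * w = w0 + t%:C%C * w + h%:C%C * w).
      by rewrite !ReImE /=; ring.
    by rewrite rmorphD /= mulrDl addrA.
  apply: le_trans (normc_geRe _) _; rewrite Normc.normcM u1 mul1r.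
  apply: le_trans Hk _; rewrite -ler_pdivlMl ?divr_gt0//.
  apply: le_trans nh _; rewrite le_eqVlt; apply/orP; left; apply/eqP.
  by field; rewrite !gt_eqF.
have [||t] := @MVT_segment R p dp 0 1 ler01.
- by move=> t; rewrite in_itv /= => /andP[t0 t1]; apply: hp; rewrite !ltW.
- apply/subspace_continuousP => t; rewrite /= in_itv /= => t01.
  apply: cvg_within_filter; have [dt _] := hp t t01.
  by apply: differentiable_continuous; exact/derivable1_diffP.
rewrite in_itv /= => t01; rewrite subr0 mulr1 /p mul0r mul1r addr0 => h.
rewrite mulrBr ReD ReN h; apply: le_trans (ler_norm _) _.
apply: le_trans (normc_geRe _) _; rewrite !Normc.normcM u1 mul1r.
by rewrite ler_wpM2r ?normc_ge0// DL.
Qed.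

(* The derivative of g is Lipschitz because z |-> g (z + v) - g z is small. *)
Lemma taylor1 g r B d w : 0 < r -> (forall w, normc w <= r -> cdiff g w) ->
  (forall w, normc w <= r -> normc (g w) <= B) -> has_cderiv g 0 d ->
  normc w <= r / 4 ->
  normc (g w - g 0) <= 4 * B / r * normc w /\
  normc (g w - g 0 - w * d) <= 32 * B / r ^+ 2 * normc w ^+ 2.
Proof.
move=> r0 dg gB Hd wr.
have B0 : 0 <= B.
  by apply: le_trans (normc_ge0 (g 0)) (gB _ _); rewrite Normc.normc0 ltW.
have [D HD] : exists D : C -> C, forall z, normc z <= r -> has_cderiv g z (D z).
  have : forall z : C, exists e : C, normc z <= r -> has_cderiv g z e.
    move=> z; have [/dg/cdiffP[e He]|nz] := pselect (normc z <= r); first by exists e.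
    by exists 0 => /nz.
  by move=> /choice[D HD]; exists D.
(* The disc of radius r / 2 about z stays in the disc of radius r, so Cauchy's estimate gives 2 B /
   (r / 2). *)
have DB z : normc z <= r / 2 -> normc (D z) <= 4 * B / r.
  move=> zr; have r2 : 0 < r / 2 by rewrite divr_gt0.
  have sub x : normc x <= r / 2 -> normc (x + z) <= r.
    by move=> xr; apply: le_trans (normcD _ _) _; lra.
  have -> : 4 * B / r = 2 * B / (r / 2) by field; rewrite gt_eqF.
  apply: (cauchy_deriv (g := fun x => g (x + z)) r2).
  - move=> x /sub/dg; apply: (cdiff_comp (h := fun x => x + z)); apply: cdiffD; first exact: cdiff_id.
    exact: cdiff_cst.
  - by move=> x /sub; exact: gB.
  - apply: has_cderiv_shift; rewrite add0r; apply: HD; lra.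
have lip z v : normc z <= r / 4 -> normc v <= r / 4 ->
    normc (g (z + v) - g z) <= 4 * B / r * normc v.
  move=> zr vr.
  have tv t : 0 <= t <= 1 -> normc (z + t%:C%C * v) <= r / 2.
    move=> /andP[t0 t1]; apply: le_trans (normcD _ _) _.
    rewrite Normc.normcM normc_real ger0_norm//.
    have := ler_piMl (normc_ge0 v) t1; lra.
  apply: (segment_lipschitz (D := fun t => D (z + t%:C%C * v))).
    by move=> t /tv h; apply: HD; lra.
  by move=> t /tv; exact: DB.
split.
  by rewrite -[w in g w]add0r; apply: lip => //; rewrite Normc.normc0 divr_ge0// ltW.
have n0 : normc 0 = 0 :> R := Normc.normc0 R.
have d0 : d = D 0 by apply: has_cderiv_unique Hd (HD _ _); rewrite n0 ltW.
(* By [lip] the difference g (z + v) - g z is at most (4 B / r) |v| on the disc of radius r / 4;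
   Cauchy's estimate there produces the constant 32. *)
have Dlip v : normc v <= r / 4 -> normc (D v - d) <= 32 * B / r ^+ 2 * normc v.
  move=> vr; have r4 : 0 < r / 4 by rewrite divr_gt0.
  have -> : 32 * B / r ^+ 2 * normc v = 2 * (4 * B / r * normc v) / (r / 4).
    by field; rewrite gt_eqF.
  apply: (cauchy_deriv (g := fun z => g (z + v) - g z) r4).
  - move=> z zr; apply: cdiffB; last by apply: dg; lra.
    apply: (cdiff_comp (h := fun z => z + v)).
      by apply: cdiffD; [exact: cdiff_id|exact: cdiff_cst].
    by apply: dg; apply: le_trans (normcD _ _) _; lra.
  - by move=> z zr; exact: lip.
  - apply: has_cderivB => //; apply: has_cderiv_shift; rewrite add0r.
    by apply: HD; lra.
have tw t : 0 <= t <= 1 -> normc (t%:C%C * w) <= normc w.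
  move=> /andP[t0 t1]; rewrite Normc.normcM normc_real ger0_norm//.
  by rewrite ler_piMl// normc_ge0.
have h1 t : 0 <= t <= 1 ->
    has_cderiv (fun z => g z - z * d) (0 + t%:C%C * w) (D (t%:C%C * w) - d).
  move=> t01; rewrite add0r; apply: has_cderivB; last exact: has_cderiv_scale.
  by apply: HD; have := tw t t01; lra.
have h2 t : 0 <= t <= 1 ->
    normc (D (t%:C%C * w) - d) <= 32 * B / r ^+ 2 * normc w.
  move=> t01; have tr := tw t t01.
  apply: le_trans (Dlip _ (le_trans tr wr)) _.
  by rewrite ler_wpM2l// divr_ge0 ?exprn_ge0 ?(ltW r0)// mulr_ge0.
have := segment_lipschitz h1 h2.
by rewrite add0r mul0r subr0 -[_ * normc w * normc w]mulrA -expr2 addrAC.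
Qed.

End disk_estimates.

(** * Pairings and mean squares on concentric circles *)

Section circle_pairing.
Variable R : realType.
Local Notation C := R[i].
Implicit Types (g h : C -> C) (r s t : R) (w : C).
Variable (rho : R).
Local Notation ccont u := (segcont u 0 (pi *+ 2)).
Local Notation holdisk g := (forall w, normc w < rho -> cdiff g w).
Local Notation pairing g r h s :=
  (cmean (fun t => complex.Re (g (circ r t) * (h (circ s t))^*%C))).

(** With q = r s, the function g(w) conj (h (conj (q / w))) is holomorphic on the annulus r <= |w|
    <= r'. At w = x e^(it) it equals g(x e^(it)) conj (h (y e^(it))) with x y = q, so [annulus_mean]
    compares the two pairings. *)
Let pairing_le g h r s r' s' : holdisk g -> holdisk h ->
  0 < r -> r <= r' -> r' < rho -> 0 < s' -> s < rho -> r * s = r' * s' ->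
  pairing g r h s = pairing g r' h s'.
Proof.
move=> dg dh r0 rr rrho s0' srho E.
have r0' := lt_le_trans r0 rr.
have s0 : 0 < s by rewrite -(pmulr_rgt0 _ r0) E mulr_gt0.
pose q := (r * s)%:C%C : C.
pose G w := g w * (h ((q / w)^*%C))^*%C.
have dG w : r <= normc w <= r' -> cdiff G w.
  move=> /andP[rw wr].
  have w0 : 0 < normc w := lt_le_trans r0 rw.
  apply: cdiffM; first by apply: dg; exact: le_lt_trans wr _.
  apply: (@cdiff_comp _ (fun z => (h (z^*%C))^*%C) (fun w => q / w)).
    apply: cdiffM; first exact: cdiff_cst.
    apply: cdiffV; first exact: cdiff_id.
    by apply: contraTneq w0 => ->; rewrite Normc.normc0 ltxx.
  apply: cdiff_conj; apply: dh.
  rewrite normc_conj Normc.normcM Normc.normcV normc_real ger0_norm ?mulr_ge0 ?(ltW r0) ?(ltW s0)//.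
  rewrite ltr_pdivrMr//; apply: le_lt_trans (_ : s * normc w < _).
    by rewrite mulrC ler_pM2l.
  by rewrite ltr_pM2r.
have HG x y t : 0 < x -> x * y = r * s -> G (circ x t) = g (circ x t) * (h (circ y t))^*%C.
  move=> x0 xy; rewrite /G; congr (_ * (h _)^*%C).
  have -> : circ y t = (circ y (- t))^*%C.
    by rewrite /circ cisN conjcM conjcK conjc_real.
  congr (_^*%C); rewrite /q -xy /circ.
  have c1 : cis t * cis (- t) = 1 by rewrite -cisD subrr cis0.
  have cn : cis t != 0 by exact: cis_neq0.
  have xn : (x%:C%C : C) != 0 by rewrite eq_complex /= negb_and gt_eqF.
  rewrite -[cis (- t)](mulKf cn) c1 rmorphM /=; field.
  by rewrite xn cn.
have := annulus_mean r0 rr dG.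
rewrite (eq_cmean (v := fun t => complex.Re (g (circ r t) * (h (circ s t))^*%C))); last first.
  by move=> t; rewrite (HG r s).
rewrite (eq_cmean (u := fun t => complex.Re (G (circ r' t)))
  (v := fun t => complex.Re (g (circ r' t) * (h (circ s' t))^*%C))); last first.
  by move=> t; rewrite (HG r' s').
by [].
Qed.

Lemma circ_pairing g h r s r' s' : holdisk g -> holdisk h ->
  0 < r < rho -> 0 < s < rho -> 0 < r' < rho -> 0 < s' < rho ->
  r * s = r' * s' -> pairing g r h s = pairing g r' h s'.
Proof.
move=> dg dh /andP[r0 r1] /andP[s0 s1] /andP[r0' r1'] /andP[s0' s1'] E.
have [rr|/ltW rr] := leP r r'; first exact: pairing_le.
by apply/esym/pairing_le.
Qed.

Let on_circ g r : holdisk g -> r < rho -> forall w, normc w = r -> cdiff g w.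
Proof. by move=> dg rr w wr; apply: dg; rewrite wr. Qed.

Lemma cmean_sqmodE g r : cmean (fun t => sqmod (g (circ r t))) = pairing g r g r.
Proof. by apply: eq_cmean => t; rewrite sqmodE !ReImE; ring. Qed.

Lemma cmean_polar g h r s : holdisk g -> holdisk h -> 0 < r < rho -> 0 < s < rho ->
  cmean (fun t => sqmod (g (circ r t) + h (circ s t))) =
  cmean (fun t => sqmod (g (circ r t))) + cmean (fun t => sqmod (h (circ s t))) +
  2 * pairing g r h s.
Proof.
move=> dg dh /andP[/ltW r0 r1] /andP[/ltW s0 s1].
have c1 := circ_sqmod_ccont r0 (on_circ dg r1).
have c2 := circ_sqmod_ccont s0 (on_circ dh s1).
have c3 := circ_pair_ccont r0 s0 (on_circ dg r1) (on_circ dh s1).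
rewrite -cmeanZ// -cmeanD// -cmeanD//; last 2 first.
- exact: segcontD.
- exact: segcontZ.
by apply: eq_cmean => t; exact: sqmod_polar.
Qed.

Lemma cmean_sqmod_sub g r s q : holdisk g -> 0 < r < rho -> 0 < s < rho ->
  0 < q < rho -> r * s = q * q ->
  cmean (fun t => sqmod (g (circ r t) - g (circ s t))) +
  2 * cmean (fun t => sqmod (g (circ q t))) =
  cmean (fun t => sqmod (g (circ r t))) + cmean (fun t => sqmod (g (circ s t))).
Proof.
move=> dg rr ss qq E.
have dg' : holdisk (fun w => - g w).
  by move=> w /dg; exact: differentiableN.
have H := cmean_polar dg dg' rr ss.
rewrite [X in X + _]H.
have -> : cmean (fun t => sqmod (- g (circ s t))) = cmean (fun t => sqmod (g (circ s t))).
  by apply: eq_cmean => t; rewrite sqmodN.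
have -> : pairing g r (fun w => - g w) s = - pairing g r g s.
  have c : ccont (fun t => complex.Re (g (circ r t) * (g (circ s t))^*%C)).
    case/andP: rr => /ltW r0 r1; case/andP: ss => /ltW s0 s1.
    exact: circ_pair_ccont r0 s0 (on_circ dg r1) (on_circ dg s1).
  by rewrite -mulN1r -cmeanZ//; apply: eq_cmean => t; rewrite !ReImE; ring.
by rewrite (circ_pairing dg dg rr ss qq qq E) -cmean_sqmodE; ring.
Qed.

(* The mean n(r) of |g|^2 satisfies n(r) + n(s) >= 2 n(sqrt(rs)); were n(r) > n(s)
   with r < s, it would grow linearly along the geometric sequence through s, r. *)
Lemma cmean_sqmod_homo g r s : holdisk g -> 0 < r -> r <= s -> s < rho ->
  cmean (fun t => sqmod (g (circ r t))) <= cmean (fun t => sqmod (g (circ s t))).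
Proof.
move=> dg r0 rs srho; pose N x := cmean (fun t => sqmod (g (circ x t))).
have s0 := lt_le_trans r0 rs.
rewrite leNgt; apply/negP; rewrite -/(N r) -/(N s) => Nsr.
have {}rs : r < s.
  by rewrite lt_neqAle rs andbT; apply: contraTneq Nsr => ->; rewrite ltxx.
pose a := r / s; have a0 : 0 < a by rewrite divr_gt0.
have a1 : a < 1 by rewrite ltr_pdivrMr// mul1r.
pose x k := s * a ^+ k.
have x0 k : 0 < x k by rewrite mulr_gt0// exprn_gt0.
have xr k : 0 < x k < rho.
  rewrite x0 /=; apply: le_lt_trans srho; rewrite ler_piMr ?(ltW s0)//.
  by rewrite exprn_ile1 ?(ltW a0)// (ltW a1).
have conv k : N (x k.+1) *+ 2 <= N (x k) + N (x k.+2).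
  have E : x k * x k.+2 = x k.+1 * x k.+1 by rewrite /x !exprS; ring.
  have H := cmean_sqmod_sub dg (xr k) (xr k.+2) (xr k.+1) E.
  suff : 0 <= cmean (fun t => sqmod (g (circ (x k) t) - g (circ (x k.+2) t))).
    by rewrite mulr2n /N; lra.
  rewrite -[0 : R](cmean_cst (R := R)); apply: cmean_le.
  - exact: segcont_cst.
  - have /andP[/ltW k0 k1] := xr k; have /andP[/ltW l0 l1] := xr k.+2.
    have -> : (fun t => sqmod (g (circ (x k) t) - g (circ (x k.+2) t))) =
      (fun t => (sqmod (g (circ (x k) t)) + sqmod (g (circ (x k.+2) t)) +
        (-2) * complex.Re (g (circ (x k) t) * (g (circ (x k.+2) t))^*%C))).
      by apply/funext => t; rewrite !sqmodE !ReImE; ring.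
    apply: segcontD.
      apply: segcontD; first exact: circ_sqmod_ccont k0 (on_circ dg k1).
      exact: circ_sqmod_ccont l0 (on_circ dg l1).
    apply: segcontZ; exact: circ_pair_ccont k0 l0 (on_circ dg k1) (on_circ dg l1).
  - by move=> t; exact: sqmod_ge0.
have x_0 : x 0%N = s by rewrite /x expr0 mulr1.
have x_1 : x 1%N = r by rewrite /x expr1 /a mulrC divfK// gt_eqF.
pose de := N r - N s; have de0 : 0 < de by rewrite subr_gt0.
have inc k : de <= N (x k.+1) - N (x k).
  elim: k => [|k ih]; first by rewrite x_0 x_1.
  have := conv k; lra.
have lin k : N s + k%:R * de <= N (x k).
  elim: k => [|k ih]; first by rewrite x_0 mul0r addr0.
  have := inc k; rewrite -natr1 mulrDl mul1r; lra.
(* Continuity at 0 bounds g, hence its mean squares, on a small disc; the linear growth [lin]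
   contradicts this once the radii x j have entered the disc. *)
have [k [kk0 kk1 Hk]] : exists k : R, [/\ 0 < k, k < rho & forall w, normc w < k ->
    sqmod (g w) <= (normc (g 0) + 1) ^+ 2].
  have /cdiffP[D HD] : cdiff g 0 by apply: dg; rewrite Normc.normc0 (lt_trans s0).
  have [k k0 Hk] := has_cderiv_cont HD ltr01.
  exists (Num.min k s); split; first by rewrite lt_min k0.
    by rewrite gt_min srho orbT.
  move=> w; rewrite lt_min => /andP[/Hk + _]; rewrite add0r => h.
  have nn := normc_ge0 (g 0).
  rewrite sqmod_le_normc; last by lra.
  rewrite (_ : g w = g 0 + (g w - g 0)); last by rewrite addrC subrK.
  by apply: le_trans (normcD _ _) _; rewrite lerD2l.
set B := (normc (g 0) + 1) ^+ 2 in Hk.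
have bd j : x j < k -> N (x j) <= B.
  move=> xk; rewrite -[leRHS](cmean_cst (R := R)); apply: cmean_le.
  - have /andP[/ltW k0 k1] := xr j; exact: circ_sqmod_ccont k0 (on_circ dg k1).
  - exact: segcont_cst.
  - by move=> t; apply: Hk; rewrite normc_circ// ltW.
have [m Hm] : exists m, forall j, (m <= j)%N -> x j < k.
  have := cvg_expr (z := a); rewrite gtr0_norm// => /(_ a1)/cvgrPdist_lt.
  have ks : 0 < k / s by rewrite divr_gt0.
  move=> /(_ _ ks)[m _ Hm]; exists m => j mj; have := Hm j mj.
  by rewrite sub0r normrN ger0_norm ?exprn_ge0 ?(ltW a0)// ltr_pdivlMr// mulrC.
pose l := (Num.trunc ((B - N s) / de)).+1.
have h1 := bd (maxn m l) (Hm _ (leq_maxl _ _)).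
have h2 := lin (maxn m l).
have h3 : (B - N s) / de < (maxn m l)%:R.
  by apply: lt_le_trans (truncnS_gt _) _; rewrite ler_nat leq_maxr.
by move: h3; rewrite ltr_pdivrMr//; lra.
Qed.

End circle_pairing.

(** * Holomorphic functions on the ball *)

Section euclidean_norm.
Variables (R : realType) (n : nat).
Local Notation C := R[i].
Local Notation vec := 'rV[R[i]]_n.
Implicit Types (x y z : vec) (w : C) (r : R).

Definition sqsum z : R := \sum_(i < n) sqmod (z ord0 i).
(** The norm of ['rV[R[i]]_n] is the maximum of the moduli of the coordinates, whereas the ball is
    Euclidean. Differentials are estimated in the former, the ball in the latter; [enorm_le_norm]
    compares them with the crude factor n. *)
Definition enorm z : R := Num.sqrt (sqsum z).

Lemma sqsum_ge0 z : 0 <= sqsum z.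
Proof. by apply: sumr_ge0 => i _; exact: sqmod_ge0. Qed.

Lemma enorm_ge0 z : 0 <= enorm z.
Proof. exact: sqrtr_ge0. Qed.

Lemma sqr_enorm z : enorm z ^+ 2 = sqsum z.
Proof. by rewrite sqr_sqrtr// sqsum_ge0. Qed.

Lemma unit_ballE z : unit_ball z <-> enorm z < 1.
Proof.
rewrite /unit_ball /= -/(sqsum z) -sqr_enorm; have := enorm_ge0 z; move: (enorm z) => r r0.
split=> h; last by nra.
by rewrite ltNge; apply/negP => h'; nra.
Qed.

Lemma sqsumZ w z : sqsum (w *: z) = sqmod w * sqsum z.
Proof. by rewrite /sqsum mulr_sumr; apply: eq_bigr => i _; rewrite mxE sqmodM. Qed.

Lemma enormZ w z : enorm (w *: z) = normc w * enorm z.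
Proof. by rewrite /enorm sqsumZ sqrtrM ?sqmod_ge0// -sqmod_normc. Qed.

Lemma sqsum_eq0 z : sqsum z = 0 -> z = 0.
Proof.
move=> h; apply/rowP => i; rewrite mxE; apply: sqmod_eq0; apply/eqP.
move: h => /eqP; rewrite psumr_eq0; last by move=> *; exact: sqmod_ge0.
by move=> /allP/(_ i)/=; rewrite mem_index_enum => /(_ isT).
Qed.

Lemma enorm0 : enorm 0 = 0.
Proof. by rewrite /enorm /sqsum big1 ?sqrtr0// => i _; rewrite mxE sqmod0. Qed.

Lemma enormD x y : enorm (x + y) <= enorm x + enorm y.
Proof.
have [x0|x0] := eqVneq (enorm x) 0.
  have -> : x = 0 by apply: sqsum_eq0; rewrite -sqr_enorm x0 expr0n.
  by rewrite add0r enorm0 add0r.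
have [y0|y0] := eqVneq (enorm y) 0.
  have -> : y = 0 by apply: sqsum_eq0; rewrite -sqr_enorm y0 expr0n.
  by rewrite addr0 enorm0 addr0.
have {}x0 : 0 < enorm x by rewrite lt0r x0 enorm_ge0.
have {}y0 : 0 < enorm y by rewrite lt0r y0 enorm_ge0.
have xy0 : 0 <= enorm x + enorm y by rewrite addr_ge0// ltW.
rewrite -(ler_sqr _ _) ?nnegrE ?enorm_ge0// sqr_enorm.
(* With this e the weighted bound of [sqmodD_eps], summed over the coordinates, is exactly the
   square of the sum of the norms. *)
pose e := enorm y / enorm x; have e0 : 0 < e by rewrite divr_gt0.
have -> : (enorm x + enorm y) ^+ 2 = (1 + e) * sqsum x + (1 + e^-1) * sqsum y.
  by rewrite -!sqr_enorm /e; field; rewrite !gt_eqF.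
rewrite /sqsum !mulr_sumr -big_split /=; apply: ler_sum => i _.
by rewrite mxE; exact: sqmodD_eps.
Qed.

Lemma normc_le_enorm z i : normc (z ord0 i) <= enorm z.
Proof.
rewrite sqmod_normc; apply: ler_wsqrtr; rewrite /sqsum (bigD1 i)//= lerDl.
by apply: sumr_ge0 => j _; exact: sqmod_ge0.
Qed.

Lemma enorm_le_norm z r : 0 <= r -> `|z| <= r%:C%C -> enorm z <= n%:R * r.
Proof.
move=> r0 zr.
have zi i : normc (z ord0 i) <= r.
  rewrite -lecR; apply: le_trans zr; rewrite -normC_normc.
  rewrite -[`|z|]/(mx_norm z) mx_normE -[leLHS]nngE num_le.
  exact: (le_bigmax _ (fun ij : 'I_1 * 'I_n => `|z ij.1 ij.2|%:nng) (ord0, i)).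
have [n0|n0] := posnP n.
  rewrite /enorm /sqsum big1 ?sqrtr0 ?mulr_ge0// => i _.
  by have [] := negP (_ : ~~ (0 < n)%N) (leq_ltn_trans (leq0n i) (ltn_ord i));
    rewrite -leqNgt n0.
have nr0 : 0 <= n%:R * r by rewrite mulr_ge0.
rewrite -[leRHS]ger0_norm// -sqrtr_sqr; apply: ler_wsqrtr.
apply: (@le_trans _ _ (\sum_(i < n) r ^+ 2)).
  by apply: ler_sum => i _; rewrite sqmod_le_normc.
rewrite sumr_const card_ord -[leLHS]mulr_natl exprMn.
apply: ler_wpM2r; first exact: sqr_ge0.
by rewrite -natrX ler_nat -mulnn leq_pmulr.
Qed.

End euclidean_norm.

(** * Limits of bounded families along ultrafilters *)

Section bounded_ultralimit.
Variable R : realType.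

(** Compactness gives a cluster point, and an ultrafilter converges to its cluster points because it
    contains each set or its complement. *)
Lemma ultra_bounded_cvg_real (I : Type) (G : set_system I) (x : I -> R) (B : R) :
  UltraFilter G -> (forall i, `|x i| <= B) ->
  exists l : R, forall e : R, 0 < e -> \forall i \near G, `|x i - l| <= e.
Proof.
move=> GU xB.
have [|p [_ pc]] := @segment_compact R (- B) B (x @ G) _.
  by apply: (@filterE _ G) => i /=; rewrite in_itv /= -ler_norml.
exists p => e e0.
have [//|nG] := in_ultra_setVsetC [set i | `|x i - p| <= e] GU.
have nb : nbhs p (ball p e) by exact: nbhsx_ballx.
have nG' : (x @ G) (~` ball p e).
  apply: (@filterS _ G) nG => i /= h; rewrite /ball /= distrC => h'; apply: h; exact: ltW.
by have [y [h1 /= h2]] := pc _ _ nG' nb.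
Qed.

Lemma ultra_bounded_cvg (I : Type) (G : set_system I) (x : I -> R[i]) (B : R) :
  UltraFilter G -> (forall i, normc (x i) <= B) ->
  exists l : R[i], forall e : R, 0 < e -> \forall i \near G, normc (x i - l) <= e.
Proof.
move=> GU xB.
have [a Ha] := ultra_bounded_cvg_real GU (fun i => le_trans (normc_geRe (x i)) (xB i)).
have [b Hb] := ultra_bounded_cvg_real GU (fun i => le_trans (normc_geIm (x i)) (xB i)).
exists (a +i* b)%C => e e0; have e2 : 0 < e / 2 by rewrite divr_gt0.
near=> i; apply: le_trans (normc_le_ReIm _) _.
rewrite !ReImE /= [leRHS]splitr lerD//; near: i; [exact: Ha|exact: Hb].
Unshelve. all: by end_near. Qed.

Lemma ultra_lim_unique (I : Type) (G : set_system I) (x : I -> R[i]) (l l' : R[i]) :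
  ProperFilter G ->
  (forall e : R, 0 < e -> \forall i \near G, normc (x i - l) <= e) ->
  (forall e : R, 0 < e -> \forall i \near G, normc (x i - l') <= e) -> l = l'.
Proof.
move=> GU H H'; apply/eqP; rewrite -subr_eq0; apply/eqP/normc_eq0/eqP.
rewrite -normr_le0 ger0_norm ?normc_ge0//; apply/ler_addgt0Pr => e e0; rewrite add0r.
have e2 : 0 < e / 2 by rewrite divr_gt0.
have [i [h1 h2]] := filter_ex (filterI (H _ e2) (H' _ e2)).
rewrite (_ : l - l' = (x i - l') - (x i - l)); last by ring.
by apply: le_trans (normcB _ _) _; lra.
Qed.

Lemma lim_normc_le (I : Type) (G : set_system I) (x : I -> R[i]) (l : R[i]) (B : R) :
  ProperFilter G ->
  (forall e : R, 0 < e -> \forall i \near G, normc (x i - l) <= e) ->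
  (\forall i \near G, normc (x i) <= B) -> normc l <= B.
Proof.
move=> GF H HB; apply/ler_addgt0Pr => e e0.
have [i [h1 h2]] := filter_ex (filterI (H _ e0) HB).
rewrite (_ : l = x i - (x i - l)); last by ring.
by apply: le_trans (normcB _ _) _; lra.
Qed.

End bounded_ultralimit.

(** * Taylor estimates and limits of holomorphic functions on the ball *)

Section holomorphic.
Variables (R : realType) (n : nat).
Local Notation C := R[i].
Local Notation vec := 'rV[R[i]]_n.
Implicit Types (x y z h : vec) (w : C) (r d B : R) (f : vec -> C).

Lemma holomorphic_slice f z h w : holomorphic f -> enorm (z + w *: h) < 1 ->
  cdiff (fun w => f (z + w *: h)) w.
Proof.
move=> hf /unit_ballE/hf df.
apply: (@differentiable_comp C C^o vec C^o (fun w : C^o => z + w *: h) f) => //.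
Qed.

Lemma has_cderiv_slice f z h (L : {linear vec -> C^o}) :
  (forall e : R, 0 < e -> exists2 d : R, 0 < d &
     forall k : vec, `|k| < d%:C%C ->
       (normc (f (z + k) - f z - L k))%:C%C <= e%:C%C * `|k|) ->
  has_cderiv (fun w => f (z + w *: h)) 0 (L h).
Proof.
move=> H e e0; pose N := complex.Re `|h|.
have hN : `|h| = N%:C%C by rewrite RRe_real// realE normr_ge0.
have N0 : 0 <= N by rewrite -ler0c -hN normr_ge0.
have N1 : 0 < N + 1 by lra.
have [k k0 Hk] := H _ (divr_gt0 e0 N1). exists (k / (N + 1)); first by rewrite divr_gt0.
move=> w; rewrite ltr_pdivlMr// => wk; rewrite add0r scale0r addr0.
have nw : `|w *: h| = (normc w * N)%:C%C.
  by rewrite normrZ hN normC_normc rmorphM.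
have := Hk (w *: h); rewrite nw ltcR => /(_ _).
rewrite -rmorphM lecR linearZ /=.
have wN : normc w * N <= normc w * (N + 1) by rewrite ler_wpM2l ?normc_ge0//; lra.
move=> /(_ (le_lt_trans wN wk)) /le_trans; apply.
rewrite mulrA; apply: (@le_trans _ _ (e / (N + 1) * normc w * (N + 1))).
  apply: ler_wpM2l; last by lra.
  by rewrite mulr_ge0 ?normc_ge0// divr_ge0// ltW.
by rewrite mulrAC divfK// gt_eqF.
Qed.

Lemma ball_slice z h d w : enorm z + d < 1 -> normc w * enorm h <= d ->
  enorm (z + w *: h) < 1.
Proof.
by move=> zd wh; apply: le_lt_trans (enormD _ _) _; rewrite enormZ; lra.
Qed.

(** The one-variable estimates for w -> f(z + w h) on the disc of radius d / |h|, read off at w = 1.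
    The constants depend on B and d only, hence are uniform over a bounded family of functions. *)
Lemma taylor_ball f z d B (L : {linear vec -> C^o}) h :
  holomorphic f -> 0 < d -> enorm z + d < 1 ->
  (forall y, enorm (y - z) <= d -> normc (f y) <= B) ->
  (forall e : R, 0 < e -> exists2 d : R, 0 < d &
     forall k : vec, `|k| < d%:C%C ->
       (normc (f (z + k) - f z - L k))%:C%C <= e%:C%C * `|k|) ->
  normc (L h) <= 2 * B / d * enorm h /\
  (enorm h <= d / 4 ->
   normc (f (z + h) - f z) <= 4 * B / d * enorm h /\
   normc (f (z + h) - f z - L h) <= 32 * B / d ^+ 2 * enorm h ^+ 2).
Proof.
move=> hf d0 zd fB HL.
have [h0|h0] := eqVneq (enorm h) 0.
  have -> : h = 0 by apply: sqsum_eq0; rewrite -sqr_enorm h0 expr0n.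
  split; first by rewrite linear0 enorm0 mulr0 Normc.normc0.
  by rewrite addr0 linear0 subrr subr0 enorm0 [0 ^+ 2]expr2 !mulr0 Normc.normc0.
have {}h0 : 0 < enorm h by rewrite lt0r h0 enorm_ge0.
have r0 : 0 < d / enorm h by rewrite divr_gt0.
have dg w : normc w <= d / enorm h -> cdiff (fun w => f (z + w *: h)) w.
  by rewrite ler_pdivlMr// => wh; apply: holomorphic_slice => //; exact: ball_slice wh.
have gB w : normc w <= d / enorm h -> normc (f (z + w *: h)) <= B.
  by rewrite ler_pdivlMr// => wh; apply: fB; rewrite addrC addKr enormZ.
have Hd := has_cderiv_slice h HL.
split.
  apply: le_trans (cauchy_deriv r0 dg gB Hd) _.
  by rewrite le_eqVlt; apply/orP; left; apply/eqP; field; rewrite !gt_eqF.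
move=> hd; have w1 : normc (1 : C) <= d / enorm h / 4.
  by rewrite Normc.normc1 ler_pdivlMr// mul1r ler_pdivlMr//; lra.
have [T1 T2] := taylor1 r0 dg gB Hd w1.
move: T1 T2; rewrite scale1r scale0r addr0 mul1r Normc.normc1 expr1n !mulr1.
move=> T1 T2; split.
  apply: le_trans T1 _; rewrite le_eqVlt; apply/orP; left; apply/eqP; field.
  by rewrite !gt_eqF.
apply: le_trans T2 _; rewrite le_eqVlt; apply/orP; left; apply/eqP; field.
by rewrite !gt_eqF.
Qed.

(** Along a finer ultrafilter the differentials of the fs i at z, being bounded on each vector,
    converge to a linear map. The second-order estimate is uniform in i and so passes to the limit,
    which makes this map the differential of f. *)
Lemma holomorphic_limit (I : Type) (F : set_system I) (fs : I -> vec -> C) f :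
  ProperFilter F -> (forall i, holomorphic (fs i)) ->
  (forall r, r < 1 -> exists B, forall i z, enorm z <= r -> normc (fs i z) <= B) ->
  (forall z, enorm z < 1 -> forall e : R, 0 < e ->
     \forall i \near F, normc (fs i z - f z) <= e) ->
  holomorphic f.
Proof.
move=> FF hfs bnd; have [G [GU FG]] := ultraFilterLemma FF => cvgF.
have cvgG z : enorm z < 1 -> forall e : R, 0 < e ->
   \forall i \near G, normc (fs i z - f z) <= e.
  by move=> z1 e e0; apply: FG; exact: cvgF.
move=> z /unit_ballE z1.
pose d := (1 - enorm z) / 2; have d0 : 0 < d by rewrite divr_gt0// subr_gt0.
have zd : enorm z + d < 1 by rewrite /d; lra.
have [B HB] := bnd _ zd.
have fB i y : enorm (y - z) <= d -> normc (fs i y) <= B.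
  move=> yz; apply: HB; rewrite (_ : y = z + (y - z)); last by rewrite addrC subrK.
  by apply: le_trans (enormD _ _) _; rewrite lerD2l.
have /choice[L HL] : forall i, exists L : {linear vec -> C^o},
  forall e : R, 0 < e -> exists2 d : R, 0 < d &
     forall k : vec, `|k| < d%:C%C ->
       (normc (fs i (z + k) - fs i z - L k))%:C%C <= e%:C%C * `|k|.
  move=> i; have /unit_ballE/(hfs i)/differentiable_epsP[L [_ HL]] := z1.
  by exists L.
have T i h := taylor_ball h (hfs i) d0 zd (fB i) (HL i).
have /choice[l Hl] : forall h : vec, exists l : C,
    forall e : R, 0 < e -> \forall i \near G, normc (L i h - l) <= e.
  by move=> h; apply: (ultra_bounded_cvg (B := 2 * B / d * enorm h)) => // i; case: (T i h).
have ll : linear (l : vec -> C^o).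
  move=> a u v; apply: (ultra_lim_unique (x := fun i => L i (a *: u + v)) _ (Hl _)).
  move=> e e0; have a1 : 0 < normc a + 1 by rewrite ltr_wpDl ?normc_ge0.
  have e1 : 0 < e / 2 / (normc a + 1) by rewrite !divr_gt0.
  have e2 : 0 < e / 2 by rewrite divr_gt0.
  near=> i; have h1 : normc (L i u - l u) <= e / 2 / (normc a + 1) by near: i; exact: Hl.
  have h2 : normc (L i v - l v) <= e / 2 by near: i; exact: Hl.
  rewrite linearP (_ : _ - _ = a * (L i u - l u) + (L i v - l v)); last first.
    by rewrite -[a *: L i u]/(a * L i u) -[a *: l u]/(a * l u); ring.
  apply: le_trans (normcD _ _) _; rewrite Normc.normcM [leRHS]splitr lerD//.
  apply: le_trans (ler_wpM2l (normc_ge0 _) h1) _.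
  by rewrite mulrCA ler_piMr ?(ltW e2)// ler_pdivrMr// mul1r; lra.
pose L0 : {linear vec -> C^o} :=
  HB.pack (l : vec -> C^o) (GRing.isLinear.Build _ _ _ _ _ ll).
apply/differentiable_epsP; exists L0; split.
  apply: (linear_le_continuous (K := `|2 * B / d| * n%:R)) => h.
  pose N := complex.Re `|h|.
  have hN : `|h| = N%:C%C by rewrite RRe_real// realE normr_ge0.
  have N0 : 0 <= N by rewrite -ler0c -hN normr_ge0.
  rewrite hN -rmorphM lecR; apply: (@le_trans _ _ (2 * B / d * enorm h)).
    apply: (@lim_normc_le _ _ G (fun i => L i h) _ _ _ (Hl h)); apply: filterE => i.
    by case: (T i h).
  apply: (@le_trans _ _ (`|2 * B / d| * enorm h)).
    by rewrite ler_wpM2r ?enorm_ge0// ler_norm.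
  rewrite -[leRHS]mulrA; apply: ler_wpM2l => //.
  by apply: enorm_le_norm => //; rewrite hN.
have est h : enorm h <= d / 4 ->
    normc (f (z + h) - f z - l h) <= 32 * B / d ^+ 2 * enorm h ^+ 2.
  move=> hd.
  have zh : enorm (z + h) < 1 by apply: le_lt_trans (enormD _ _) _; lra.
  apply: (lim_normc_le (x := fun i => fs i (z + h) - fs i z - L i h) (G := G)).
    move=> e e0; have e3 : 0 < e / 3 by rewrite divr_gt0.
    near=> i.
    have h1 : normc (fs i (z + h) - f (z + h)) <= e / 3 by near: i; exact: cvgG.
    have h2 : normc (fs i z - f z) <= e / 3 by near: i; exact: cvgG.
    have h3 : normc (L i h - l h) <= e / 3 by near: i; exact: Hl.
    rewrite (_ : _ - _ = (fs i (z + h) - f (z + h)) - (fs i z - f z) - (L i h - l h)); last by ring.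
    apply: le_trans (normcB _ _) _; have := normcB (fs i (z + h) - f (z + h)) (fs i z - f z).
    lra.
  by apply: filterE => i; case: (T i h) => _ /(_ hd)[].
have B0 : 0 <= B.
  have [i _] := @filter_ex _ G _ setT filterT.
  by apply: le_trans (normc_ge0 _) (HB i z _); lra.
move=> e e0.
pose K := 32 * B / d ^+ 2.
have K0 : 0 <= K by rewrite divr_ge0 ?sqr_ge0// mulr_ge0.
pose m := n%:R + 1 : R; have m0 : 0 < m by rewrite ltr_wpDl.
have S0 : 0 < (K + 1) * m ^+ 2 by rewrite mulr_gt0 ?exprn_gt0//; lra.
(* The first bound keeps h in the range of the Taylor estimate, the second absorbs the quadratic
   error. The increments in K + 1 and m = n + 1 keep the denominators positive. *)
exists (Num.min (d / 4 / m) (e / ((K + 1) * m ^+ 2))).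
  rewrite lt_min; apply/andP; split; last exact: divr_gt0.
  by apply: divr_gt0 => //; exact: divr_gt0.
move=> h; pose N := complex.Re `|h|.
have hN : `|h| = N%:C%C by rewrite RRe_real// realE normr_ge0.
have N0 : 0 <= N by rewrite -ler0c -hN normr_ge0.
rewrite hN ltcR lt_min => /andP[N1]; rewrite ltr_pdivlMr// => N2.
have {}N1 : m * N <= d / 4 by move: N1; rewrite ltr_pdivlMr// mulrC => /ltW.
have hm : enorm h <= m * N.
  apply: le_trans (enorm_le_norm N0 _) _; first by rewrite hN.
  by apply: ler_wpM2r => //; rewrite /m lerDl.
rewrite -rmorphM lecR.
apply: le_trans (est h _) _; first exact: le_trans hm N1.
rewrite -/K; apply: (@le_trans _ _ (K * (m * N) ^+ 2)).
  apply: ler_wpM2l => //; rewrite ler_sqr ?nnegrE ?enorm_ge0//.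
  by apply: mulr_ge0 => //; exact: ltW.
have -> : K * (m * N) ^+ 2 = N * (K * m ^+ 2) * N by ring.
apply: ler_wpM2r => //; apply: le_trans (ltW N2).
by apply: ler_wpM2l => //; apply: ler_wpM2r; [exact: sqr_ge0|lra].
Unshelve. all: by end_near. Qed.

End holomorphic.

(** * Lebesgue measure on C^n and averages over circles *)

Section measure_preserving.
Variable R : realType.
Local Notation leb := (@lebesgue_measure R).
Local Notation mR := (measurableTypeR R).

Definition mpres d (T : measurableType d) (m : set T -> \bar R) (f : T -> T) :=
  measurable_fun setT f /\ forall A, measurable A -> m (f @^-1` A) = m A.

Lemma mpres_comp d (T : measurableType d) (m : {measure set T -> \bar R}) f g :
  mpres m f -> mpres m g -> mpres m (f \o g).
Proof.
move=> [mf Hf] [mg Hg]; split; first exact: measurableT_comp.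
move=> A mA; rewrite comp_preimage Hg ?Hf//.
by rewrite -[X in measurable X]setTI; exact: mf.
Qed.

Lemma mpres_integral d (T : measurableType d) (m : {measure set T -> \bar R}) f
    (F : T -> \bar R) : mpres m f -> measurable_fun setT F -> (forall x, 0 <= F x)%E ->
  (\int[m]_x F (f x) = \int[m]_x F x)%E.
Proof.
move=> [mf Hf] mF F0.
have := @ge0_integral_pushforward _ _ _ _ R f mf m setT F measurableT mF (fun y _ => F0 y).
rewrite preimage_setT => <-.
apply: (@eq_measure_integral _ _ _ setT m (image_measure m mf) F) => A mA _.
exact: Hf.
Qed.

Lemma lebesgue_measure_shift (c : R) : mpres leb (fun x : mR => (x + c : mR)).
Proof.
have mf : measurable_fun setT (fun x : mR => (x + c : mR)).
  by apply: measurable_funD => //; exact: measurable_cst.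
split => // A mA; apply/esym.
apply: (@lebesgue_measure_unique _ (image_measure leb mf)) => //= _ [[a b]] _ <-.
rewrite /pushforward /=.
have -> : (fun x : R => x + c) @^-1` `]a, b]%classic = `]a - c, b - c]%classic.
  by apply/seteqP; split => x /=; rewrite !in_itv /= => /andP[? ?]; apply/andP; split; lra.
rewrite !lebesgue_measure_itv /= !lte_fin ltrD2r; case: ifP => // _.
by rewrite -!EFinB; congr (_%:E); lra.
Qed.

Lemma mpres_fst d (T : measurableType d) (m : {measure set T -> \bar R}) f :
  mpres m f -> mpres (m \x leb)%E (fun p : T * mR => (f p.1, p.2)).
Proof.
move=> fp; have [mf Hf] := fp; split.
  by apply: measurable_fun_pair => //; exact: measurableT_comp.
move=> A mA; rewrite /product_measure1.
rewrite -(mpres_integral (F := leb \o xsection A) fp)//.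
exact: measurable_fun_xsection.
Qed.

Lemma mpres_skew d (T : measurableType d) (m : {measure set T -> \bar R})
    (phi : T -> R) : measurable_fun setT phi ->
  mpres (m \x leb)%E (fun p : T * mR => (p.1, (p.2 + phi p.1 : mR))).
Proof.
move=> mphi; split.
  apply: measurable_fun_pair => //; apply: measurable_funD => //.
  exact: measurableT_comp.
move=> A mA; rewrite /product_measure1; apply: eq_integral => x _ /=.
have [_ H] := lebesgue_measure_shift (phi x).
rewrite -(H (xsection A x)); last exact: measurable_xsection.
by congr (leb _); rewrite /xsection; apply/seteqP; split => y /=; rewrite !inE.
Qed.

(** The product measure integrates the measures of sections, so exchanging the last two coordinates
    is Tonelli's theorem on each plane slice. *)
Lemma mpres_swap d (T : measurableType d) (m : {sigma_finite_measure set T -> \bar R}) :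
  mpres ((m \x leb) \x leb)%E
    (fun p : T * mR * mR => ((p.1.1, p.2), p.1.2)).
Proof.
have ms : measurable_fun setT (fun p : T * mR * mR => ((p.1.1, p.2), p.1.2)).
  apply: measurable_fun_pair; last exact: (@measurableT_comp _ _ _ _ _ _ snd _ fst).
  by apply: measurable_fun_pair => //; exact: (@measurableT_comp _ _ _ _ _ _ fst _ fst).
have PE X : measurable X -> (((m \x leb) \x leb) X =
    \int[m]_t \int[leb]_x leb (xsection X (t, x)))%E.
  move=> mX; rewrite {1}/product_measure1 fubini_tonelli1//=.
  exact: (@measurable_fun_xsection _ _ _ _ _ leb X mX).
split=> // X mX; have mX' : measurable ((fun p : T * mR * mR =>
    ((p.1.1, p.2), p.1.2)) @^-1` X) by rewrite -[X in measurable X]setTI; exact: ms.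
rewrite (PE _ mX') (PE _ mX); apply: eq_integral => t _.
pose B := [set p : mR * mR | X ((t, p.1), p.2)].
have mB : measurable B.
  rewrite (_ : B = setT `&` (fun p : mR * mR => ((t, p.1), p.2)) @^-1` X).
    suff h : measurable_fun setT (fun p : mR * mR => ((t, p.1), p.2)) by exact: h.
    by apply: measurable_fun_pair => //; exact: measurable_fun_pair.
  by rewrite setTI.
have := @indic_fubini_tonelli _ _ _ _ R leb leb B mB.
by rewrite indic_fubini_tonelli_FE// indic_fubini_tonelli_GE.
Qed.

Definition plane_lift T (tau : plane R -> plane R) (p : T * mR * mR) : T * mR * mR :=
  ((p.1.1, (tau (p.1.2, p.2)).1), (tau (p.1.2, p.2)).2).

(** Stated for the last two factors of an arbitrary product, because [lebesgue] adds each complex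
    coordinate in this nested form; no product has to be reassociated. *)
Definition plane_pres (tau : plane R -> plane R) :=
  forall d (T : measurableType d) (m : {sigma_finite_measure set T -> \bar R}),
    mpres ((m \x leb) \x leb)%E (plane_lift tau).

Lemma plane_pres_comp s t : plane_pres s -> plane_pres t -> plane_pres (s \o t).
Proof.
move=> hs ht d T m; have := mpres_comp (hs d T m) (ht d T m).
rewrite (_ : plane_lift s \o plane_lift t = plane_lift (s \o t))//.
by apply/funext => -[[u x] y]; rewrite /plane_lift /=; case: (t (x, y)).
Qed.

Lemma plane_pres_shear (a b : R) : plane_pres (fun p => (p.1, p.2 + (a * p.1 + b))).
Proof.
move=> d T m.
have mphi : measurable_fun setT (fun p : T * mR => a * p.2 + b).
  by apply: measurable_funD => //; apply: measurable_funM.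
have := @mpres_skew _ _ (m \x leb)%E _ mphi.
by congr mpres; apply/funext => -[[t x] y].
Qed.

Lemma plane_pres_swap : plane_pres (fun p => (p.2, p.1)).
Proof. by move=> d T m; exact: mpres_swap. Qed.

Lemma plane_pres_shear' (a b : R) : plane_pres (fun p => (p.1 + (a * p.2 + b), p.2)).
Proof.
exact: (plane_pres_comp plane_pres_swap
  (plane_pres_comp (plane_pres_shear a b) plane_pres_swap)).
Qed.

Lemma plane_pres_translation (a b : R) : plane_pres (fun p => (p.1 + a, p.2 + b)).
Proof.
have := plane_pres_comp (plane_pres_shear' 0 a) (plane_pres_shear 0 b).
congr plane_pres; apply/funext => -[x y] /=.
by rewrite !mul0r !add0r.
Qed.

Definition rot (c s : R) (p : plane R) : plane R :=
  (c * p.1 - s * p.2, s * p.1 + c * p.2).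

(* A rotation other than the half-turn is a product of three shears. *)
Lemma plane_pres_rot c s : c ^+ 2 + s ^+ 2 = 1 -> plane_pres (rot c s).
Proof.
have shears (c' s' : R) : c' ^+ 2 + s' ^+ 2 = 1 -> c' != -1 -> plane_pres (rot c' s').
  move=> cs cN1; have c1 : 1 + c' != 0 by rewrite addrC addr_eq0.
  (* The tangent of half the angle. *)
  pose t := s' / (1 + c').
  have := plane_pres_comp (plane_pres_shear' (- t) 0)
    (plane_pres_comp (plane_pres_shear s' 0) (plane_pres_shear' (- t) 0)).
  congr plane_pres; apply/funext => -[x y]; rewrite /rot /= !addr0.
  have e1 : t * (1 + c') = s' by rewrite /t divfK.
  have e2 : s' * t = 1 - c'.
    apply: (mulIf c1); rewrite -mulrA e1 -expr2.
    by rewrite (_ : s' ^+ 2 = 1 - c' ^+ 2); [ring|lra].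
  have -> : y + s' * (x + - t * y) = s' * x + c' * y.
    rewrite mulrDr mulrA mulrN e2; ring.
  congr (_, _).
  have -> : x + - t * y + - t * (s' * x + c' * y) =
    x * (1 - s' * t) - (t * (1 + c')) * y by ring.
  by rewrite e1 e2; ring.
move=> cs; have [c1|] := eqVneq c (-1); last exact: shears.
have s0 : s = 0.
  by apply/eqP; rewrite -sqrf_eq0; apply/eqP; rewrite c1 sqrrN expr1n in cs; lra.
(* The half-turn is the square of the quarter-turn. *)
have h : plane_pres (rot 0 1).
  by apply: shears; [ring|rewrite eq_sym oppr_eq0 oner_eq0].
have := plane_pres_comp h h; congr plane_pres.
by apply/funext => -[x y]; rewrite /rot /= c1 s0; congr (_, _); ring.
Qed.

End measure_preserving.

(** * Coordinatewise transformations of Lebesgue measure *)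

Section lebesgue_tuple.
Variable R : realType.
Local Notation leb := (@lebesgue_measure R).
Local Notation mR := (measurableTypeR R).
Local Notation coords n := (n.-tuple (plane R)).

Definition box n (d : R) : set (coords n) :=
  [set t | all (fun p : plane R => (`|p.1| <= d) && (`|p.2| <= d)) t].

Lemma boxP n d (t : coords n) : box d t <->
  forall i, `|(tnth t i).1| <= d /\ `|(tnth t i).2| <= d.
Proof.
split=> [/all_tnthP h i|h]; first by have /andP[] := h i.
by apply/all_tnthP => i; have [-> ->] := h i.
Qed.

Lemma measurable_box n d : measurable (box d : set (coords n)).
Proof.
have mI : measurable (`[- d, d]%classic : set mR) by exact: measurable_itv.
have -> : (box d : set (coords n)) =
    \bigcap_(i in [set: 'I_n]) ((@tnth _ _ ^~ i) @^-1` (`[- d, d] `*` `[- d, d])).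
  apply/seteqP; split => t /=.
    by move=> /boxP h i _ /=; have [h1 h2] := h i; split;
      rewrite /= in_itv /= -ler_norml.
  move=> h; apply/boxP => i; have [] := h i I.
  by rewrite /= !in_itv /= -!ler_norml.
apply: fin_bigcap_measurable => // i _; rewrite -[X in measurable X]setTI.
by apply: measurable_tnth => //; exact: measurableX.
Qed.

Lemma lebesgue_box n d : 0 <= d ->
  lebesgue R n (box d) = ((d *+ 2) ^+ (n * 2))%:E.
Proof.
move=> d0; elim: n => [|n ih].
  rewrite /= diracE mem_set ?expr0//.
have mI : measurable (`[- d, d]%classic : set mR) by exact: measurable_itv.
have lI : leb `[- d, d] = (d *+ 2)%:E.
  rewrite lebesgue_measure_itv /= lte_fin.
  have [->|dn0] := eqVneq d 0; first by rewrite oppr0 ltxx mul0rn.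
  by rewrite gtrN ?lt0r ?dn0// -EFinB opprK mulr2n.
have -> : lebesgue R n.+1 (box d) = ((lebesgue R n \x leb) \x leb)%E
    ((box d `*` `[- d, d]) `*` `[- d, d]).
  rewrite /= /pushforward; congr (product_measure1 _ _ _).
  apply/seteqP; split=> -[[t x] y]; rewrite /box /= !in_itv /= -!ler_norml.
    by move=> /andP[/andP[-> ->] ->].
  by move=> [[-> ->] ->].
have mB : measurable (box d : set (coords n)) by exact: measurable_box.
have mBI : measurable ((box d : set (coords n)) `*` (`[- d, d]%classic : set mR)).
  exact: measurableX.
rewrite (product_measure1E _ _ mBI mI) /= (product_measure1E _ _ mB mI).
rewrite ih lI [X in (_ * X * _)%E]lI -!EFinM; congr (_%:E).
by rewrite mulSn addnC exprD -mulrA -expr2.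
Qed.

Lemma sigma_finite_lebesgue n : sigma_finite setT (lebesgue R n).
Proof.
exists (fun k => box k%:R).
  apply/esym/seteqP; split => // t _.
  pose S := \sum_(i < n) (`|(tnth t i).1| + `|(tnth t i).2|).
  exists (Num.trunc S).+1 => //=; apply/boxP => i.
  have h : `|(tnth t i).1| + `|(tnth t i).2| <= S.
    by rewrite /S (bigD1 i)//= lerDl sumr_ge0// => j _; rewrite addr_ge0.
  have := truncnS_gt S; have := normr_ge0 (tnth t i).1; have := normr_ge0 (tnth t i).2.
  by move: h => /=; split; lra.
by move=> k; split; [exact: measurable_box|rewrite lebesgue_box ?ltry].
Qed.

(** A copy under its own name, to which the sigma-finite structure demanded by Tonelli's theorem and
    by [plane_pres] is attached. *)
Definition lebesgue_sf n : set (coords n) -> \bar R := lebesgue R n.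

HB.instance Definition _ n := isMeasure.Build _ _ _ (@lebesgue_sf n)
  (measure0 (lebesgue R n)) (measure_ge0 (lebesgue R n))
  (@measure_semi_sigma_additive _ _ _ (lebesgue R n)).

HB.instance Definition _ n := Measure_isSigmaFinite.Build _ _ _ (@lebesgue_sf n)
  (sigma_finite_lebesgue n).

Definition cmap n (tau : 'I_n -> plane R -> plane R) (t : coords n) : coords n :=
  [tuple tau i (tnth t i) | i < n].

(** By induction on n: through [cons_coord] the map becomes a map of the tail, covered by the
    induction hypothesis, composed with a [plane_lift] of the two new real coordinates. *)
Lemma lebesgue_cmap n (tau : 'I_n -> plane R -> plane R) :
  (forall i, plane_pres (tau i)) -> mpres (lebesgue R n) (cmap tau).
Proof.
elim: n tau => [|n ih] tau htau.
  have -> : cmap tau = id by apply/funext => t; rewrite [LHS]tuple0 [RHS]tuple0.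
  by split => //; exact: measurable_id.
have [mT HT] := ih (fun i => tau (lift ord0 i)) (fun i => htau _).
pose T := cmap (fun i => tau (lift ord0 i)).
have h1 : mpres ((lebesgue R n \x leb) \x leb)%E
    (fun p : coords n * mR * mR => ((T p.1.1, p.1.2), p.2)).
  by apply: (mpres_fst (m := (lebesgue R n \x leb)%E)
    (f := fun p : coords n * mR => (T p.1, p.2))); exact: mpres_fst.
have h2 := htau ord0 _ _ (@lebesgue_sf n).
have [mP HP] := mpres_comp h1 h2.
have E p : cmap tau (cons_coord p) =
    cons_coord (((fun p : coords n * mR * mR => ((T p.1.1, p.1.2), p.2)) \o
      plane_lift (tau ord0)) p).
  case: p => [[t x] y]; apply: eq_from_tnth => i; rewrite tnth_mktuple /cons_coord /=.
  have [->|] := eqVneq i ord0.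
    by rewrite !(tnth_nth (0, 0)) /=; case: (tau ord0 (x, y)).
  case: (unliftP ord0 i) => [j ->|->]; last by rewrite eqxx.
  by move=> _; rewrite !tnthS tnth_mktuple.
split.
  apply/measurable_fun_tnthP => i.
  (* Measurability of [tau i] itself is read off from [plane_pres] with the line as auxiliary space,
     restricted to the slice over 0. *)
  have mtau : measurable_fun setT (tau i : plane R -> plane R).
    have [mL _] := htau i _ _ (leb).
    have mt : measurable_fun setT (fun q : plane R => ((0 : mR, q.1), q.2)).
      by apply: measurable_fun_pair => //; apply: measurable_fun_pair.
    have := measurableT_comp mL mt => mc.
    apply: (measurable_fun_pairP (tau i)).2; split.
      rewrite (_ : fst \o tau i = (snd \o fst) \o (plane_lift (tau i) \o
         (fun q : plane R => ((0 : mR, q.1), q.2)))); last by apply/funext => -[].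
      apply: measurableT_comp mc.
      exact: (@measurableT_comp _ _ _ _ _ _ snd _ fst).
    rewrite (_ : snd \o tau i = snd \o (plane_lift (tau i) \o
       (fun q : plane R => ((0 : mR, q.1), q.2)))); last by apply/funext => -[].
    by apply: measurableT_comp mc.
  rewrite (_ : _ \o _ = tau i \o (@tnth _ _ ^~ i)); last first.
    by apply/funext => t /=; rewrite tnth_mktuple.
  by apply: measurableT_comp mtau _; exact: measurable_tnth.
move=> A mA; rewrite /= /pushforward.
have mcA : measurable (@cons_coord R n @^-1` A).
  by rewrite -[X in measurable X]setTI; exact: measurable_cons_coord.
rewrite -[RHS](HP _ mcA); congr (product_measure1 _ _ _).
by apply/seteqP; split => p /=; rewrite E.
Qed.

End lebesgue_tuple.

Lemma measurable_sqmod (R : realType) d (T : measurableType d) (D : set T) (g : T -> R[i]) :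
  measurable_fun D (fun t => complex.Re (g t)) ->
  measurable_fun D (fun t => complex.Im (g t)) ->
  measurable_fun D (fun t => sqmod (g t)).
Proof.
move=> m1 m2; under eq_fun do rewrite sqmodE.
by apply: measurable_funD; exact: measurable_funX.
Qed.

(** * Rotations, translations and measurability in real coordinates *)

Section coordinates.
Variables (R : realType) (n : nat).
Local Notation C := R[i].
Local Notation vec := 'rV[R[i]]_n.
Local Notation coords := (n.-tuple (plane R)).
Local Notation leb := (@lebesgue_measure R).
Local Notation mR := (measurableTypeR R).
Local Notation L := (lebesgue R n).
Implicit Types (f : vec -> C) (t : coords) (z : vec) (r th : R).

Lemma sqnormE t : sqnorm t = sqsum (complex_point t).
Proof.
rewrite /sqnorm /sqsum; apply: eq_bigr => i _; rewrite mxE sqmodE /=.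
by [].
Qed.

Lemma coord_ballE t : coord_ball t <-> enorm (complex_point t) < 1.
Proof. by rewrite /coord_ball /= sqnormE -unit_ballE. Qed.

Lemma coord_sphereE t : coord_sphere t <-> enorm (complex_point t) = 1.
Proof.
rewrite /coord_sphere /= sqnormE -sqr_enorm.
split=> [h|->]; last by rewrite expr1n.
by apply/eqP; rewrite -sqrp_eq1 ?enorm_ge0// h.
Qed.

Lemma measurable_cmap (tau : 'I_n -> plane R -> plane R) :
  (forall i, measurable_fun setT (tau i)) -> measurable_fun setT (cmap tau).
Proof.
move=> h; apply/measurable_fun_tnthP => i.
rewrite (_ : _ \o _ = tau i \o (@tnth _ _ ^~ i)); last first.
  by apply/funext => t /=; rewrite tnth_mktuple.
by apply: measurableT_comp (h i) _; exact: measurable_tnth.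
Qed.

Definition crot th : coords -> coords := cmap (fun=> rot (cos th) (sin th)).
Definition ctrans z : coords -> coords :=
  cmap (fun i p => (p.1 + complex.Re (z ord0 i), p.2 + complex.Im (z ord0 i))).
Definition cscale r : coords -> coords := cmap (fun _ p => (r * p.1, r * p.2)).

Lemma complex_point_rot th t :
  complex_point (crot th t) = cis th *: complex_point t.
Proof.
apply/rowP => i; rewrite !mxE tnth_mktuple /rot /cis /=.
by apply: complex_ext; rewrite ReImE /=; ring.
Qed.

Lemma complex_point_trans z t : complex_point (ctrans z t) = complex_point t + z.
Proof.
apply/rowP => i; rewrite !mxE tnth_mktuple /=.
by apply: complex_ext; rewrite ReImE /=.
Qed.

Lemma complex_point_scale r t : complex_point (cscale r t) = r%:C%C *: complex_point t.
Proof.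
apply/rowP => i; rewrite !mxE tnth_mktuple /=.
by apply: complex_ext; rewrite ReImE /=; ring.
Qed.

Lemma mpres_crot th : mpres L (crot th).
Proof. by apply: lebesgue_cmap => _; apply: plane_pres_rot; exact: cos2Dsin2. Qed.

Lemma mpres_ctrans z : mpres L (ctrans z).
Proof. by apply: lebesgue_cmap => i; exact: plane_pres_translation. Qed.

Lemma measurable_cscale r : measurable_fun setT (cscale r).
Proof.
apply: measurable_cmap => _; apply: measurable_fun_pair.
  by apply: measurable_funM => //; exact: measurable_cst.
by apply: measurable_funM => //; exact: measurable_cst.
Qed.

Lemma enorm_rot th t : enorm (complex_point (crot th t)) = enorm (complex_point t).
Proof. by rewrite complex_point_rot enormZ normc_cis mul1r. Qed.

Lemma sqnorm_rot th t : sqnorm (crot th t) = sqnorm t.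
Proof. by rewrite !sqnormE -!sqr_enorm enorm_rot. Qed.

(** Joint measurability in the point and the angle, as Tonelli's theorem needs it in
    [rot_average]. *)
Lemma measurable_rot_pair : measurable_fun setT (fun p : coords * mR => crot p.2 p.1).
Proof.
have mc : measurable_fun setT (fun x : mR => (cos x : mR)).
  exact: continuous_measurable_fun (@continuous_cos R).
have ms : measurable_fun setT (fun x : mR => (sin x : mR)).
  exact: continuous_measurable_fun (@continuous_sin R).
have mc2 : measurable_fun setT (fun p : coords * mR => (cos p.2 : mR)).
  exact: (measurableT_comp mc).
have ms2 : measurable_fun setT (fun p : coords * mR => (sin p.2 : mR)).
  exact: (measurableT_comp ms).
apply/measurable_fun_tnthP => i.
rewrite (_ : _ \o _ = fun p : coords * mR =>
    (cos p.2 * (tnth p.1 i).1 - sin p.2 * (tnth p.1 i).2,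
     sin p.2 * (tnth p.1 i).1 + cos p.2 * (tnth p.1 i).2)); last first.
  by apply/funext => p /=; rewrite tnth_mktuple.
have mt : measurable_fun setT (fun p : coords * mR => tnth p.1 i).
  exact: (measurableT_comp (measurable_tnth i)).
have m1 : measurable_fun setT (fun p : coords * mR => (tnth p.1 i).1).
  exact: (measurableT_comp measurable_fst mt).
have m2 : measurable_fun setT (fun p : coords * mR => (tnth p.1 i).2).
  exact: (measurableT_comp measurable_snd mt).
apply: measurable_fun_pair.
  by apply: measurable_funB; apply: measurable_funM.
by apply: measurable_funD; apply: measurable_funM.
Qed.

Let I2 : set mR := `[0, pi *+ 2]%classic.

Definition theta_int (u : R -> \bar R) : \bar R := (\int[leb]_(th in I2) u th)%E.

Lemma rot_average (F : coords -> \bar R) : measurable_fun setT F ->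
  (forall t, 0 <= F t)%E ->
  (\int[L]_t theta_int (fun th => F (crot th t)) = (pi *+ 2)%:E * \int[L]_t F t)%E.
Proof.
move=> mF F0.
pose G (p : coords * mR) : \bar R := (F (crot p.2 p.1) * (\1_I2 p.2)%:E)%E.
have mI : measurable I2 by exact: measurable_itv.
have mi : measurable_fun setT (fun x : mR => ((\1_I2 x)%:E : \bar R)).
  exact/measurable_EFinP/measurable_indic.
have mFr : measurable_fun setT (fun p : coords * mR => F (crot p.2 p.1)).
  exact: (measurableT_comp mF measurable_rot_pair).
have mG : measurable_fun setT G.
  apply: emeasurable_funM => //.
  exact: (measurableT_comp mi measurable_snd).
have G0 p : (0 <= G p)%E by rewrite mule_ge0// lee_fin indicE.
have FT := @fubini_tonelli _ _ _ _ R (@lebesgue_sf R n) leb G mG G0.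
transitivity (\int[L]_t \int[leb]_x (F (crot x t) * (\1_I2 x)%:E))%E.
  apply: eq_integral => t _; rewrite /theta_int integral_mkcond.
  apply: eq_integral => x _; rewrite patchE indicE.
  by case: (x \in I2); rewrite ?mule1 ?mule0.
rewrite [LHS]FT.
transitivity (\int[leb]_x ((\int[L]_t F t) * (\1_I2 x)%:E))%E.
  apply: eq_integral => x _; rewrite /G /= -(mpres_integral (mpres_crot x) mF F0).
  apply: ge0_integralZr => //.
  exact: (measurableT_comp mF (mpres_crot x).1).
rewrite ge0_integralZl//; last exact: integral_ge0.
have lI : leb I2 = (pi *+ 2)%:E.
  by rewrite lebesgue_measure_itv /= lte_fin mulrn_wgt0 ?pi_gt0// -EFinB subr0.
by rewrite integral_indic// setIT [X in (_ * X)%E]lI muleC.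
Qed.

(** By [rot_average] both integrals are, up to the factor 2 pi, integrals of circle integrals. This
    takes the place of polar coordinates. *)
Lemma rot_average_le (F G : coords -> \bar R) :
  measurable_fun setT F -> measurable_fun setT G ->
  (forall t, 0 <= F t)%E -> (forall t, 0 <= G t)%E ->
  (forall t, theta_int (fun th => F (crot th t)) <= theta_int (fun th => G (crot th t)))%E ->
  (\int[L]_t F t <= \int[L]_t G t)%E.
Proof.
move=> mF mG F0 G0 H.
have p0 : (0 : R) < pi *+ 2 by rewrite mulrn_wgt0 ?pi_gt0.
have h : (\int[L]_t theta_int (fun th => F (crot th t)) <=
          \int[L]_t theta_int (fun th => G (crot th t)))%E.
  have mth (E : coords -> \bar R) : measurable_fun setT E -> (forall t, 0 <= E t)%E ->
      measurable_fun setT (fun t => theta_int (fun th => E (crot th t))).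
    move=> mE E0.
    have mI : measurable I2 by exact: measurable_itv.
    have mi : measurable_fun setT (fun x : mR => ((\1_I2 x)%:E : \bar R)).
      exact/measurable_EFinP/measurable_indic.
    have := @measurable_fun_fubini_tonelli_F _ _ coords mR R leb
      (fun p => (E (crot p.2 p.1) * (\1_I2 p.2)%:E)%E).
    rewrite /fubini_F /=.
    have -> : (fun x => (\int[leb]_y (E (crot y x) * (\1_I2 y)%:E))%E) =
              (fun t => theta_int (fun th => E (crot th t))).
      apply/funext => t; rewrite /theta_int [RHS]integral_mkcond.
      apply: eq_integral => x _; rewrite patchE indicE.
      by case: (x \in I2); rewrite ?mule1 ?mule0.
    apply; last by move=> p; rewrite mule_ge0// lee_fin indicE.
    apply: emeasurable_funM; first exact: (measurableT_comp mE measurable_rot_pair).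
    exact: (measurableT_comp mi measurable_snd).
  apply: ge0_le_integral => //.
  - by move=> t _; apply: integral_ge0.
  - exact: mth.
  - exact: mth.
by move: h; rewrite !rot_average// lee_pmul2l// lte_fin.
Qed.

Lemma theta_intE (u : R -> R) : segcont u 0 (pi *+ 2) ->
  theta_int (fun th => (u th)%:E) = (pi *+ 2 * cmean u)%:E.
Proof.
move=> uc; rewrite /theta_int /cmean mulrA divff ?mul1r; last first.
  by rewrite gt_eqF// mulrn_wgt0// pi_gt0.
rewrite /segint /Rintegral fineK//; apply: integrable_fin_num => //.
exact: segcont_integrable.
Qed.

Lemma eq_theta_int (u v : R -> \bar R) : u =1 v -> theta_int u = theta_int v.
Proof. by move=> uv; congr theta_int; apply/funext. Qed.

Lemma le_theta_int (u v : R -> R) : segcont u 0 (pi *+ 2) -> segcont v 0 (pi *+ 2) ->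
  cmean u <= cmean v ->
  (theta_int (fun th => (u th)%:E) <= theta_int (fun th => (v th)%:E))%E.
Proof.
move=> uc vc uv; rewrite !theta_intE// lee_fin ler_wpM2l//.
by rewrite mulrn_wge0// pi_ge0.
Qed.

(** The extension by zero: f is arbitrary outside the ball, where it need not be measurable. *)
Definition fhat f t : C := if sqnorm t < 1 then f (complex_point t) else 0.

Lemma fhatE f t : enorm (complex_point t) < 1 -> fhat f t = f (complex_point t).
Proof. by move=> /coord_ballE h; rewrite /fhat ifT. Qed.

Definition grid_index (m : nat) t : n.-tuple (int * int) :=
  [tuple (Num.floor ((tnth t i).1 * m.+1%:R), Num.floor ((tnth t i).2 * m.+1%:R)) | i < n].

Definition grid_point (m : nat) (q : n.-tuple (int * int)) : vec :=
  \row_(i < n) Complex ((tnth q i).1%:~R / m.+1%:R) ((tnth q i).2%:~R / m.+1%:R).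

Lemma measurable_grid m (g : n.-tuple (int * int) -> R) :
  measurable_fun setT (g \o grid_index m).
Proof.
move=> _ Y mY; rewrite setTI.
pose A q := [set t | grid_index m t = q].
have mA q : measurable (A q).
  have -> : A q = \bigcap_(i in [set: 'I_n]) ((@tnth _ _ ^~ i) @^-1`
     ([set x : R | Num.floor (x * m.+1%:R) = (tnth q i).1] `*`
      [set x : R | Num.floor (x * m.+1%:R) = (tnth q i).2])).
    apply/seteqP; split => t /=.
      by move=> <- i _ /=; rewrite tnth_mktuple.
    move=> h; apply: eq_from_tnth => i; rewrite tnth_mktuple.
    by have [/= -> ->] := h i I; case: (tnth q i).
  have mfl (a : int) : measurable ([set x : R | Num.floor (x * m.+1%:R) = a] : set mR).
    have m0 : (0 : R) < m.+1%:R by rewrite ltr0n.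
    rewrite (_ : mkset _ = `[a%:~R / m.+1%:R, (a + 1)%:~R / m.+1%:R[%classic).
      exact: measurable_itv.
    apply/seteqP; split => x /=; rewrite in_itv /= ler_pdivrMr// ltr_pdivlMr//.
      by move=> <-; exact: floor_itv.
    by rewrite -floor_eq => /eqP.
  apply: fin_bigcap_measurable => // i _; rewrite -[X in measurable X]setTI.
  by apply: measurable_tnth => //; exact: measurableX.
have -> : (g \o grid_index m) @^-1` Y =
   \bigcup_k (if unpickle k is Some q then if pselect (Y (g q)) then A q else set0 else set0).
  apply/seteqP; split => t /=.
    by move=> Yt; exists (pickle (grid_index m t)) => //=; rewrite pickleK; case: pselect.
  by move=> [k _ /=]; case: unpickle => // q; case: pselect => // h ->.
apply: bigcup_measurable => k _; case: unpickle => // q.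
by case: pselect => [h|h] /=; [exact: mA|exact: measurable0].
Qed.

Lemma row_norm_lt z r : 0 < r -> (forall i, normc (z ord0 i) < r) -> `|z| < r%:C%C.
Proof.
move=> r0 zr; rewrite -[`|z|]/(mx_norm z).
have [->|/mx_norm_neq0[[i j] ->]] := eqVneq (mx_norm z) 0; first by rewrite ltcR.
by rewrite ord1 /= normC_normc ltcR.
Qed.

(** On the ball f is the pointwise limit of its values at nearby grid points, and each of these
    approximations is constant on countably many measurable cells. *)
Lemma measurable_fhat f : holomorphic f ->
  measurable_fun setT (fun t => complex.Re (fhat f t)) /\
  measurable_fun setT (fun t => complex.Im (fhat f t)).
Proof.
move=> hf.
suff H (p : C -> R) : continuous (p : C^o -> R) -> p 0 = 0 ->
    measurable_fun setT (fun t => p (fhat f t)).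
  by split; apply: H => //; [exact: continuous_Re|exact: continuous_Im].
move=> cp p0.
have mB := @measurable_coord_ball R n.
have -> : (fun t => p (fhat f t)) = (fun t => p (f (complex_point t))) \_ (@coord_ball R n).
  apply/funext => t; rewrite patchE /fhat; case: ifPn => h.
    by rewrite mem_set.
  by rewrite memNset//= => h'; rewrite h' in h.
apply/(measurable_restrictT _ mB).
apply: (@measurable_fun_cvg _ _ _ _
  (fun m t => p (f (grid_point m (grid_index m t))))).
  move=> m; apply: measurable_funTS.
  exact: (@measurable_grid m (fun q => p (f (grid_point m q)))).
move=> t /coord_ballE/unit_ballE/hf df.
have cf := @differentiable_continuous C _ _ _ _ df.
apply/cvgrPdist_le => e e0.
have /cvgrPdist_le/(_ e e0) pnear := cp (f (complex_point t)).
have /near_normedP[d d0 Hd] := cf _ pnear.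
(* Rounding the real and the imaginary part costs 1 / (m + 1) each, and 2 / (m + 1) < d. *)
pose N := (Num.trunc (3 / d)).+1.
exists N => // m Nm; apply: Hd; apply: row_norm_lt => // i.
rewrite !mxE tnth_mktuple.
set x := (tnth t i).1; set y := (tnth t i).2.
have m0 : (0 : R) < m.+1%:R by rewrite ltr0n.
have fl (u : R) : `|(Num.floor (u * m.+1%:R))%:~R / m.+1%:R - u| <= (m.+1%:R)^-1.
  have /andP[h1 h2] := floor_itv (u * m.+1%:R).
  have -> : (Num.floor (u * m.+1%:R))%:~R / m.+1%:R - u =
      ((Num.floor (u * m.+1%:R))%:~R - u * m.+1%:R) / m.+1%:R.
    by rewrite mulrBl mulfK// gt_eqF.
  rewrite normrM (ger0_norm (x := (m.+1%:R)^-1)) ?invr_ge0 ?ler0n//.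
  apply: ler_piMl; first by rewrite invr_ge0 ler0n.
  by rewrite ler_norml; move: h2; rewrite intrD => h2; apply/andP; split; lra.
apply: le_lt_trans (normc_le_ReIm _) _; rewrite !ReImE /=.
apply: le_lt_trans (lerD (fl x) (fl y)) _.
have : 3 / d < m.+1%:R.
  by apply: lt_le_trans (truncnS_gt _) _; rewrite ler_nat ltnW// ltnS.
rewrite ltr_pdivrMr// => h3.
have -> : m.+1%:R^-1 + m.+1%:R^-1 = 2 / m.+1%:R :> R by field; rewrite gt_eqF.
by rewrite ltr_pdivrMr//; lra.
Qed.

Lemma measurable_sqmod_fhat f : holomorphic f ->
  measurable_fun setT (fun t => sqmod (fhat f t)).
Proof. by move=> /measurable_fhat[? ?]; exact: measurable_sqmod. Qed.

End coordinates.

(** * Integrals over the ball and the sphere *)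

Section normalized_measures.
Variables (R : realType) (n : nat).
Local Notation C := R[i].
Local Notation vec := 'rV[R[i]]_n.
Local Notation coords := (n.-tuple (plane R)).
Local Notation L := (lebesgue R n).
Local Notation B := (@coord_ball R n).
Local Notation S := (@coord_sphere R n).
Implicit Types (f : vec -> C) (t : coords) (z : vec) (r th : R).
Local Open Scope ereal_scope.

Definition cball r : set coords := [set t | (enorm (complex_point t) < r)%R].

Lemma coord_ball_cball : B = cball 1.
Proof. by apply/seteqP; split => t /coord_ballE. Qed.

Lemma measurable_enorm : measurable_fun setT (fun t => enorm (complex_point t)).
Proof.
rewrite (_ : (fun t => _) = (fun x : R => (x `^ 2^-1)%R) \o @sqnorm R n).
  exact: measurableT_comp (measurable_powR _) (@measurable_sqnorm R n).
by apply/funext => t /=; rewrite powR12_sqrt ?sqnorm_ge0// sqnormE.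
Qed.

Lemma measurable_cball r : measurable (cball r).
Proof.
rewrite (_ : cball r = setT `&` (fun t => enorm (complex_point t)) @^-1` `]-oo, r[).
  by apply: measurable_enorm => //; exact: measurable_itv.
by rewrite setTI; apply/seteqP; split=> t /=; rewrite in_itv.
Qed.

Lemma measurable_coord_sphere : measurable S.
Proof.
rewrite (_ : S = setT `&` (@sqnorm R n) @^-1` [set 1%R]).
  by apply: measurable_sqnorm => //; exact: measurable_set1.
by rewrite setTI.
Qed.

Lemma lebesgue_cball_lty r : L (cball r) < +oo.
Proof.
have [r0|r0] := leP 0%R r; last first.
  rewrite (_ : cball r = set0) ?measure0//; apply/seteqP; split => t //= h.
  by have := enorm_ge0 (complex_point t); rewrite leNgt (lt_trans h).
apply: (@le_lt_trans _ _ (L (box r))); last by rewrite lebesgue_box// ltry.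
apply: le_measure; rewrite ?inE; [exact: measurable_cball|exact: measurable_box|].
move=> t /= /ltW h; apply/boxP => i.
have /= h1 := normc_geRe (complex_point t ord0 i).
have /= h2 := normc_geIm (complex_point t ord0 i).
have h3 := le_trans (normc_le_enorm (complex_point t) i) h.
rewrite mxE /= in h1 h2 h3.
by split; [exact: le_trans h1 h3|exact: le_trans h2 h3].
Qed.

Lemma lebesgue_cball_gt0 r : (0 < r)%R -> 0 < L (cball r).
Proof.
(* A point of the box of half-side d has coordinates of modulus at most 2 d, hence Euclidean norm at
   most 2 n d, which is less than m d = r. *)
move=> r0; pose m : R := (n%:R * 2 + 1)%R.
have m0 : (0 < m)%R by rewrite ltr_wpDl// mulr_ge0.
pose d := (r / m)%R; have d0 : (0 < d)%R by rewrite divr_gt0.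
apply: (@lt_le_trans _ _ (L (box d))).
  by rewrite lebesgue_box ?(ltW d0)// lte_fin exprn_gt0// mulrn_wgt0.
apply: le_measure; rewrite ?inE; [exact: measurable_box|exact: measurable_cball|].
move=> t /boxP h /=.
have zi i : (normc (complex_point t ord0 i) <= d * 2)%R.
  apply: le_trans (normc_le_ReIm _) _; rewrite mxE /=.
  by have [h1 h2] := h i; rewrite mulr_natr mulr2n lerD.
have dd : (0 <= d * 2)%R by rewrite mulr_ge0// ltW.
have hn : (`|complex_point t| <= (d * 2)%:C%C)%R.
  rewrite -[`|_|%R]/(mx_norm (complex_point t)).
  have [->|/mx_norm_neq0[[i j] ->]] := eqVneq (mx_norm (complex_point t)) 0%R.
    by rewrite ler0c.
  by rewrite ord1 /= normC_normc lecR.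
apply: le_lt_trans (enorm_le_norm dd hn) _.
have dm : (d * m = r)%R by rewrite /d divfK// gt_eqF.
rewrite -dm (_ : n%:R * (d * 2) = d * (n%:R * 2))%R; last by ring.
by rewrite ltr_pM2l// /m ltrDl.
Qed.

Definition ball_vol : R := fine (L B).

Lemma ball_volE : L B = ball_vol%:E.
Proof.
by rewrite fineK// ge0_fin_numE// coord_ball_cball lebesgue_cball_lty.
Qed.

Lemma ball_vol_gt0 : (0 < ball_vol)%R.
Proof. by rewrite -lte_fin -ball_volE coord_ball_cball lebesgue_cball_gt0. Qed.

Lemma integral_ball_measure (D : set coords) (F : coords -> \bar R) :
  measurable D -> measurable_fun D F -> (forall t, D t -> 0 <= F t) ->
  \int[ball_measure R n]_(t in D) F t = (ball_vol^-1)%:E * \int[L]_(t in D `&` B) F t.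
Proof.
move=> mD mF F0; rewrite /ball_measure ge0_integral_mscale//=; congr (_ * _).
have mB := @measurable_coord_ball R n.
have mN : measurable (~` B) by exact: measurableC.
have N0 : mrestr L mB (~` B) = 0 by rewrite /mrestr setICl measure0.
rewrite (@ge0_negligible_integral _ _ _ (mrestr L mB) D (~` B))//.
rewrite setDE setCK; apply: eq_measure_integral => A mA AD.
by rewrite /= /mrestr setIidl// => t /AD[].
Qed.

Lemma radial_projE t : complex_point (radial_proj t) =
  ((enorm (complex_point t))^-1)%:C%C *: complex_point t.
Proof.
apply/rowP => i; rewrite !mxE tnth_mktuple sqnormE -/(enorm (complex_point t)).
by apply: complex_ext; rewrite ReImE /=; ring.
Qed.

(** The origin is its own radial projection, so it is the only point that misses the sphere. *)
Lemma radial_sphereE t : S (radial_proj t) <-> (enorm (complex_point t) != 0)%R.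
Proof.
rewrite coord_sphereE radial_projE enormZ normc_real ger0_norm ?invr_ge0 ?enorm_ge0//.
split=> [|h]; last by rewrite mulVf.
by move=> h; apply/eqP => h0; move: h; rewrite h0 mulr0 => /eqP; rewrite eq_sym oner_eq0.
Qed.

Lemma radial_rot th t : radial_proj (crot th t) = crot th (radial_proj t).
Proof.
apply: eq_from_tnth => i; rewrite !tnth_mktuple sqnorm_rot /rot /=.
by congr (_, _); ring.
Qed.

Lemma integral_sphere_measure (F : coords -> \bar R) :
  measurable_fun setT F -> (forall t, 0 <= F t) ->
  \int[sphere_measure R n]_(t in S) F t =
  (ball_vol^-1)%:E * \int[L]_(t in (@radial_proj R n @^-1` S) `&` B) F (radial_proj t).
Proof.
move=> mF F0; rewrite /sphere_measure.
have mp := @measurable_radial_proj R n.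
rewrite (@ge0_integral_pushforward _ _ _ _ R _ mp (ball_measure R n) S F
  measurable_coord_sphere)//; last exact: measurable_funTS.
have mPS : measurable (@radial_proj R n @^-1` S).
  by rewrite -[X in measurable X]setTI; apply: mp => //; exact: measurable_coord_sphere.
have mG : measurable_fun (@radial_proj R n @^-1` S) (F \o @radial_proj R n).
  exact/measurable_funTS/measurableT_comp.
by rewrite (integral_ball_measure mPS mG)// => t _ /=.
Qed.

Lemma average_le (D E : set coords) (F G : coords -> \bar R) :
  measurable D -> measurable E -> measurable_fun D F -> measurable_fun E G ->
  (forall t, 0 <= F t) -> (forall t, 0 <= G t) ->
  (forall th t, D (crot th t) <-> D t) -> (forall th t, E (crot th t) <-> E t) ->
  D `<=` E ->
  (forall t, D t -> theta_int (fun th => F (crot th t)) <= theta_int (fun th => G (crot th t))) ->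
  \int[L]_(t in D) F t <= \int[L]_(t in E) G t.
Proof.
move=> mD mE mF mG F0 G0 rD rE DE H.
rewrite integral_mkcond [leRHS]integral_mkcond.
have P0 (A : set coords) (K : coords -> \bar R) t : (forall t, 0 <= K t) -> 0 <= (K \_ A) t.
  by move=> K0; rewrite patchE; case: ifP.
apply: rot_average_le.
- exact/(measurable_restrictT _ mD).
- exact/(measurable_restrictT _ mE).
- by move=> t; exact: P0.
- by move=> t; exact: P0.
move=> t; have [Dt|nDt] := pselect (D t).
  have h th : D (crot th t) by apply/rD.
  rewrite (eq_theta_int (v := fun th => F (crot th t))); last first.
    by move=> th; rewrite patchE mem_set.
  rewrite (eq_theta_int (u := fun th => (G \_ E) (crot th t)) (v := fun th => G (crot th t))).
    exact: H.
  by move=> th; rewrite patchE mem_set//; exact: DE.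
rewrite (eq_theta_int (v := fun=> 0)); last first.
  by move=> th; rewrite patchE memNset// => /rD.
rewrite /theta_int integral0; apply: integral_ge0 => th _; exact: P0.
Qed.

Lemma sphere_average_le (F G : coords -> \bar R) :
  measurable_fun setT F -> measurable_fun setT G ->
  (forall t, 0 <= F t) -> (forall t, 0 <= G t) ->
  (forall t, S t -> theta_int (fun th => F (crot th t)) <= theta_int (fun th => G (crot th t))) ->
  \int[sphere_measure R n]_(t in S) F t <= \int[sphere_measure R n]_(t in S) G t.
Proof.
move=> mF mG F0 G0 H; rewrite !integral_sphere_measure//.
have mp := @measurable_radial_proj R n.
have mPS : measurable (@radial_proj R n @^-1` S).
  by rewrite -[X in measurable X]setTI; apply: mp => //; exact: measurable_coord_sphere.
have mD : measurable ((@radial_proj R n @^-1` S) `&` B).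
  by apply: measurableI => //; exact: measurable_coord_ball.
have rD th t : ((@radial_proj R n @^-1` S) `&` B) (crot th t) <->
    ((@radial_proj R n @^-1` S) `&` B) t.
  by rewrite /= !radial_sphereE !coord_ballE enorm_rot.
rewrite lee_pmul2l ?lte_fin ?invr_gt0 ?ball_vol_gt0//.
apply: average_le => //.
- exact/measurable_funTS/measurableT_comp.
- exact/measurable_funTS/measurableT_comp.
move=> t [/= St _]; rewrite (eq_theta_int (v := fun th => F (crot th (radial_proj t)))).
  rewrite (eq_theta_int (u := fun th => G (radial_proj (crot th t)))
    (v := fun th => G (crot th (radial_proj t)))); first exact: H.
  by move=> th; rewrite radial_rot.
by move=> th; rewrite radial_rot.
Qed.

(** The origin lies in a box of side zero. For n = 0 it is the whole space, with mass 1, and the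
    sphere is empty; here the condition n >= 1 enters. *)
Lemma lebesgue_enorm0 : (0 < n)%N -> L [set t | enorm (complex_point t) = 0%R] = 0.
Proof.
move=> n0; apply/eqP; rewrite eq_le measure_ge0 andbT.
apply: (@le_trans _ _ (L (box 0%R))); last first.
  rewrite lebesgue_box// lee_fin mul0rn expr0n muln_eq0 /= orbF.
  by rewrite gtn_eqF.
apply: le_measure; rewrite ?inE; last 2 first.
- exact: measurable_box.
- move=> t /= h; apply/boxP => i.
  have := normc_le_enorm (complex_point t) i; rewrite h.
  have := normc_geRe (complex_point t ord0 i); have := normc_geIm (complex_point t ord0 i).
  by rewrite mxE /= => h1 h2 h3; split; [exact: le_trans h2 h3|exact: le_trans h1 h3].
rewrite (_ : mkset _ = setT `&` (fun t => enorm (complex_point t)) @^-1` [set 0%R]).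
  by apply: measurable_enorm => //; exact: measurable_set1.
by rewrite setTI.
Qed.

(** Both integrals are integrals over the ball without its centre, the second one through the radial
    projection, so the circle through t is compared with the circle through t / |t|. *)
Lemma ball_sphere_average_le (F G : coords -> \bar R) : (0 < n)%N ->
  measurable_fun setT F -> measurable_fun setT G ->
  (forall t, 0 <= F t) -> (forall t, 0 <= G t) ->
  (forall t, B t -> (enorm (complex_point t) != 0)%R ->
     theta_int (fun th => F (crot th t)) <=
     theta_int (fun th => G (crot th (radial_proj t)))) ->
  \int[ball_measure R n]_(t in B) F t <= \int[sphere_measure R n]_(t in S) G t.
Proof.
move=> n0 mF mG F0 G0 H.
have mB := @measurable_coord_ball R n.
rewrite integral_sphere_measure// integral_ball_measure//; last exact: measurable_funTS.
rewrite lee_pmul2l ?lte_fin ?invr_gt0 ?ball_vol_gt0//.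
have mp := @measurable_radial_proj R n.
have mPS : measurable (@radial_proj R n @^-1` S).
  by rewrite -[X in measurable X]setTI; apply: mp => //; exact: measurable_coord_sphere.
have mD : measurable ((@radial_proj R n @^-1` S) `&` B) by exact: measurableI.
have mN : measurable (~` (@radial_proj R n @^-1` S)) by exact: measurableC.
have N0 : L (~` (@radial_proj R n @^-1` S)) = 0.
  rewrite -(lebesgue_enorm0 n0); congr (L _); apply/seteqP; split => t /=.
    by move=> h; apply: contrapT => h0; apply: h; apply/radial_sphereE/eqP.
  by move=> h /radial_sphereE; rewrite h eqxx.
have mFB : measurable_fun B F by exact: measurable_funTS.
rewrite setIid (@ge0_negligible_integral _ _ _ L B (~` (@radial_proj R n @^-1` S)))//.
rewrite setDE setCK setIC.
have rD th t : ((@radial_proj R n @^-1` S) `&` B) (crot th t) <->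
    ((@radial_proj R n @^-1` S) `&` B) t.
  by rewrite /= !radial_sphereE !coord_ballE enorm_rot.
apply: average_le => //.
- exact: measurable_funTS.
- exact/measurable_funTS/measurableT_comp.
move=> t [/= St Bt].
rewrite (eq_theta_int (u := fun th => G (radial_proj (crot th t)))
  (v := fun th => G (crot th (radial_proj t)))).
  by apply: H => //; exact/radial_sphereE.
by move=> th; rewrite radial_rot.
Qed.

Lemma ball_measure1 : \int[ball_measure R n]_(t in B) 1 = 1.
Proof.
have mB := @measurable_coord_ball R n.
rewrite integral_ball_measure// setIid integral_cst// mul1e ball_volE -EFinM.
by rewrite mulVf// gt_eqF// ball_vol_gt0.
Qed.

Lemma sphere_measure_le1 : \int[sphere_measure R n]_(t in S) 1 <= 1.
Proof.
have mB := @measurable_coord_ball R n.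
have mp := @measurable_radial_proj R n.
have mPS : measurable (@radial_proj R n @^-1` S).
  by rewrite -[X in measurable X]setTI; apply: mp => //; exact: measurable_coord_sphere.
rewrite integral_sphere_measure// integral_cst//; last exact: measurableI.
rewrite mul1e.
have v0 : (0 <= ball_vol^-1)%R by rewrite invr_ge0 ltW// ball_vol_gt0.
apply: (@le_trans _ _ ((ball_vol^-1)%:E * L B)).
  apply: lee_wpmul2l; first by rewrite lee_fin.
  apply: le_measure; [exact/mem_set/measurableI|exact: mem_set|by move=> ? []].
by rewrite ball_volE -EFinM mulVf// gt_eqF// ball_vol_gt0.
Qed.

(** The sub-mean value property on the circles about z fills a ball of radius d about z; translation
    invariance moves it to the origin. The constant is the ratio of the volumes of the unit ball and
    of the ball of radius d. *)
Lemma ball_point_bound r : (r < 1)%R -> exists K : R, (0 < K)%R /\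
  forall f z, holomorphic f -> (enorm z <= r)%R ->
  (sqmod (f z))%:E <=
    K%:E * \int[ball_measure R n]_(t in B) (sqmod (f (complex_point t)))%:E.
Proof.
move=> r1; pose d := ((1 - r) / 2)%R.
have d0 : (0 < d)%R by rewrite /d; lra.
have rd : (r + d < 1)%R by rewrite /d; lra.
have mB := @measurable_coord_ball R n.
have mC := measurable_cball d.
pose v := fine (L (cball d)).
have vE : L (cball d) = v%:E by rewrite fineK// ge0_fin_numE// lebesgue_cball_lty.
have v0 : (0 < v)%R by rewrite -lte_fin -vE lebesgue_cball_gt0.
have V0 := ball_vol_gt0.
exists (ball_vol / v)%R; split; first by rewrite divr_gt0.
move=> f z hf zr.
have mfh : measurable_fun setT (fun t => (sqmod (fhat f t))%:E : \bar R).
  by apply/measurable_EFinP; exact: measurable_sqmod_fhat.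
have -> : \int[ball_measure R n]_(t in B) (sqmod (f (complex_point t)))%:E =
    (ball_vol^-1)%:E * \int[L]_(t in B) (sqmod (fhat f t))%:E.
  have mfB : measurable_fun B (fun t => (sqmod (fhat f t))%:E : \bar R).
    exact: measurable_funTS.
  rewrite -[in RHS](setIid B) -(integral_ball_measure mB mfB); last first.
    by move=> t _; rewrite lee_fin sqmod_ge0.
  by apply: eq_integral => t; rewrite inE => /coord_ballE h; rewrite fhatE.
have pE (x : \bar R) : 0 <= x ->
    (ball_vol / v)%:E * ((ball_vol^-1)%:E * x) = (v^-1)%:E * x.
  by move=> x0; rewrite muleA -EFinM mulrAC divff ?gt_eqF// mul1r.
rewrite pE; last by apply: integral_ge0 => t _; rewrite lee_fin sqmod_ge0.
rewrite -(@lee_pmul2l _ v%:E) ?lte_fin//.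
rewrite [leRHS]muleA -[v%:E * (v^-1)%:E]EFinM divff ?gt_eqF// mul1e.
pose G t := (sqmod (fhat f t))%:E.
pose T := ctrans z.
have [mT HT] := mpres_ctrans z.
apply: (@le_trans _ _ (\int[L]_(t in cball d) G (T t))).
  rewrite -vE muleC -integral_cst//.
  apply: average_le => //.
  - by apply/measurable_funTS/measurableT_comp.
  - by move=> t; rewrite lee_fin sqmod_ge0.
  - by move=> t; rewrite lee_fin sqmod_ge0.
  - by move=> th t; rewrite /cball /= enorm_rot.
  - by move=> th t; rewrite /cball /= enorm_rot.
  move=> t /= td.
  pose g (w : C) := f (z + w *: complex_point t)%R.
  have ok (w : C) : (normc w <= 1)%R -> (enorm (z + w *: complex_point t) < 1)%R.
    move=> w1; apply: (ball_slice (d := d)); first by lra.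
    exact: le_trans (ler_piMl (enorm_ge0 _) w1) (ltW td).
  have dg w : (normc w <= 1)%R -> cdiff g w.
    by move=> /ok h; exact: holomorphic_slice.
  have E th : G (T (crot th t)) = (sqmod (g (circ 1 th)))%:E.
    have e1 : complex_point (T (crot th t)) = (z + circ 1 th *: complex_point t)%R.
      by rewrite complex_point_trans complex_point_rot addrC /circ mul1r.
    by rewrite /G fhatE e1//; apply: ok; rewrite normc_circ.
  rewrite (eq_theta_int E); apply: le_theta_int.
  - exact: segcont_cst.
  - by apply: circ_sqmod_ccont => // w w1; apply: dg; rewrite w1.
  - rewrite cmean_cst; have := submean_sqmod ltr01 dg.
    by rewrite /g scale0r addr0.
have -> : \int[L]_(t in cball d) G (T t) =
    \int[L]_t ((G \_ [set t | (enorm (complex_point t - z)%R < d)%R]) (T t)).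
  rewrite integral_mkcond; apply: eq_integral => t _.
  rewrite !patchE; have e1 : (complex_point (T t) - z)%R = complex_point t.
    by rewrite complex_point_trans addrK.
  have -> : (t \in cball d) = (T t \in [set t | (enorm (complex_point t - z)%R < d)%R]).
    by apply/idP/idP; rewrite !inE /cball /= e1.
  by [].
have G0 t : 0 <= G t by rewrite lee_fin sqmod_ge0.
have mE : measurable [set t | (enorm (complex_point t - z)%R < d)%R].
  have -> : [set t | (enorm (complex_point t - z)%R < d)%R] =
      setT `&` (ctrans (- z)) @^-1` cball d.
    by rewrite setTI; apply/seteqP; split => t /=; rewrite /cball /= complex_point_trans.
  by have [mT' _] := mpres_ctrans (- z); exact: mT'.
rewrite (mpres_integral (mpres_ctrans z)); last 2 first.
- by apply/(measurable_restrictT _ mE); exact: measurable_funTS.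
- by move=> t; rewrite patchE; case: ifP.
rewrite -integral_mkcond; apply: ge0_subset_integral => //.
  exact: measurable_funTS.
move=> t /= h; apply/coord_ballE.
rewrite (_ : complex_point t = (z + (complex_point t - z))%R); last by rewrite addrC subrK.
by apply: le_lt_trans (enormD _ _) _; lra.
Qed.

End normalized_measures.

(** * A minimax inequality *)

Section minimax.
Variables (R : realType) (M : nat).
Implicit Types (v w th : 'I_M -> R) (c e : R).

Let pp (K : R) v m : R := Num.max 0 (v m - K).
Let Phi (K : R) v : R := \sum_m pp K v m ^+ 2.

Let pp_ge0 K v m : 0 <= pp K v m. Proof. by rewrite le_max lexx. Qed.

(** The right-hand side is the square of max(0, x) + h, and x + h is at most max(0, x) + h. *)
Let pp_step (x h : R) : Num.max 0 (x + h) ^+ 2 <=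
  Num.max 0 x ^+ 2 + 2 * (Num.max 0 x * h) + h ^+ 2.
Proof.
have -> : Num.max 0 x ^+ 2 + 2 * (Num.max 0 x * h) + h ^+ 2 = (Num.max 0 x + h) ^+ 2.
  by ring.
have hx : x <= Num.max 0 x by rewrite le_max lexx orbT.
have h0 : 0 <= Num.max 0 x by rewrite le_max lexx.
have [h1|h1] := leP (x + h) 0; first by rewrite expr0n /= sqr_ge0.
by rewrite ler_sqr ?nnegrE; lra.
Qed.

(* Gradient descent on the squared excess over c + e / 2: at v, the weights
   proportional to the excess produce a descent direction w - v. *)
Lemma minimax (S : set ('I_M -> R)) c e : (0 < M)%N -> 0 < c -> 0 < e ->
  (forall u v s, S u -> S v -> 0 <= s <= 1 -> S (fun m => u m + s * (v m - u m))) ->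
  (forall v, S v -> forall m, 0 <= v m) ->
  (forall th, (forall m, 0 < th m) -> \sum_m th m = 1 ->
     exists2 v, S v & \sum_m th m * v m <= c) ->
  exists2 v, S v & forall m, v m <= c + e.
Proof.
move=> M0 c0 e0 Sconv S0 Sth.
have MR : 0 < M%:R :> R by rewrite ltr0n.
pose K := c + e / 2; pose d := e / (4 * c + e).
have ce : 0 < 4 * c + e by lra.
have d0 : 0 < d by rewrite divr_gt0.
have d1 : 1 - d = 4 * c / (4 * c + e) by rewrite /d; field; rewrite gt_eqF.
have d1' : 0 < 1 - d by rewrite d1 divr_gt0// mulr_gt0.
pose B := c * M%:R / d; have B0 : 0 < B by rewrite !divr_gt0// mulr_gt0.
(* Mixing in the uniform weights keeps every weight at least d / M, which bounds the coordinates of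
   the point found by B. The choice of d makes (1 - d) (c + e / 4) equal to c. *)
have best th : (forall m, 0 <= th m) -> \sum_m th m = 1 ->
    exists v, [/\ S v, forall m, v m <= B & \sum_m th m * v m <= c + e / 4].
  move=> th0 th1; pose th' m := (1 - d) * th m + d / M%:R.
  have dM : 0 < d / M%:R by rewrite divr_gt0.
  have th'0 m : d / M%:R <= th' m by rewrite /th' lerDr mulr_ge0// ltW.
  have th'1 : \sum_m th' m = 1.
    have dMM : (d / M%:R) *+ M = d by rewrite -[LHS]mulr_natl mulrCA divff ?mulr1// gt_eqF.
    by rewrite big_split /= -mulr_sumr th1 sumr_const card_ord dMM mulr1 subrK.
  have [v Sv Hv] := Sth _ (fun m => lt_le_trans dM (th'0 m)) th'1.
  have v0 := S0 v Sv; exists v; split => // [m|].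
    rewrite /B ler_pdivlMr// mulrC -ler_pdivrMr// mulrAC.
    apply: le_trans Hv; rewrite (bigD1 m)//=.
    apply: (@le_trans _ _ (th' m * v m)); first by apply: ler_wpM2r.
    rewrite lerDl; apply: sumr_ge0 => j _; rewrite mulr_ge0// (le_trans _ (th'0 j))//.
    exact: ltW.
  rewrite -(ler_pM2l d1'); apply: (@le_trans _ _ c).
    apply: le_trans Hv; rewrite mulr_sumr; apply: ler_sum => m _.
    by rewrite mulrA ler_wpM2r// /th' lerDl ltW.
  by rewrite d1 le_eqVlt; apply/orP; left; apply/eqP; field; rewrite gt_eqF.
apply: contrapT => nex.
pose A := M%:R * B ^+ 2 + e ^+ 2.
have A0 : 0 < A by rewrite ltr_pwDr ?exprn_gt0// mulr_ge0 ?sqr_ge0// ltW.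
(* A step of length t gains at least t e^2 / 4 to first order, because the total excess is above e /
   2, and loses at most t^2 A = t e^2 / 8. The net decrease is D. *)
pose t := e ^+ 2 / (8 * A); have t0 : 0 < t by rewrite divr_gt0 ?exprn_gt0// mulr_gt0.
have t1 : t <= 1.
  rewrite ler_pdivrMr ?mulr_gt0// mul1r /A.
  have : 0 <= M%:R * B ^+ 2 by rewrite mulr_ge0 ?sqr_ge0// ltW.
  by have := sqr_ge0 e; lra.
pose D := t * e ^+ 2 / 8; have D0 : 0 < D by rewrite divr_gt0// mulr_gt0// exprn_gt0.
have tA : t * A = e ^+ 2 / 8 by rewrite /t; field; rewrite gt_eqF.
have step v : S v -> (forall m, v m <= B) ->
    exists w, [/\ S w, forall m, w m <= B & Phi K w <= Phi K v - D].
  move=> Sv vB; have v0 := S0 v Sv.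
  pose si := \sum_m pp K v m.
  have si0 : 0 <= si by apply: sumr_ge0 => m _; exact: pp_ge0.
  have sie : e / 2 < si.
    rewrite ltNge; apply/negP => h; apply: nex; exists v => // m.
    have : pp K v m <= e / 2.
      apply: le_trans h; rewrite /si (bigD1 m)//= lerDl.
      by apply: sumr_ge0 => j _; exact: pp_ge0.
    by rewrite /pp ge_max /K => /andP[_]; lra.
  have si0' : 0 < si by lra.
  have [||w [Sw wB Hw]] := best (fun m => pp K v m / si).
  - by move=> m; rewrite divr_ge0// pp_ge0.
  - by rewrite -mulr_suml divff// gt_eqF.
  have w0 := S0 w Sw.
  exists (fun m => v m + t * (w m - v m)); split.
  - by apply: Sconv => //; rewrite (ltW t0).
  - move=> m; rewrite (_ : _ + _ = (1 - t) * v m + t * w m); last by ring.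
    have -> : B = (1 - t) * B + t * B by ring.
    by apply: lerD; apply: ler_wpM2l => //; [lra|exact: ltW].
  apply: (@le_trans _ _ (\sum_m (pp K v m ^+ 2 + 2 * (pp K v m * (t * (w m - v m)))
      + (t * (w m - v m)) ^+ 2))).
    apply: ler_sum => m _; apply: le_trans (pp_step _ _).
    by rewrite /pp (_ : v m - K + _ = v m + t * (w m - v m) - K)//; ring.
  rewrite !big_split /= -/(Phi K v) -addrA lerD2l.
  have h1 : \sum_m (t * (w m - v m)) ^+ 2 <= t ^+ 2 * A.
    under eq_bigr do rewrite exprMn; rewrite -mulr_sumr.
    apply: ler_wpM2l; first exact: sqr_ge0.
    apply: (@le_trans _ _ (\sum_(m < M) B ^+ 2)).
      apply: ler_sum => m _; rewrite -(real_normK (num_real _)) ler_sqr ?nnegrE ?(ltW B0)//.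
      have := v0 m; have := w0 m; have := vB m; have := wB m.
      by move=> *; rewrite ler_norml; apply/andP; split; lra.
    by rewrite sumr_const card_ord -[leLHS]mulr_natl /A lerDl sqr_ge0.
  have h2 : \sum_m 2 * (pp K v m * (t * (w m - v m))) <=
      2 * t * (si * (c + e / 4) - si * K).
    have -> : \sum_m 2 * (pp K v m * (t * (w m - v m))) =
       2 * t * (si * (\sum_m pp K v m / si * w m) - \sum_m pp K v m * v m).
      rewrite [si * _]mulr_sumr -sumrB mulr_sumr; apply: eq_bigr => m _.
      by field; rewrite gt_eqF.
    apply: ler_wpM2l; first by rewrite mulr_ge0 ?(ltW t0).
    apply: lerB; first exact: (ler_wpM2l si0).
    rewrite /si mulr_suml; apply: ler_sum => m _.
    rewrite /pp; have [h|h] := leP (v m - K) 0; first by rewrite !mul0r.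
    by apply: ler_wpM2l; lra.
  apply: le_trans (lerD h2 h1) _.
  have -> : t ^+ 2 * A = t * (e ^+ 2 / 8) by rewrite -tA; ring.
  rewrite /K /D.
  have : e * e / 2 <= e * si by rewrite -mulrA ler_pM2l// ltW.
  move=> h3; have : t * (e * e / 2) <= t * (e * si) by rewrite ler_pM2l.
  by rewrite expr2; lra.
have [||v1 [Sv1 v1B _]] := best (fun=> M%:R^-1).
- by move=> m; rewrite invr_ge0 ltW.
- by rewrite sumr_const card_ord -[LHS]mulr_natl divff// gt_eqF.
have iter k : exists w, [/\ S w, forall m, w m <= B & Phi K w <= Phi K v1 - k%:R * D].
  elim: k => [|k [w [Sw wB Hw]]]; first by exists v1; rewrite mul0r subr0.
  have [w' [Sw' wB' Hw']] := step w Sw wB.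
  exists w'; split => //; apply: le_trans Hw' _; rewrite -natr1 mulrDl mul1r; lra.
have [w [_ _ Hw]] := iter (Num.trunc (Phi K v1 / D)).+1.
have := truncnS_gt (Phi K v1 / D); rewrite ltr_pdivrMr// => h.
have : 0 <= Phi K w by apply: sumr_ge0 => m _; exact: sqr_ge0.
by lra.
Qed.

End minimax.

(** * Square-integrable functions *)

Section square_integrable.
Context d (T : measurableType d) (R : realType) (mu : {measure set T -> \bar R}).
Variables (D : set T) (mD : measurable D).
Implicit Types (F G E : T -> R[i]) (c : R[i]).
Local Notation Re := complex.Re.
Local Notation Im := complex.Im.

Definition cmeas F :=
  measurable_fun D (fun t => Re (F t)) /\ measurable_fun D (fun t => Im (F t)).

Definition sqint F : \bar R := (\int[mu]_(t in D) (sqmod (F t))%:E)%E.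

Definition sqnm F : R := \int[mu]_(t in D) (sqmod (F t)).

Definition L2 F := cmeas F /\ (sqint F < +oo)%E.

Definition ip F G : R[i] :=
  ((\int[mu]_(t in D) Re (F t * (G t)^*%C)) +i*
   (\int[mu]_(t in D) Im (F t * (G t)^*%C)))%C.

Lemma cmeas_cst c : cmeas (fun=> c).
Proof. by split; exact: measurable_cst. Qed.

Lemma cmeas_sqmod F : cmeas F -> measurable_fun D (fun t => (sqmod (F t))%:E).
Proof.
by move=> [? ?]; apply/measurable_EFinP; exact: measurable_sqmod.
Qed.

Lemma cmeasM F G : cmeas F -> cmeas G -> cmeas (fun t => F t * G t).
Proof.
move=> [F1 F2] [G1 G2]; split.
  under eq_fun do rewrite ReM; apply: measurable_funB; exact: measurable_funM.
under eq_fun do rewrite ImM; apply: measurable_funD; exact: measurable_funM.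
Qed.

Lemma cmeasD F G : cmeas F -> cmeas G -> cmeas (fun t => F t + G t).
Proof.
move=> [F1 F2] [G1 G2]; split.
  by under eq_fun do rewrite ReD; exact: measurable_funD.
by under eq_fun do rewrite ImD; exact: measurable_funD.
Qed.

Lemma cmeas_conj F : cmeas F -> cmeas (fun t => (F t)^*%C).
Proof.
move=> [F1 F2]; split; first by under eq_fun do rewrite Re_conj.
by under eq_fun do rewrite Im_conj; exact: measurable_funN.
Qed.

Lemma cmeas_lin F G c : cmeas F -> cmeas G -> cmeas (fun t => F t + c * G t).
Proof. by move=> mF mG; apply: cmeasD => //; apply: cmeasM => //; exact: cmeas_cst. Qed.

Lemma sqint_ge0 F : (0 <= sqint F)%E.
Proof. by apply: integral_ge0 => t _; rewrite lee_fin sqmod_ge0. Qed.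

Lemma sqnm_ge0 F : 0 <= sqnm F.
Proof. by apply: Rintegral_ge0 => t _; exact: sqmod_ge0. Qed.

Lemma sqintE F : L2 F -> sqint F = (sqnm F)%:E.
Proof. by move=> [_ h]; rewrite /sqnm fineK// ge0_fin_numE// sqint_ge0. Qed.

Lemma sqint_lin_le F G c : cmeas F -> cmeas G ->
  (sqint (fun t => F t + c * G t)%R <= 2%:E * sqint F + (2 * sqmod c)%:E * sqint G)%E.
Proof.
move=> mF mG; have sF := cmeas_sqmod mF; have sG := cmeas_sqmod mG.
have p0 F' t : (0 <= (sqmod (F' t))%:E)%E by move=> *; rewrite lee_fin sqmod_ge0.
have q0 (k : R) F' t : 0 <= k -> (0 <= k%:E * (sqmod (F' t))%:E)%E.
  by move=> k0; rewrite -EFinM lee_fin mulr_ge0 ?sqmod_ge0.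
have c2 : 0 <= 2 * sqmod c by rewrite mulr_ge0 ?sqmod_ge0.
have m2 (k : R) F' : cmeas F' -> measurable_fun D (fun t => k%:E * (sqmod (F' t))%:E)%E.
  by move=> /cmeas_sqmod m; exact: measurable_funeM.
have mL := cmeas_sqmod (cmeas_lin c mF mG).
rewrite /sqint -!ge0_integralZl ?lee_fin// -ge0_integralD//;
  try exact: m2; try (by move=> *; exact: q0).
apply: ge0_le_integral => //; try (by move=> t _; rewrite lee_fin sqmod_ge0);
  try (by apply: emeasurable_funD; exact: m2).
move=> t _; rewrite -!EFinM -EFinD lee_fin; apply: le_trans (sqmodD_le2 _ _) _.
by rewrite sqmodM mulrA.
Qed.

Lemma L2_lin F G c : L2 F -> L2 G -> L2 (fun t => F t + c * G t).
Proof.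
move=> HF HG; have [mF _] := HF; have [mG _] := HG.
split; first exact: cmeas_lin.
apply: le_lt_trans (sqint_lin_le c mF mG) _.
by rewrite (sqintE HF) (sqintE HG) -!EFinM -EFinD ltry.
Qed.

Lemma integrable_sqmod F : L2 F -> mu.-integrable D (EFin \o (fun t => sqmod (F t))).
Proof.
move=> [mF hF]; apply/integrableP; split; first exact: cmeas_sqmod.
by under eq_integral => t _ do rewrite /= ger0_norm ?sqmod_ge0//.
Qed.

Lemma integrable_L2M F G : L2 F -> L2 G ->
  mu.-integrable D (EFin \o (fun t => Re (F t * (G t)^*%C))) /\
  mu.-integrable D (EFin \o (fun t => Im (F t * (G t)^*%C))).
Proof.
move=> HF HG; have [mF _] := HF; have [mG _] := HG.
have [m1 m2] := cmeasM mF (cmeas_conj mG).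
have I : mu.-integrable D (fun t => (sqmod (F t))%:E + (sqmod (G t))%:E)%E.
  by apply: integrableD => //; exact: integrable_sqmod.
have b t : normc (F t * (G t)^*%C) <= `|sqmod (F t) + sqmod (G t)|.
  rewrite ger0_norm ?addr_ge0 ?sqmod_ge0// Normc.normcM normc_conj.
  rewrite /sqmod; have := sqr_ge0 (normc (F t) - normc (G t)).
  by have := sqr_ge0 (normc (F t)); have := sqr_ge0 (normc (G t)); nra.
split; apply: le_integrable I => //=.
- exact: measurableT_comp.
- by move=> t _; rewrite lee_fin (le_trans (normc_geRe _)).
- exact: measurableT_comp.
- by move=> t _; rewrite lee_fin (le_trans (normc_geIm _)).
Qed.

Lemma integrableZ_comp (k : R) (f : T -> R) : mu.-integrable D (EFin \o f) ->
  mu.-integrable D (EFin \o (fun t => k * f t)).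
Proof. by move=> /(integrableZl mD k). Qed.

Lemma integrableD_comp (f g : T -> R) : mu.-integrable D (EFin \o f) ->
  mu.-integrable D (EFin \o g) -> mu.-integrable D (EFin \o (fun t => f t + g t)).
Proof. by move=> h1 h2; exact: (integrableD mD h1 h2). Qed.

Lemma sqnmD F G c : L2 F -> L2 G -> sqnm (fun t => F t + c * G t) =
  sqnm F + sqmod c * sqnm G + 2 * (Re c * Re (ip F G) + Im c * Im (ip F G)).
Proof.
move=> HF HG; have [i1 i2] := integrable_L2M HF HG.
have iF := integrable_sqmod HF; have iG := integrable_sqmod HG.
transitivity (\int[mu]_(t in D) (sqmod (F t) + (sqmod c * sqmod (G t) +
    (2 * Re c * Re (F t * (G t)^*%C) + 2 * Im c * Im (F t * (G t)^*%C)))))%R.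
  apply: eq_Rintegral => t _; rewrite sqmod_polar sqmodM !conjcM.
  by rewrite !(ReM, ImM, Re_conj, Im_conj); ring.
have z k f : mu.-integrable D (EFin \o f) ->
  mu.-integrable D (EFin \o (fun t => k * f t)) by exact: integrableZ_comp.
have z1 := z (sqmod c) _ iG; have z2 := z (2 * Re c) _ i1; have z3 := z (2 * Im c) _ i2.
have z4 := integrableD_comp z2 z3.
rewrite RintegralD ?RintegralD ?RintegralZl//; last exact: integrableD_comp.
by rewrite /ip /= /sqnm; ring.
Qed.

Lemma ip_conj F G : L2 F -> L2 G -> ip G F = (ip F G)^*%C.
Proof.
move=> HF HG; have [i1 i2] := integrable_L2M HF HG.
apply: complex_ext; rewrite ?Re_conj ?Im_conj /=.
  by apply: eq_Rintegral => t _; rewrite !(ReM, ImM, Re_conj, Im_conj); ring.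
rewrite -mulN1r -RintegralZl//.
by apply: eq_Rintegral => t _; rewrite !(ReM, ImM, Re_conj, Im_conj); ring.
Qed.

Lemma ip_linr E F G c : L2 E -> L2 F -> L2 G ->
  ip E (fun t => F t + c * G t) = ip E F + c^*%C * ip E G.
Proof.
move=> HE HF HG; have [i1 i2] := integrable_L2M HE HF.
have [j1 j2] := integrable_L2M HE HG.
have z1 k f : mu.-integrable D (EFin \o f) -> mu.-integrable D (EFin \o (fun t => k * f t)).
  exact: integrableZ_comp.
apply: complex_ext; rewrite !(ReD, ImD, ReM, ImM, Re_conj, Im_conj) /=.
  transitivity (\int[mu]_(t in D) (Re (E t * (F t)^*%C) +
      (Re c * Re (E t * (G t)^*%C) + Im c * Im (E t * (G t)^*%C))))%R.
    by apply: eq_Rintegral => t _; rewrite !(ReD, ImD, ReM, ImM, Re_conj, Im_conj); ring.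
  have z := integrableD_comp (z1 (Re c) _ j1) (z1 (Im c) _ j2).
  rewrite RintegralD// RintegralD//; try exact: z1.
  by rewrite RintegralZl// RintegralZl//; ring.
transitivity (\int[mu]_(t in D) (Im (E t * (F t)^*%C) +
    (Re c * Im (E t * (G t)^*%C) + (- Im c) * Re (E t * (G t)^*%C))))%R.
  by apply: eq_Rintegral => t _; rewrite !(ReD, ImD, ReM, ImM, Re_conj, Im_conj); ring.
have z := integrableD_comp (z1 (Re c) _ j2) (z1 (- Im c) _ j1).
rewrite RintegralD// RintegralD//; try exact: z1.
by rewrite RintegralZl// RintegralZl//; ring.
Qed.

Lemma ip_self F : ip F F = (sqnm F)%:C%C.
Proof.
have h t : F t * (F t)^*%C = (sqmod (F t))%:C%C.
  apply: complex_ext; rewrite !(ReM, ImM, Re_conj, Im_conj) sqmodE /=.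
    by rewrite mulrN opprK !expr2.
  by rewrite mulrN mulrC addNr.
apply: complex_ext; rewrite /=; first by apply: eq_Rintegral => t _; rewrite h.
rewrite (@eq_Rintegral _ _ _ mu D (fun=> 0)); first by rewrite Rintegral_cst// mul0r.
by move=> t _; rewrite h.
Qed.

Lemma cauchy_schwarz F G : L2 F -> L2 G -> sqmod (ip F G) <= sqnm F * sqnm G.
Proof.
move=> HF HG.
(* Nonnegativity of the squared norm of F - s <F, G> G. *)
have key s : 0 <= sqnm F + s ^+ 2 * sqmod (ip F G) * sqnm G - 2 * s * sqmod (ip F G).
  have := sqnm_ge0 (fun t => F t + (- s%:C%C * ip F G) * G t).
  rewrite sqnmD//; move: (ip F G) => q.
  rewrite sqmodM sqmodN sqmod_real !(ReM, ImM, ReN, ImN) /= sqmodE.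
  by move=> h; apply: le_trans h _; rewrite le_eqVlt; apply/orP; left; apply/eqP; ring.
have g0 := sqnm_ge0 G; have f0 := sqnm_ge0 F; have p0 := sqmod_ge0 (ip F G).
have [g1|g1] := eqVneq (sqnm G) 0.
  rewrite g1 mulr0 leNgt; apply/negP => p1.
  (* If G has norm zero, [key] is affine in s, and this s gives it the value -1. *)
  have := key ((sqnm F + 1) / (2 * sqmod (ip F G))); rewrite g1 mulr0 addr0.
  rewrite (_ : 2 * _ * _ = sqnm F + 1); last by field; rewrite gt_eqF.
  by lra.
have g2 : 0 < sqnm G by rewrite lt_def g1.
have := key (sqnm G)^-1.
have -> : sqnm F + (sqnm G)^-1 ^+ 2 * sqmod (ip F G) * sqnm G -
  2 * (sqnm G)^-1 * sqmod (ip F G) = (sqnm F * sqnm G - sqmod (ip F G)) / sqnm G.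
  by field.
by rewrite pmulr_lge0 ?invr_gt0// subr_ge0.
Qed.

Lemma eq_sqint F G : cmeas F -> cmeas G -> ae_eq mu D F G -> sqint F = sqint G.
Proof.
move=> mF mG h; apply: ge0_ae_eq_integral => //; try exact: cmeas_sqmod.
- by move=> t _; rewrite lee_fin sqmod_ge0.
- by move=> t _; rewrite lee_fin sqmod_ge0.
- by apply: filterS h => t h Dt; rewrite h.
Qed.

Lemma eq_ip E F G : cmeas E -> cmeas F -> cmeas G -> ae_eq mu D F G ->
  ip E F = ip E G.
Proof.
move=> mE mF mG h; have [e1 e2] := cmeasM mE (cmeas_conj mF).
have [e3 e4] := cmeasM mE (cmeas_conj mG).
congr (_ +i* _)%C; congr fine; apply: ae_eq_integral => //; try exact: measurableT_comp;
  by apply: filterS h => t h Dt; rewrite h.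
Qed.

End square_integrable.

(** * Hilbert spaces of holomorphic functions on the ball *)

Section hilbert_model.
Variables (R : realType) (n : nat) (H : fspace R n).
Local Notation C := R[i].
Local Notation vec := 'rV[R[i]]_n.
Local Notation mu := (fs_measure H).
Local Notation D := (fs_dom H).
Local Notation val := (fs_val H).
Local Notation mem := (fs_mem H).
Local Notation Re := complex.Re.
Local Notation Im := complex.Im.

(* [hm_point] and [hm_limit] stand in for completeness of the space. *)
Record hilbert_model : Prop := HilbertModel {
  hm_dom : measurable D;
  hm_mass : (\int[mu]_(t in D) 1 <= 1)%E;
  hm_holomorphic : forall f, mem f -> holomorphic f;
  hm_lin : forall f g (c : C), mem f -> mem g -> mem (fun z => f z + c * g z);
  hm_val : forall f g (c : C), mem f -> mem g ->
    ae_eq mu D (val (fun z => f z + c * g z)) (fun t => val f t + c * val g t);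
  hm_L2 : forall f, mem f -> L2 mu D (val f);
  hm_point : forall r, r < 1 -> exists2 K : R, 0 < K & forall f z, mem f ->
    enorm z <= r -> sqmod (f z) <= K * sqnm mu D (val f);
  hm_limit : forall (fs : nat -> vec -> C) f (K : R), (forall j, mem (fs j)) ->
    (forall j, sqnm mu D (val (fs j)) <= K) -> holomorphic f ->
    (forall z, enorm z < 1 -> forall e : R, 0 < e ->
       \forall j \near \oo, normc (fs j z - f z) <= e) ->
    mem f /\ sqnm mu D (val f) <= K;
  hm_Hinfty : forall f, Hinfty f -> mem f;
  hm_bounded : forall f (B : R), Hinfty f ->
    (forall z : vec, unit_ball z -> sqmod (f z) <= B) ->
    {ae mu, forall t, D t -> sqmod (val f t) <= B}
}.

(** The number k a is the squared norm of k; the modulus only turns it into a real. The integral is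
    allowed to be infinite. *)
Definition kernel_jensen : Prop :=
  forall a f k, unit_ball a -> mem f -> is_reproducing_kernel H a k ->
    ((sqmod (f a) * normc (k a))%:E <=
       \int[mu]_(t in D) (sqmod (val f t) * sqmod (val k t))%:E)%E.

Hypothesis hm : hilbert_model.
Let mD := hm_dom hm.
Let q f := sqnm mu D (val f).
Implicit Types (f g h k : vec -> C) (a z : vec) (c : C).

Lemma q_ge0 f : 0 <= q f. Proof. exact: sqnm_ge0. Qed.

Lemma cmeas_val f : mem f -> cmeas D (val f).
Proof. by move=> /(hm_L2 hm)[]. Qed.

Lemma L2_val_lin f g c : mem f -> mem g -> L2 mu D (fun t => val f t + c * val g t).
Proof. by move=> mf mg; apply: L2_lin mD _ _ _ _ _ => //; exact: hm_L2. Qed.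

Lemma qD f g c : mem f -> mem g -> q (fun z => f z + c * g z) =
  q f + sqmod c * q g + 2 * (Re c * Re (inner H f g) + Im c * Im (inner H f g)).
Proof.
move=> mf mg; have L := L2_val_lin c mf mg.
rewrite -(sqnmD mD)//; [|exact: hm_L2..].
congr fine; apply: eq_sqint => //; last exact: hm_val.
- exact/cmeas_val/hm_lin.
- by case: L.
Qed.

Lemma inner_conj f g : mem f -> mem g -> inner H g f = (inner H f g)^*%C.
Proof. by move=> mf mg; apply: ip_conj mD _ _ _ _; exact: hm_L2. Qed.

Lemma inner_linr h f g c : mem h -> mem f -> mem g ->
  inner H h (fun z => f z + c * g z) = inner H h f + c^*%C * inner H h g.
Proof.
move=> mh mf mg; have L := L2_val_lin c mf mg.
rewrite /inner -!/(ip mu D _ _) -(ip_linr mD)//; try exact: hm_L2.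
apply: eq_ip => //; last exact: hm_val.
- exact: cmeas_val.
- exact/cmeas_val/hm_lin.
- by case: L.
Qed.

Lemma inner_self f : inner H f f = (q f)%:C%C.
Proof. exact: ip_self. Qed.

Lemma Hinfty_cst c : @Hinfty R n (fun=> c).
Proof. by split; [move=> z _; exact: differentiable_cst|exists (normc c)]. Qed.

Lemma mem_cst c : mem (fun=> c).
Proof. by apply: hm_Hinfty => //; exact: Hinfty_cst. Qed.

(** * Existence of reproducing kernels *)

Section riesz.
Variables (a : vec) (a1 : enorm a < 1).

Let S : set (vec -> C) := [set f | mem f /\ f a = 1].

Let m := inf [set q f | f in S].

Let S1 : S (fun=> 1). Proof. by split; [exact: mem_cst|]. Qed.

Let lbm f : S f -> m <= q f.
Proof.
move=> Sf; apply: ge_inf; last by exists f.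
by exists 0 => _ [g _ <-]; exact: q_ge0.
Qed.

(** The parallelogram law: the midpoint of f and g also takes the value 1 at a, so its squared norm
    is at least m. *)
Let near_min j f g : S f -> S g -> q f <= m + j -> q g <= m + j ->
  q (fun z => g z + (-1) * f z) <= 4 * j.
Proof.
move=> [mf fa] [mg ga] hf hg.
have mgf : mem (fun z => g z + (-1) * f z) by exact: hm_lin.
have h1 := qD 1 mf mgf.
have h2 := qD (2^-1)%:C%C mf mgf.
have e1 : q (fun z => f z + 1 * (g z + (-1) * f z)) = q g.
  by congr q; apply/funext => z; ring.
have : m <= q (fun z => f z + (2^-1)%:C%C * (g z + (-1) * f z)).
  apply: lbm; split; first exact: hm_lin.
  by rewrite fa ga; ring.
move: h1; rewrite e1 sqmod1 h2 sqmod_real; move: (inner H f _) => [A B] /=.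
move: (q (fun z => g z + _)) => G.
have -> : (2^-1 : R) ^+ 2 = 4^-1 by field.
by lra.
Qed.

Let minimizing : exists fs : nat -> vec -> C,
  forall j, S (fs j) /\ q (fs j) <= m + j.+1%:R^-1.
Proof.
have h j : exists f, S f /\ q f <= m + j.+1%:R^-1.
  have j0 : 0 < j.+1%:R^-1 :> R by rewrite invr_gt0.
  have [|_ [f Sf <-] hf] := inf_adherent j0 (_ : has_inf [set q f | f in S]).
    by split; [exists (q (fun=> 1)), (fun=> 1)|exists 0 => _ [g _ <-]; exact: q_ge0].
  by exists f; split => //; exact: ltW.
by have [fs Hfs] := choice h; exists fs.
Qed.

(** A minimizing sequence is Cauchy in norm and by [hm_point] also at each point. An ultrafilter
    provides its pointwise limit, and [hm_limit] on the tails of the sequence gives membership and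
    the norm. *)
Let minimizer : exists2 f, S f & q f <= m.
Proof.
have [fs Hfs] := minimizing.
have qle j : q (fs j) <= m + 1.
  have [_ h] := Hfs j; apply: le_trans h _; by rewrite lerD2l -[leRHS]invr1 lef_pV2 ?posrE ?ltr0n// ler1n.
have [G [GU Goo]] := @ultraFilterLemma _ (\oo : set_system nat) _.
have loc r : r < 1 -> exists B, forall i z, enorm z <= r -> normc (fs i z) <= B.
  move=> /(hm_point hm)[K K0 HK]; exists (Num.sqrt (K * (m + 1))) => i z zr.
  rewrite sqmod_normc; apply: ler_wsqrtr; have [[mf _] _] := Hfs i.
  by apply: le_trans (HK _ _ mf zr) _; apply: ler_wpM2l; [exact: ltW|exact: qle].
have lim z : exists l : C, enorm z < 1 ->
    forall e : R, 0 < e -> \forall i \near G, normc (fs i z - l) <= e.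
  have [z1|z1] := ltP (enorm z) 1; last by exists 0.
  have [B HB] := loc _ z1.
  by have [l Hl] := @ultra_bounded_cvg _ _ G (fs^~ z) B _ (fun i => HB i z (lexx _)); exists l.
have [f Hf] := choice lim.
have holf : holomorphic f.
  apply: (@holomorphic_limit _ _ _ G fs) => // i.
  by have [[mf _] _] := Hfs i; exact: hm_holomorphic.
have cv z : enorm z < 1 -> forall e : R, 0 < e ->
    \forall j \near \oo, normc (fs j z - f z) <= e.
  move=> z1 e e0; have [K K0 HK] := hm_point hm z1.
  (* [near_min] multiplies this by 4 and the point estimate by K, which leaves (e / 2)^2. *)
  have d0 : 0 < (e / 2) ^+ 2 / (4 * K) by rewrite divr_gt0 ?exprn_gt0 ?mulr_gt0 ?divr_gt0.
  have [J _ HJ] : \forall j \near \oo, j.+1%:R^-1 <= (e / 2) ^+ 2 / (4 * K).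
    have := @near_infty_natSinv_lt R (PosNum d0); apply: filterS => j /= h; exact: ltW.
  have near j i : (J <= j)%N -> (J <= i)%N -> normc (fs j z - fs i z) <= e / 2.
    move=> Jj Ji; have [Sj hj] := Hfs j; have [Si hi] := Hfs i.
    have := near_min Si Sj (le_trans hi _) (le_trans hj _).
    move=> /(_ ((e / 2) ^+ 2 / (4 * K))) h.
    have := h _ _; rewrite !lerD2l => {}h; have := h (HJ _ Ji) (HJ _ Jj) => {}h.
    have := HK (fun z => fs j z + (-1) * fs i z) z _ (lexx _).
    move=> /(_ (hm_lin hm _ (proj1 Sj) (proj1 Si))) h2.
    rewrite -ler_sqr ?nnegrE ?normc_ge0 ?divr_ge0 ?(ltW e0)//.
    rewrite -[leLHS]/(sqmod _) -mulN1r; apply: le_trans h2 _.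
    apply: (@le_trans _ _ (K * (4 * ((e / 2) ^+ 2 / (4 * K))))).
      by apply: ler_wpM2l => //; exact: ltW.
    by rewrite le_eqVlt; apply/orP; left; apply/eqP; field; rewrite gt_eqF.
  exists J => // j /= Jj.
  have [i [iJ /= iz]] : exists i, (J <= i)%N /\ normc (fs i z - f z) <= e / 2.
    have e2 : 0 < e / 2 by rewrite divr_gt0.
    apply: (@filter_ex _ G); apply: filterI; last exact: Hf.
    by apply: Goo; exists J.
  rewrite (_ : fs j z - f z = (fs j z - fs i z) + (fs i z - f z)); last by ring.
  by apply: le_trans (normcD _ _) _; have := near j i Jj iJ; lra.
have tail e : 0 < e -> mem f /\ q f <= m + e.
  move=> e0.
  have [J _ HJ] : \forall j \near \oo, j.+1%:R^-1 <= e.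
    have := @near_infty_natSinv_lt R (PosNum e0); apply: filterS => j /= h; exact: ltW.
  apply: (@hm_limit hm (fun j => fs (J + j)%N)) => // [j|j|z z1 d d0].
  - by have [[]] := Hfs (J + j)%N.
  - have [_ h] := Hfs (J + j)%N; apply: le_trans h _; rewrite lerD2l.
    by apply: HJ => /=; rewrite leq_addr.
  - have [J' _ HJ'] := cv z z1 d d0; exists J' => // j /= Jj.
    by apply: HJ' => /=; rewrite (leq_trans Jj)// leq_addl.
exists f; last by apply/ler_addgt0Pr => e e0; have [] := tail e e0.
split; first by have [] := tail 1 ltr01.
apply: (@ultra_lim_unique _ _ G (fs^~ a)); first exact: Hf.
move=> e e0; apply: (@filterE _ G) => i; have [[_ ->] _] := Hfs i.
by rewrite subrr Normc.normc0 ltW.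
Qed.

(* The point evaluation at [a] is represented by a multiple of the element of
   least norm taking the value 1 at [a]. *)
Lemma kernel_exists : exists k, is_reproducing_kernel H a k.
Proof.
have [f0 [m0 f0a] qf0] := minimizer.
have orth g : mem g -> g a = 0 -> inner H f0 g = 0.
  (* The perturbation f0 - s <f0, g> g still takes the value 1 at a. The added 1 covers the case
     that g has norm zero. *)
  move=> mg ga; set s := (q g + 1)^-1.
  have g1 : 0 < q g + 1 by rewrite ltr_wpDl ?q_ge0.
  have s0 : 0 < s by rewrite invr_gt0.
  have sg : s * q g <= 1 by rewrite mulrC ler_pdivrMr// mul1r lerDl.
  have : m <= q (fun z => f0 z + (- s%:C%C * inner H f0 g) * g z).
    apply: lbm; split; first exact: hm_lin.
    by rewrite ga mulr0 addr0.
  rewrite qD// => h; apply: sqmod_eq0; apply/eqP; rewrite eq_le sqmod_ge0 andbT.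
  move: h; move: (inner H f0 g) => A.
  rewrite sqmodM sqmodN sqmod_real !(ReM, ImM, ReN, ImN) /=.
  rewrite (_ : 2 * _ = - (2 * s * sqmod A)); last by rewrite sqmodE; ring.
  rewrite (_ : s ^+ 2 * sqmod A * q g = s * sqmod A * (s * q g)); last by ring.
  have A0 := sqmod_ge0 A; have sA : 0 <= s * sqmod A by rewrite mulr_ge0// ltW.
  have : s * sqmod A * (s * q g) <= s * sqmod A * 1 by apply: ler_wpM2l.
  move=> h1 h2; rewrite -(@pmulr_rle0 _ s)//; lra.
have q0 : 0 < q f0.
  rewrite lt_def q_ge0 andbT; apply/eqP => q0.
  have [K K0 HK] := hm_point hm a1; have := HK _ _ m0 (lexx _).
  by rewrite -/(q f0) q0 mulr0 f0a sqmod1 ler10.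
(* This is f0 / q f0, written in the form to which [hm_lin] applies. *)
exists (fun z => f0 z + ((q f0)^-1 - 1)%:C%C * f0 z); split; first exact: hm_lin.
move=> f mf; rewrite inner_linr//.
have : inner H f0 (fun z => f z + (- f a) * f0 z) = 0.
  by apply: orth; [exact: hm_lin|rewrite f0a; ring].
rewrite inner_linr// inner_self inner_conj// => h.
have -> : inner H f f0 = f a * (q f0)%:C%C.
  move/eqP : h; rewrite addrC addr_eq0 => /eqP h.
  apply: (can_inj (@conjcK _)); rewrite conjcM conjc_real.
  by rewrite -[LHS]opprK -h raddfN mulNr opprK.
have -> : (((q f0)^-1 - 1)%:C%C)^*%C = ((q f0)^-1 - 1)%:C%C by rewrite conjc_real.
have : (q f0)^-1%:C%C * (q f0)%:C%C = 1 by rewrite -rmorphM mulVf ?gt_eqF.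
move=> pq; rewrite rmorphB rmorph1.
rewrite (_ : _ + _ = f a * ((q f0)^-1%:C%C * (q f0)%:C%C)); last by ring.
by rewrite pq mulr1.
Qed.

End riesz.

End hilbert_model.

(** * Normalized kernels, weights, and the step from bounded solutions to weighted bounds *)

Section corona_equivalence.
Variables (R : realType) (n : nat) (H : fspace R n) (hm : hilbert_model H).
Hypothesis hj : kernel_jensen H.
Local Notation C := R[i].
Local Notation vec := 'rV[R[i]]_n.
Local Notation mu := (fs_measure H).
Local Notation D := (fs_dom H).
Local Notation val := (fs_val H).
Local Notation mem := (fs_mem H).
Local Notation q f := (sqnm mu D (val f)).
Let mD := hm_dom hm.
Implicit Types (f g h k : vec -> C) (z : vec) (c : C).

Lemma kernelP a : unit_ball a -> is_reproducing_kernel H a (reproducing_kernel H a).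
Proof.
by move=> /unit_ballE /(kernel_exists hm); exact: (@xgetPex _ _ [set k | is_reproducing_kernel H a k]).
Qed.

Lemma kernel_diag a : unit_ball a ->
  reproducing_kernel H a a = (q (reproducing_kernel H a))%:C%C.
Proof. by move=> /kernelP[mk ->//]; exact: inner_self. Qed.

Lemma kernel_diag_gt0 a : unit_ball a -> 0 < q (reproducing_kernel H a).
Proof.
move=> /kernelP[mk rk]; rewrite lt_def sqnm_ge0 andbT; apply/eqP => q0.
have m1 := mem_cst hm 1.
have := cauchy_schwarz mD (hm_L2 hm m1) (hm_L2 hm mk).
by rewrite q0 mulr0 -[ip _ _ _ _]/(inner H _ _) -rk// sqmod1 ler10.
Qed.

(** Boundary functions are linear only up to null sets, so the normalizing factor comes out almost
    everywhere. *)
Lemma normalized_kernelP a : unit_ball a ->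
  mem (normalized_kernel H a) /\
  ae_eq mu D (fun t => sqmod (val (normalized_kernel H a) t))
    (fun t => (q (reproducing_kernel H a))^-1 * sqmod (val (reproducing_kernel H a) t)).
Proof.
move=> ba; have [mk _] := kernelP ba; have q0 := kernel_diag_gt0 ba.
set c := (sqrtC (reproducing_kernel H a a))^-1.
have -> : normalized_kernel H a =
    (fun z => reproducing_kernel H a z + (c - 1) * reproducing_kernel H a z).
  by apply/funext => z; rewrite /normalized_kernel -/c; ring.
split; first exact: hm_lin.
apply: filterS (hm_val hm (c - 1) mk mk) => t ht Dt; rewrite ht//.
rewrite (_ : _ + _ = c * val (reproducing_kernel H a) t); last by ring.
rewrite sqmodM; congr (_ * _).
have s2 : sqmod (sqrtC (reproducing_kernel H a a)) = q (reproducing_kernel H a).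
  by rewrite /sqmod -normcX sqrtCK kernel_diag// normc_real gtr0_norm.
have s0 : sqrtC (reproducing_kernel H a a) != 0.
  by apply/eqP => s0; move: s2; rewrite s0 sqmod0 => s2; rewrite -s2 ltxx in q0.
apply: (mulfI (lt0r_neq0 q0)); rewrite divff ?lt0r_neq0//.
by rewrite -{1}s2 -sqmodM divff// sqmod1.
Qed.

Lemma measurable_prod h k : mem h -> mem k ->
  measurable_fun D (fun t => sqmod (val h t) * sqmod (val k t)).
Proof.
by move=> /(cmeas_val hm)[? ?] /(cmeas_val hm)[? ?]; apply: measurable_funM;
  exact: measurable_sqmod.
Qed.

Lemma normalized_jensen a h : unit_ball a -> mem h ->
  ((sqmod (h a))%:E <=
    \int[mu]_(t in D) (sqmod (val h t) * sqmod (val (normalized_kernel H a) t))%:E)%E.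
Proof.
move=> ba mh; have [mk ek] := normalized_kernelP ba; have q0 := kernel_diag_gt0 ba.
have [mr _] := kernelP ba.
have p0 f g t : (0 <= (sqmod (f t) * sqmod (g t))%:E)%E.
  by move=> *; rewrite lee_fin mulr_ge0 ?sqmod_ge0.
have mhr : measurable_fun D (fun t => (sqmod (val h t) *
    sqmod (val (reproducing_kernel H a) t))%:E).
  by apply/measurable_EFinP; exact: measurable_prod.
rewrite (_ : (\int[mu]_(t in D) _)%E = ((q (reproducing_kernel H a))^-1%:E *
  \int[mu]_(t in D) (sqmod (val h t) * sqmod (val (reproducing_kernel H a) t))%:E)%E);
  last first.
  rewrite -ge0_integralZl// ?lee_fin ?invr_ge0 ?(ltW q0)//;
    try (by move=> t _; rewrite lee_fin mulr_ge0 ?sqmod_ge0).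
  apply: ge0_ae_eq_integral => //.
  - by apply/measurable_EFinP; exact: measurable_prod.
  - exact: measurable_funeM.
  - by move=> t _; rewrite lee_fin mulr_ge0 ?sqmod_ge0.
  - by move=> t _; apply: mule_ge0; rewrite lee_fin ?invr_ge0 ?sqnm_ge0// mulr_ge0 ?sqmod_ge0.
  - by apply: filterS ek => t ht Dt; rewrite ht// -EFinM mulrCA.
have := hj ba mh (kernelP ba).
rewrite kernel_diag// normc_real gtr0_norm// => hjk.
by rewrite lee_pdivlMl// -EFinM mulrC.
Qed.

Lemma normalized_sqint a : unit_ball a -> sqint mu D (val (normalized_kernel H a)) = 1%E.
Proof.
move=> ba; have [mk ek] := normalized_kernelP ba; have q0 := kernel_diag_gt0 ba.
have [mr _] := kernelP ba.
have mrr : measurable_fun D (fun t => (sqmod (val (reproducing_kernel H a) t))%:E).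
  exact/cmeas_sqmod/(cmeas_val hm).
have e : sqint mu D (val (normalized_kernel H a)) =
  ((q (reproducing_kernel H a))^-1%:E * sqint mu D (val (reproducing_kernel H a)))%E.
  rewrite /sqint -ge0_integralZl// ?lee_fin ?invr_ge0 ?(ltW q0)//;
    try (by move=> t _; rewrite lee_fin sqmod_ge0).
  apply: ge0_ae_eq_integral => //.
  - exact/cmeas_sqmod/(cmeas_val hm).
  - exact: measurable_funeM.
  - by move=> t _; rewrite lee_fin sqmod_ge0.
  - by move=> t _; apply: mule_ge0; rewrite lee_fin ?invr_ge0 ?sqnm_ge0// sqmod_ge0.
  - by apply: filterS ek => t ht Dt; rewrite ht.
rewrite e sqintE; [by rewrite -EFinM mulVf ?gt_eqF|exact: hm_L2].
Qed.

Section weights.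
Variables (M : nat) (a : 'I_M -> vec) (ba : forall m, unit_ball (a m)).

(** Index 0 carries the constant weight of theta_0, so that the weighted norm is a single convex
    combination of M + 1 integrals. *)
Definition weight (m : 'I_M.+1) t : R :=
  if unlift ord0 m is Some j then sqmod (val (normalized_kernel H (a j)) t) else 1.

Definition weight_int m h : \bar R :=
  (\int[mu]_(t in D) (sqmod (val h t) * weight m t)%:E)%E.

Lemma weight_ge0 m t : 0 <= weight m t.
Proof. by rewrite /weight; case: unliftP => // *; rewrite sqmod_ge0. Qed.

Lemma measurable_weight m : measurable_fun D (weight m).
Proof.
rewrite /weight; case: unliftP => [j _|_]; last exact: measurable_cst.
by have [mk _] := normalized_kernelP (ba j); have [? ?] := cmeas_val hm mk; exact: measurable_sqmod.
Qed.

Lemma measurable_weighted m h : mem h ->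
  measurable_fun D (fun t => (sqmod (val h t) * weight m t)%:E).
Proof.
move=> mh; apply/measurable_EFinP; apply: measurable_funM; last exact: measurable_weight.
by have [? ?] := cmeas_val hm mh; exact: measurable_sqmod.
Qed.

Lemma weight_int_ge0 m h : (0 <= weight_int m h)%E.
Proof. by apply: integral_ge0 => t _; rewrite lee_fin mulr_ge0 ?sqmod_ge0 ?weight_ge0. Qed.

Lemma weighted_sqnormE (th : 'I_M.+1 -> R) h : (forall m, 0 <= th m) -> mem h ->
  weighted_sqnorm H a th h = (\sum_(m < M.+1) (th m)%:E * weight_int m h)%E.
Proof.
move=> th0 mh; have mW m := measurable_weighted m mh.
have W0 m t : (0 <= (sqmod (val h t) * weight m t)%:E)%E.
  by rewrite lee_fin mulr_ge0 ?sqmod_ge0 ?weight_ge0.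
transitivity (\int[mu]_(t in D)
    \sum_(m < M.+1) (th m)%:E * (sqmod (val h t) * weight m t)%:E)%E.
  apply: eq_integral => t _; rewrite [RHS](eq_bigr (fun m => (th m * (sqmod (val h t) * weight m t))%:E))//.
  rewrite sumEFin; congr EFin; rewrite big_ord_recl {1}/weight unlift_none mulr1.
  rewrite mulrDr mulrC; congr (_ + _); rewrite mulr_sumr; apply: eq_bigr => j _.
  by rewrite /weight liftK mulrCA.
rewrite ge0_integral_sum//; try (by move=> m; exact: measurable_funeM);
  try (by move=> m t _; rewrite mule_ge0// lee_fin).
by apply: eq_bigr => m _; rewrite ge0_integralZl// lee_fin.
Qed.

Lemma weight_int_bounded m h (B : R) : mem h -> 0 <= B ->
  {ae mu, forall t, D t -> sqmod (val h t) <= B} -> (weight_int m h <= B%:E)%E.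
Proof.
move=> mh B0 hB.
apply: (@le_trans _ _ (\int[mu]_(t in D) (B%:E * (weight m t)%:E))%E).
  apply: ae_ge0_le_integral => //.
  - by move=> t _; rewrite lee_fin mulr_ge0 ?sqmod_ge0 ?weight_ge0.
  - exact: measurable_weighted.
  - by move=> t _; rewrite -EFinM lee_fin mulr_ge0 ?weight_ge0.
  - by apply: measurable_funeM; apply/measurable_EFinP; exact: measurable_weight.
  - apply: filterS hB => t ht Dt; rewrite -EFinM lee_fin.
    by apply: ler_wpM2r; [exact: weight_ge0|exact: ht].
rewrite ge0_integralZl ?lee_fin//;
  try (by apply/measurable_EFinP; exact: measurable_weight);
  try (by move=> t _; rewrite lee_fin weight_ge0).
rewrite -[leRHS]mule1; apply: lee_wpmul2l; first by rewrite lee_fin.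
rewrite /weight; case: unliftP => [j _|_]; last exact: hm_mass.
by rewrite -[leLHS]/(sqint mu D _) normalized_sqint.
Qed.

(** Pointwise convexity of the squared modulus, with defect s (1 - s) |x - y|^2. *)
Lemma weight_int_convex m f g (s : R) : mem f -> mem g -> 0 <= s <= 1 ->
  (weight_int m (fun z => f z + s%:C%C * (g z + (-1) * f z))%R <=
    (1 - s)%:E * weight_int m f + s%:E * weight_int m g)%E.
Proof.
move=> mf mg /andP[s0 s1].
have mgf : mem (fun z => g z + (-1) * f z) by exact: hm_lin.
have p0 h t : 0 <= sqmod (val h t) * weight m t by rewrite mulr_ge0 ?sqmod_ge0 ?weight_ge0.
have mW h : mem h -> measurable_fun D (fun t => (sqmod (val h t) * weight m t)%:E).
  exact: measurable_weighted.
have s1' : 0 <= 1 - s by rewrite subr_ge0.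
rewrite /weight_int -!ge0_integralZl ?lee_fin//; try exact: mW;
  try (by move=> t _; rewrite lee_fin p0).
have mZ (r : R) h : mem h ->
    measurable_fun D (fun t => r%:E * (sqmod (val h t) * weight m t)%:E)%E.
  by move=> /mW ?; exact: measurable_funeM.
rewrite -ge0_integralD//; try exact: mZ;
  try (by move=> t _; rewrite -EFinM lee_fin mulr_ge0 ?p0).
apply: ae_ge0_le_integral => //.
- by move=> t _; rewrite lee_fin p0.
- by apply: mW; exact: hm_lin.
- by move=> t _; rewrite -!EFinM -EFinD lee_fin addr_ge0// mulr_ge0 ?p0.
- by apply: emeasurable_funD; exact: mZ.
have h1 := hm_val hm s%:C%C mf mgf; have h2 := hm_val hm (-1) mg mf.
apply: filterS2 h1 h2 => t e1 e2 Dt; rewrite -!EFinM -EFinD lee_fin e1// e2//.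
rewrite (mulrA (1 - s)) (mulrA s) -mulrDl; apply: ler_wpM2r; first exact: weight_ge0.
move: (val f t) (val g t) => x y.
rewrite mulN1r !sqmodE !(ReD, ImD, ReM, ImM, ReN, ImN) /=.
have : 0 <= s * (1 - s) * ((complex.Re x - complex.Re y) ^+ 2 + (complex.Im x - complex.Im y) ^+ 2).
  by apply: mulr_ge0; [exact: mulr_ge0|rewrite addr_ge0 ?sqr_ge0].
by move=> h3; rewrite -subr_ge0; apply: etrans h3; congr (0 <= _); ring.
Qed.

End weights.

Lemma corona_cpp : corona_property R n -> convex_poisson_property H.
Proof.
move=> cor N c phi data; have [N0 _ _ _] := data.
have [K [f [K0 fH fB]]] := cor N c phi data.
have NR : 1 <= N%:R :> R by rewrite ler1n.
(* Each of the N summands is at most K^2, and N K^2 <= (N K)^2 since N >= 1. *)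
exists (N%:R * K); split; first by rewrite mulr_gt0// (lt_le_trans ltr01).
move=> M a th M0 ba th01 th1; exists f; split.
- by move=> l; exact: hm_Hinfty.
- apply: (@le_trans _ _ (\sum_(l < N) (K ^+ 2)%:E)%E).
    apply: lee_sum => l _; have ml := hm_Hinfty hm (fH l).
    have hB : {ae mu, forall t, D t -> sqmod (val (f l) t) <= K ^+ 2}.
      apply: hm_bounded => // z bz; have [h _] := fB z bz.
      exact: le_trans (@le_bigmax _ _ _ 0 (fun l => sqmod (f l z)) l) h.
    rewrite weighted_sqnormE//; last by move=> m; case/andP: (th01 m).
    apply: (@le_trans _ _ (\sum_(m < M.+1) (th m * K ^+ 2)%:E)%E).
      apply: lee_sum => m _; rewrite EFinM; apply: lee_wpmul2l.
        by rewrite lee_fin; case/andP: (th01 m).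
      by apply: weight_int_bounded => //; exact: sqr_ge0.
    by rewrite sumEFin -mulr_suml th1 mul1r.
  rewrite sumEFin lee_fin sumr_const card_ord -[leLHS]mulr_natl exprMn.
  apply: ler_wpM2r; first exact: sqr_ge0.
  by rewrite expr2 -[leLHS]mulr1; apply: ler_wpM2l; rewrite ?ler0n.
- by move=> z bz; have [] := fB z bz.
Qed.

End corona_equivalence.

(** * From weighted bounds to a bounded solution *)

Section limit_argument.
Variables (R : realType) (n : nat) (H : fspace R n) (hm : hilbert_model H).
Hypothesis hj : kernel_jensen H.
Local Notation C := R[i].
Local Notation vec := 'rV[R[i]]_n.
Local Notation mu := (fs_measure H).
Local Notation D := (fs_dom H).
Local Notation val := (fs_val H).
Local Notation mem := (fs_mem H).
Local Notation q f := (sqnm mu D (val f)).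
Let mD := hm_dom hm.

(* The minimax argument replaces the average bound over the convex weights by a
   bound for each weight; the Jensen inequality turns it into a bound at the points. *)
Lemma cpp_finite_points N (c : R) (phi : 'I_N -> vec -> C) :
  convex_poisson_property H -> corona_data c phi ->
  exists2 K : R, 0 < K & forall s : seq vec, exists f : 'I_N -> vec -> C,
    [/\ forall l, mem (f l),
        forall z, unit_ball z -> \sum_(l < N) phi l z * f l z = 1,
        forall l, q (f l) <= K &
        forall l z, z \in s -> unit_ball z -> sqmod (f l z) <= K].
Proof.
move=> cpp data; have [K [K0 HK]] := cpp N c phi data.
have K20 : 0 < K ^+ 2 by rewrite exprn_gt0.
have K1 : 0 < K ^+ 2 + 1 by rewrite addr_gt0.
exists (K ^+ 2 + 1) => // s.
(* One index beyond the length of s keeps M positive for the empty list. The extra point, like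
   points of s outside the ball, becomes the origin. *)
pose a (i : 'I_(size s).+1) : vec :=
  if `[< unit_ball (nth 0 s i) >] then nth 0 s i else 0.
have ba i : unit_ball (a i).
  rewrite /a; case: asboolP => // _; apply/unit_ballE; rewrite enorm0; exact: ltr01.
pose W m f := weight_int H a m f.
have W0 m f : (0 <= W m f)%E by exact: weight_int_ge0.
(* Upper bounds rather than values: the integrals are convex in f, so their values need not form a
   convex set, but their upper bounds do. *)
pose S : set ('I_(size s).+2 -> R) := [set v | exists f : 'I_N -> vec -> C,
  [/\ forall l, mem (f l),
      forall z, unit_ball z -> \sum_(l < N) phi l z * f l z = 1,
      forall m, 0 <= v m &
      forall m, (\sum_(l < N) W m (f l) <= (v m)%:E)%E]].
have convS u v t : S u -> S v -> 0 <= t <= 1 -> S (fun m => u m + t * (v m - u m)).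
  move=> [f [mf bf u0 uf]] [g [mg bg v0 vg]] t01; have [t0 t1] := andP t01.
  have e m : u m + t * (v m - u m) = (1 - t) * u m + t * v m by ring.
  exists (fun l z => f l z + t%:C%C * (g l z + (-1) * f l z)); split.
  - by move=> l; apply: hm_lin => //; exact: hm_lin.
  - move=> z bz; rewrite (eq_bigr (fun l => phi l z * f l z +
        t%:C%C * (phi l z * g l z - phi l z * f l z))); last by move=> l _; ring.
    by rewrite big_split /= -mulr_sumr sumrB bf// bg// subrr mulr0 addr0.
  - by move=> m; rewrite e addr_ge0// mulr_ge0// subr_ge0.
  - move=> m; rewrite e.
    apply: (@le_trans _ _ (\sum_(l < N) ((1 - t)%:E * W m (f l) + t%:E * W m (g l)))%E).
      by apply: lee_sum => l _; exact: weight_int_convex.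
    rewrite big_split /= -!ge0_sume_distrr//.
    rewrite -[leRHS]/((1 - t)%:E * (u m)%:E + t%:E * (v m)%:E)%E.
    by apply: leeD; apply: lee_wpmul2l => //; rewrite lee_fin ?subr_ge0.
have posS v : S v -> forall m, 0 <= v m by move=> [f []].
have [|v [f [mf bf _ vf]] vK] := minimax (ltn0Sn _) K20 ltr01 convS posS.
  move=> th th0 th1.
  have th01 m : 0 <= th m <= 1.
    rewrite ltW//= -th1 (bigD1 m)//= lerDl; apply: sumr_ge0 => i _; exact: ltW.
  have [f [mf fK bf]] := HK _ a th (ltn0Sn _) ba th01 th1.
  have hs : (\sum_(m < (size s).+2) (th m)%:E * (\sum_(l < N) W m (f l)) <= (K ^+ 2)%:E)%E.
    apply: le_trans fK; rewrite le_eqVlt; apply/orP; left; apply/eqP.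
    rewrite (eq_bigr (fun m => \sum_(l < N) (th m)%:E * W m (f l))%E); last first.
      by move=> m _; rewrite ge0_sume_distrr.
    rewrite exchange_big /=; apply: eq_bigr => l _; rewrite weighted_sqnormE//.
    by move=> m; exact: ltW.
  have V0 m : (0 <= \sum_(l < N) W m (f l))%E by apply: sume_ge0.
  (* A positive weight times an infinite integral would violate the bound. This is where strict
     positivity of the weights in [minimax] is used: a zero weight would hide an infinite
     integral. *)
  have Vfin m : (\sum_(l < N) W m (f l) = (fine (\sum_(l < N) W m (f l)))%:E)%E.
    rewrite fineK// ge0_fin_numE// ltNge leye_eq; apply/negP => /eqP h.
    have : (+oo <= (K ^+ 2)%:E)%E.
      apply: le_trans hs; rewrite (bigD1 m)//= h gt0_muley ?lte_fin// addye//.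
      rewrite -ltNye; apply: (@lt_le_trans _ _ 0%E) => //; apply: sume_ge0 => i _.
      by apply: mule_ge0; [rewrite lee_fin ltW|exact: V0].
    by rewrite leye_eq.
  exists (fun m => fine (\sum_(l < N) W m (f l))%E).
    by exists f; split => // m; [exact: fine_ge0|rewrite -Vfin].
  rewrite -lee_fin -sumEFin; apply: le_trans hs; apply: lee_sum => m _.
  by rewrite EFinM -Vfin.
have fW m l : (W m (f l) <= (K ^+ 2 + 1)%:E)%E.
  apply: (@le_trans _ _ (\sum_(l < N) W m (f l))%E).
    by rewrite (bigD1 l)//= leeDl//; apply: sume_ge0.
  by apply: le_trans (vf m) _; rewrite lee_fin.
exists f; split => // [l|l z zs bz].
  rewrite -lee_fin -(sqintE (hm_L2 hm (mf l))).
  apply: le_trans (fW ord0 l); rewrite /W /weight_int /weight unlift_none.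
  by rewrite le_eqVlt; apply/orP; left; apply/eqP; apply: eq_integral => t _; rewrite mulr1.
have zi : (index z s < (size s).+1)%N by rewrite ltnS index_size.
have az : a (Ordinal zi) = z.
  by rewrite /a /= nth_index// ifT//; exact/asboolP.
rewrite -lee_fin; apply: le_trans (normalized_jensen hm hj bz (mf l)) _.
by have := fW (lift ord0 (Ordinal zi)) l; rewrite /W /weight_int /weight liftK az.
Qed.

Lemma cpp_corona : convex_poisson_property H -> corona_property R n.
Proof.
move=> cpp N c phi data; have [N0 c0 hphi phi1] := data.
have [K K0 HK] := cpp_finite_points cpp data.
have [F HF] := choice HK.
pose B (s0 : seq vec) := [set s : seq vec | {subset s0 <= s}].
have PF : ProperFilter (filter_from setT B).
  apply: filter_from_proper; last by move=> s _; exists s.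
  apply: filter_from_filter; first by exists [::].
  move=> s1 s2 _ _; exists (s1 ++ s2) => // s hs; split=> x xs; apply: hs.
    by rewrite mem_cat xs.
  by rewrite mem_cat xs orbT.
have [G [GU Gle]] := @ultraFilterLemma _ (filter_from setT B) PF.
(* The bound on the norms, due to the constant weight, gives the locally uniform bounds required by
   [holomorphic_limit]. *)
have loc l r : r < 1 -> exists B, forall i z, enorm z <= r -> normc (F i l z) <= B.
  move=> /(hm_point hm)[Kr Kr0 HKr]; exists (Num.sqrt (Kr * K)) => s z zr.
  have [mf _ qf _] := HF s; rewrite sqmod_normc; apply: ler_wsqrtr.
  apply: le_trans (HKr _ _ (mf l) zr) _.
  by apply: ler_wpM2l; [exact: ltW|exact: qf].
have lim (lz : 'I_N * vec) : exists y : C, enorm lz.2 < 1 ->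
    forall e : R, 0 < e -> \forall i \near G, normc (F i lz.1 lz.2 - y) <= e.
  case: lz => l z /=; have [z1|z1] := ltP (enorm z) 1; last by exists 0.
  have [b Hb] := loc l _ z1.
  have [y Hy] := @ultra_bounded_cvg _ _ G (fun i => F i l z) b _ (fun i => Hb i z (lexx _)).
  by exists y.
have [g0 Hg0] := choice lim; pose g l z := g0 (l, z).
have Hg l z : enorm z < 1 ->
  forall e : R, 0 < e -> \forall i \near G, normc (F i l z - g l z) <= e := Hg0 (l, z).
have gK l z : unit_ball z -> normc (g l z) <= Num.sqrt K.
  move=> bz; have z1 := (unit_ballE z).1 bz.
  apply: (@lim_normc_le _ _ G (fun i => F i l z)) (Hg l z z1) _.
  (* Every list containing z belongs to the index set on which the pointwise bound at z holds. *)
  apply: Gle; exists [:: z] => // s zs; have [_ _ _ h] := HF s.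
  by rewrite sqmod_normc; apply/ler_wsqrtr/h => //; apply: zs; rewrite inE.
exists (Num.sqrt K), g; split; first by rewrite sqrtr_gt0.
  move=> l; split; last by exists (Num.sqrt K); exact: gK.
  apply: (@holomorphic_limit _ _ _ G (fun i => F i l)) => //; first by
    move=> i; have [mf _ _ _] := HF i; exact: hm_holomorphic (mf l).
  - exact: loc.
  - exact: Hg.
move=> z bz; have z1 := (unit_ballE z).1 bz; split.
  apply: bigmax_le; first exact: sqr_ge0.
  by move=> l _; rewrite /sqmod ler_sqr ?nnegrE ?normc_ge0 ?sqrtr_ge0 ?gK.
(* The constant family 1 is the sum of phi_l F_l at z; as |phi_l| <= 1, errors e / N in each F_l add
   up to at most e. *)
apply: (@ultra_lim_unique _ _ G (fun=> 1)) => [e e0|e e0]; last first.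
  by apply: (@filterE _ G) => i; rewrite subrr Normc.normc0 ltW.
have NR : 0 < N%:R :> R by rewrite ltr0n.
have near : \forall i \near G, forall l, normc (F i l z - g l z) <= e / N%:R.
  apply: filter_forall => l; apply: Hg => //; exact: divr_gt0.
apply: filterS near => i hi; have [_ bz1 _ _] := HF i.
rewrite -(bz1 z bz) -sumrB.
have sum_le (u : 'I_N -> C) : normc (\sum_l u l) <= \sum_l normc (u l).
  elim/big_ind2 : _ => [|x1 y1 x2 y2 h1 h2|//]; first by rewrite Normc.normc0.
  by apply: le_trans (normcD _ _) _; exact: lerD.
apply: le_trans (sum_le _) _.
apply: (@le_trans _ _ (\sum_(l < N) e / N%:R)); last first.
  by rewrite sumr_const card_ord -[leLHS]mulr_natl mulrCA divff ?mulr1// gt_eqF.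
apply: ler_sum => l _; rewrite -mulrBr Normc.normcM.
have [_ /(_ z bz)] := (I, phi1).
move=> /andP[_ hm1].
have p1 : normc (phi l z) <= 1.
  have := le_trans (@le_bigmax _ _ _ 0 (fun l => sqmod (phi l z)) l) (andP (phi1 z bz)).2.
  rewrite /sqmod -[leRHS](expr1n _ 2) ler_sqr ?nnegrE ?normc_ge0//.
by apply: le_trans (hi l); rewrite -[leRHS]mul1r; apply: ler_wpM2r => //; exact: normc_ge0.
Qed.

Theorem corona_iff_cpp : corona_property R n <-> convex_poisson_property H.
Proof. by split; [exact: corona_cpp|exact: cpp_corona]. Qed.

End limit_argument.

(** * The Bergman space *)

Section holomorphic_algebra.
Variables (R : realType) (n : nat).
Local Notation vec := 'rV[R[i]]_n.
Implicit Types (f g : vec -> R[i]) (c : R[i]).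

Lemma holomorphic_cst c : @holomorphic R n (fun=> c).
Proof. by move=> z _; exact: differentiable_cst. Qed.

Lemma holomorphicD f g : holomorphic f -> holomorphic g -> holomorphic (fun z => f z + g z).
Proof. by move=> hf hg z bz; exact: (differentiableD (hf z bz) (hg z bz)). Qed.

Lemma holomorphicM f g : holomorphic f -> holomorphic g -> holomorphic (fun z => f z * g z).
Proof. by move=> hf hg z bz; exact: (differentiableM (hf z bz) (hg z bz)). Qed.

Lemma holomorphic_lin f g c : holomorphic f -> holomorphic g ->
  holomorphic (fun z => f z + c * g z).
Proof. by move=> hf hg; apply: holomorphicD => //; apply: holomorphicM => //; exact: holomorphic_cst. Qed.

End holomorphic_algebra.

Section fatou.
Context d (T : measurableType d) (R : realType) (mu : {measure set T -> \bar R}).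
Variables (D : set T) (mD : measurable D).

Lemma fatou_sqint (F : nat -> T -> R[i]) (G : T -> R[i]) (K : \bar R) :
  (forall j, cmeas D (F j)) ->
  (forall t, D t -> forall e : R, 0 < e -> \forall j \near \oo, normc (F j t - G t) <= e) ->
  (forall j, sqint mu D (F j) <= K)%E -> (sqint mu D G <= K)%E.
Proof.
move=> mF cv hK.
have cvs t : D t -> (sqmod (F j t))%:E @[j --> \oo] --> (sqmod (G t))%:E.
  move=> Dt; apply: cvg_EFin; first exact: nearW.
  apply/cvgrPdist_le => e e0 /=.
  (* As d' <= 1, the sum |F| + |G| is at most this denominator, so | |G|^2 - |F|^2 | <= e. *)
  pose d' := e / (2 * normc (G t) + e + 1); have G0 := normc_ge0 (G t).
  have p0 : 0 < 2 * normc (G t) + e + 1 by lra.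
  have d0 : 0 < d' by rewrite divr_gt0.
  have d1 : d' <= 1 by rewrite ler_pdivrMr//; lra.
  apply: filterS (cv t Dt d' d0) => j hj.
  have h1 := normcD (F j t - G t) (G t); have h2 := normcD (G t - F j t) (F j t).
  rewrite !subrK (normc_distC (G t)) in h1 h2.
  have F0 := normc_ge0 (F j t).
  rewrite /sqmod subr_sqr normrM.
  have a1 : `|normc (G t) - normc (F j t)| <= d' by rewrite ler_norml; apply/andP; split; lra.
  have a2 : `|normc (G t) + normc (F j t)| <= 2 * normc (G t) + e + 1.
    by rewrite ger0_norm ?addr_ge0//; lra.
  have := ler_pM (normr_ge0 _) (normr_ge0 _) a1 a2.
  by rewrite /d' divfK ?gt_eqF.
rewrite /sqint (_ : (\int[mu]_(t in D) _)%E =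
    (\int[mu]_(t in D) limn_einf (fun j => (sqmod (F j t))%:E))%E); last first.
  apply: eq_integral => t /set_mem Dt; have h := cvs t Dt.
  by rewrite is_cvg_limn_einfE ?(cvg_lim _ h)//; apply/cvg_ex; exists (sqmod (G t))%:E.
apply: le_trans (fatou mu mD _ _) _.
- by move=> j; exact: cmeas_sqmod.
- by move=> j t _; rewrite lee_fin sqmod_ge0.
rewrite limn_einf_lim; apply: lime_le; first exact: is_cvg_einfs.
apply: nearW => j; rewrite /einfs /=; apply: le_trans (hK j).
by apply: ereal_inf_lbound; exists j => /=.
Qed.

End fatou.

Section bergman_model.
Variables (R : realType) (n : nat).
Local Notation C := R[i].
Local Notation vec := 'rV[R[i]]_n.
Local Notation B := (@coord_ball R n).
Local Notation mB := (ball_measure R n).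
Local Notation A2 := (bergman R n).
Implicit Types (f g k : vec -> C).

Lemma cmeas_ball f : holomorphic f -> cmeas B (fun t => f (complex_point t)).
Proof.
move=> /measurable_fhat[m1 m2]; have mb := @measurable_coord_ball R n.
split; [apply: eq_measurable_fun (measurable_funTS m1)|apply: eq_measurable_fun (measurable_funTS m2)];
  by move=> t /set_mem /coord_ballE h; rewrite fhatE.
Qed.

Lemma bergmanE f : fs_mem A2 f <-> holomorphic f /\ L2 mB B (fun t => f (complex_point t)).
Proof. by split=> [[hf fin]|[hf [_ fin]]]; split => //; split => //; exact: cmeas_ball. Qed.

Lemma bounded_L2 (mu : {measure set (n.-tuple (plane R)) -> \bar R}) D (F : _ -> C) (K : R) :
  measurable D -> (\int[mu]_(t in D) 1 <= 1)%E -> cmeas D F ->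
  {ae mu, forall t, D t -> sqmod (F t) <= K} -> 0 <= K -> L2 mu D F.
Proof.
move=> mD mass mF hK K0; split => //; apply: (@le_lt_trans _ _ K%:E); last exact: ltry.
apply: (@le_trans _ _ (\int[mu]_(t in D) (K%:E * 1))%E).
  apply: ae_ge0_le_integral => //.
  - by move=> t _; rewrite lee_fin sqmod_ge0.
  - exact: cmeas_sqmod.
  - by move=> t _; rewrite mule1 lee_fin.
  - by apply: filterS hK => t h Dt; rewrite mule1 lee_fin h.
rewrite ge0_integralZl// ?lee_fin//.
by rewrite -[leRHS]mule1; apply: lee_wpmul2l => //; rewrite lee_fin.
Qed.

(* If the product [f k] is in the space, this is the Cauchy-Schwarz inequality
   for [f(a) k(a) = <f k, k>]. *)
Lemma jensen_of_product (H : fspace R n) a f k (G : n.-tuple (plane R) -> C) :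
  measurable (fs_dom H) -> is_reproducing_kernel H a k ->
  L2 (fs_measure H) (fs_dom H) (fs_val H k) -> L2 (fs_measure H) (fs_dom H) G ->
  ae_eq (fs_measure H) (fs_dom H) (fun t => sqmod (G t))
    (fun t => sqmod (fs_val H f t) * sqmod (fs_val H k t)) ->
  measurable_fun (fs_dom H) (fun t => sqmod (fs_val H f t) * sqmod (fs_val H k t)) ->
  f a * k a = ip (fs_measure H) (fs_dom H) G (fs_val H k) ->
  ((sqmod (f a) * normc (k a))%:E <=
     \int[fs_measure H]_(t in fs_dom H) (sqmod (fs_val H f t) * sqmod (fs_val H k t))%:E)%E.
Proof.
move=> mD [mk rk] Lk LG eG mfk e.
have -> : (\int[fs_measure H]_(t in fs_dom H) (sqmod (fs_val H f t) *
    sqmod (fs_val H k t))%:E)%E = (sqnm (fs_measure H) (fs_dom H) G)%:E.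
  rewrite -(sqintE LG); apply: ge0_ae_eq_integral => //.
  - exact/measurable_EFinP.
  - by have [m _] := LG; exact: cmeas_sqmod.
  - by move=> t _; rewrite lee_fin mulr_ge0 ?sqmod_ge0.
  - by move=> t _; rewrite lee_fin sqmod_ge0.
  - by apply: filterS eG => t h Dt; rewrite h.
have kk : k a = (sqnm (fs_measure H) (fs_dom H) (fs_val H k))%:C%C.
  by rewrite rk//; exact: ip_self.
have := cauchy_schwarz mD LG Lk; rewrite -e sqmodM kk sqmod_real normc_real.
have := sqnm_ge0 (fs_measure H) (fs_dom H) (fs_val H k).
move: (sqnm _ _ (fs_val H k)) => q q0; rewrite ger0_norm// => h; rewrite lee_fin.
have [->|q1] := eqVneq q 0; first by rewrite mulr0 sqnm_ge0.
have q2 : 0 < q by rewrite lt_def q1.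
by rewrite -(ler_pM2r q2) -mulrA -expr2.
Qed.

Lemma bergman_model : hilbert_model A2.
Proof.
have mb := @measurable_coord_ball R n.
have mass := @ball_measure1 R n.
have lin f g (c : C) : fs_mem A2 f -> fs_mem A2 g -> fs_mem A2 (fun z => f z + c * g z).
  move=> /bergmanE[hf Lf] /bergmanE[hg Lg]; apply/bergmanE; split.
    exact: holomorphic_lin.
  exact: (L2_lin mb c Lf Lg).
have bdd f : Hinfty f -> fs_mem A2 f.
  move=> [hf [K HK]]; apply/bergmanE; split => //.
  apply: (@bounded_L2 _ _ _ (K ^+ 2)) => //.
  - by rewrite mass.
  - exact: cmeas_ball.
  - apply: nearW => t /coord_ballE/unit_ballE bt; rewrite /sqmod.
    by rewrite ler_sqr ?nnegrE ?normc_ge0 ?HK// (le_trans (normc_ge0 _) (HK _ bt)).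
  - exact: sqr_ge0.
split => //.
- by rewrite mass.
- by move=> f [].
- by move=> f g c _ _; apply: nearW.
- by move=> f /bergmanE[].
- move=> r /(@ball_point_bound R n)[K [K0 HK]]; exists K => // f z /bergmanE[hf Lf] zr.
  have := HK f z hf zr.
  rewrite -[X in (_ * X)%E]/(sqint mB B (fun t => f (complex_point t))).
  by rewrite (sqintE Lf) -EFinM lee_fin.
- move=> fs f K mfs hK hf cv.
  have h : (sqint mB B (fun t => f (complex_point t)) <= K%:E)%E.
    apply: (@fatou_sqint _ _ _ mB _ mb (fun j t => fs j (complex_point t))).
    - by move=> j; have [h _] := mfs j; exact: cmeas_ball.
    - by move=> t /coord_ballE tb; exact: cv.
    - move=> j; have /bergmanE[_ L] := mfs j.
      by rewrite (sqintE L) lee_fin; exact: hK.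
  have L : L2 mB B (fun t => f (complex_point t)).
    by split; [exact: cmeas_ball|exact: le_lt_trans h (ltry _)].
  split; first exact/bergmanE.
  by rewrite -lee_fin; move: h; rewrite (sqintE L).
- by move=> f K hf HK; apply: nearW => t /coord_ballE/unit_ballE; exact: HK.
Qed.

Lemma bergman_jensen : kernel_jensen A2.
Proof.
have mb := @measurable_coord_ball R n.
move=> a f k ba /bergmanE[hf Lf] rk; have [/bergmanE[hk Lk] rk2] := rk.
have mfk : cmeas B (fun t => f (complex_point t) * k (complex_point t)).
  exact: (cmeas_ball (holomorphicM hf hk)).
have e t : sqmod (f (complex_point t) * k (complex_point t)) =
  sqmod (f (complex_point t)) * sqmod (k (complex_point t)) by rewrite sqmodM.
have [fin|/negP inf] := boolP (sqint mB B (fun t => f (complex_point t) * k (complex_point t))%R < +oo)%E.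
  apply: (@jensen_of_product _ a f k (fun t => f (complex_point t) * k (complex_point t))) => //.
  - by apply: nearW => t _; exact: e.
  - by case: mfk => ? ?; under eq_fun do rewrite -e; exact: measurable_sqmod.
  - apply: (rk2 (fun z => f z * k z)); apply/bergmanE; split => //.
    exact: holomorphicM.
rewrite [X in (_ <= X)%E](_ : _ = +oo%E) ?leey//.
apply/eqP; rewrite -leye_eq leNgt; apply/negP => h; apply: inf.
by rewrite /sqint; under eq_integral do rewrite e.
Qed.

End bergman_model.

(** * The Hardy space *)

Section dilations.
Variables (R : realType) (n : nat).
Local Notation C := R[i].
Local Notation vec := 'rV[R[i]]_n.
Local Notation coords := (n.-tuple (plane R)).
Local Notation S := (@coord_sphere R n).
Local Notation sg := (sphere_measure R n).
Local Notation ccont u := (segcont u 0 (pi *+ 2)).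
Implicit Types (f g : vec -> C) (t : coords) (z : vec) (r s : R).

(** Going through [fhat] makes dilates measurable on the whole space; on the sphere, for 0 <= r < 1,
    this is f(r t). *)
Definition dil f r t : C := fhat f (cscale r t).

Lemma dil_ball r t : S t -> 0 <= r < 1 -> enorm (r%:C%C *: complex_point t) < 1.
Proof.
by move=> /coord_sphereE t1 /andP[r0 r1]; rewrite enormZ t1 mulr1 normc_real ger0_norm.
Qed.

Lemma dilE f r t : S t -> 0 <= r < 1 -> dil f r t = f (r%:C%C *: complex_point t).
Proof.
by move=> St r01; rewrite /dil fhatE complex_point_scale//; exact: dil_ball.
Qed.

Lemma cmeas_dil f r : holomorphic f -> cmeas setT (dil f r).
Proof.
move=> /measurable_fhat[m1 m2]; have ms := @measurable_cscale R n r.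
by split; [exact: (measurableT_comp m1 ms)|exact: (measurableT_comp m2 ms)].
Qed.

Definition slice f t (w : C) : C := f (w *: complex_point t).

Lemma slice_cdiff f t w : holomorphic f -> S t -> normc w < 1 -> cdiff (slice f t) w.
Proof.
move=> hf /coord_sphereE t1 w1.
have -> : slice f t = (fun w => f (0 + w *: complex_point t)).
  by apply/funext => x; rewrite add0r.
by apply: holomorphic_slice => //; rewrite add0r enormZ t1 mulr1.
Qed.

Lemma dil_rot f r t th : S t -> 0 <= r < 1 -> dil f r (crot th t) = slice f t (circ r th).
Proof.
move=> St r01; rewrite dilE//.
  by rewrite complex_point_rot scalerA.
by apply/coord_sphereE; rewrite enorm_rot; exact/coord_sphereE.
Qed.

(* Integrands over the sphere which can be compared circle by circle. *)
Definition circular (F : coords -> R) :=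
  [/\ measurable_fun setT F, forall t, 0 <= F t &
      forall t, S t -> ccont (fun th => F (crot th t))].

Lemma circularD F G : circular F -> circular G -> circular (fun t => F t + G t).
Proof.
move=> [mF F0 cF] [mG G0 cG]; split => [|t|t St]; first exact: measurable_funD.
  by rewrite addr_ge0.
by apply: segcontD; [exact: cF|exact: cG].
Qed.

Lemma circular_pair f g r s : holomorphic f -> holomorphic g ->
  0 <= r < 1 -> 0 <= s < 1 -> circular (fun t => sqmod (dil f r t + dil g s t)).
Proof.
move=> hf hg r01 s01; split => [|t|t St].
- have [m1 m2] := cmeasD (cmeas_dil r hf) (cmeas_dil s hg).
  exact: measurable_sqmod.
- exact: sqmod_ge0.
have [r0 r1] := andP r01; have [s0 s1] := andP s01.
have -> : (fun th => sqmod (dil f r (crot th t) + dil g s (crot th t))) =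
    (fun th => sqmod (slice f t (circ r th)) + sqmod (slice g t (circ s th)) +
       2 * complex.Re (slice f t (circ r th) * (slice g t (circ s th))^*%C)).
  by apply/funext => th; rewrite !dil_rot// sqmod_polar.
have d1 w : normc w = r -> cdiff (slice f t) w.
  by move=> wr; apply: slice_cdiff => //; rewrite wr.
have d2 w : normc w = s -> cdiff (slice g t) w.
  by move=> ws; apply: slice_cdiff => //; rewrite ws.
apply: segcontD; first by apply: segcontD; exact: circ_sqmod_ccont.
by apply: segcontZ; exact: circ_pair_ccont.
Qed.

Lemma circular_dil f r : holomorphic f -> 0 <= r < 1 ->
  circular (fun t => sqmod (dil f r t)).
Proof.
move=> hf r01; split => [|t|t St].
- by have [m1 m2] := cmeas_dil r hf; exact: measurable_sqmod.
- exact: sqmod_ge0.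
have [r0 r1] := andP r01.
have -> : (fun th => sqmod (dil f r (crot th t))) = (fun th => sqmod (slice f t (circ r th))).
  by apply/funext => th; rewrite dil_rot.
by apply: circ_sqmod_ccont => // w wr; apply: slice_cdiff => //; rewrite wr.
Qed.

Lemma circular_le F G : circular F -> circular G ->
  (forall t, S t -> cmean (fun th => F (crot th t)) <= cmean (fun th => G (crot th t))) ->
  (\int[sg]_(t in S) (F t)%:E <= \int[sg]_(t in S) (G t)%:E)%E.
Proof.
move=> [mF F0 cF] [mG G0 cG] FG; apply: sphere_average_le.
- exact/measurable_EFinP.
- exact/measurable_EFinP.
- by move=> t; rewrite lee_fin.
- by move=> t; rewrite lee_fin.
- by move=> t St; apply: le_theta_int; [exact: cF|exact: cG|exact: FG].
Qed.

Lemma circular_integralD F G : circular F -> circular G ->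
  (\int[sg]_(t in S) (F t + G t)%:E =
   \int[sg]_(t in S) (F t)%:E + \int[sg]_(t in S) (G t)%:E)%E.
Proof.
move=> [mF F0 _] [mG G0 _]; have mS := @measurable_coord_sphere R n.
rewrite -ge0_integralD//; try (by apply/measurable_EFinP; exact: measurable_funTS);
  by move=> t _; rewrite lee_fin.
Qed.

Definition dilnorm f r : \bar R := sqint sg S (dil f r).

Lemma dilnormE f r : 0 <= r < 1 ->
  dilnorm f r = (\int[sg]_(t in S) (sqmod (f (r%:C%C *: complex_point t)))%:E)%E.
Proof. by move=> r01; apply: eq_integral => t /set_mem St; rewrite dilE. Qed.

Lemma dilnorm_homo f r s : holomorphic f -> 0 < r -> r <= s -> s < 1 ->
  (dilnorm f r <= dilnorm f s)%E.
Proof.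
move=> hf r0 rs s1; have s0 := lt_le_trans r0 rs; have r1 := le_lt_trans rs s1.
apply: circular_le; try (by apply: circular_dil => //; rewrite ?(ltW r0) ?(ltW s0)).
move=> t St.
rewrite (eq_cmean (v := fun th => sqmod (slice f t (circ r th)))); last first.
  by move=> th; rewrite dil_rot// (ltW r0).
rewrite [leRHS](eq_cmean (v := fun th => sqmod (slice f t (circ s th)))); last first.
  by move=> th; rewrite dil_rot// (ltW s0).
by apply: (@cmean_sqmod_homo _ 1) => // w; exact: slice_cdiff.
Qed.

(** Polarization on each circle, where the cross term depends on r s only. The squared norms stand
    on the opposite sides because the integrals are extended reals, which cannot be subtracted
    freely. *)
Lemma dil_pairing f g r s r' s' : holomorphic f -> holomorphic g ->
  0 < r < 1 -> 0 < s < 1 -> 0 < r' < 1 -> 0 < s' < 1 -> r * s = r' * s' ->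
  (sqint sg S (fun t => dil f r t + dil g s t)%R + (dilnorm f r' + dilnorm g s') =
   sqint sg S (fun t => dil f r' t + dil g s' t)%R + (dilnorm f r + dilnorm g s))%E.
Proof.
move=> hf hg r01 s01 r01' s01' E.
have W (x : R) : 0 < x < 1 -> 0 <= x < 1 by case/andP => /ltW -> ->.
have cd f' (x : R) : holomorphic f' -> 0 < x < 1 -> circular (fun t => sqmod (dil f' x t)).
  by move=> hf' /W x01; exact: circular_dil.
(* [circular_le] transfers inequalities only; exchanging the two pairs of radii gives the other
   direction. *)
have half (p q p' q' : R) : 0 < p < 1 -> 0 < q < 1 -> 0 < p' < 1 -> 0 < q' < 1 ->
  p * q = p' * q' ->
  (\int[sg]_(t in S) (sqmod (dil f p t + dil g q t) +
      (sqmod (dil f p' t) + sqmod (dil g q' t)))%:E <=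
   \int[sg]_(t in S) (sqmod (dil f p' t + dil g q' t) +
      (sqmod (dil f p t) + sqmod (dil g q t)))%:E)%E.
  move=> p01 q01 p01' q01' e.
  have c1 := circular_pair hf hg (W _ p01) (W _ q01).
  have c2 := circular_pair hf hg (W _ p01') (W _ q01').
  have cc (x y : R) : 0 < x < 1 -> 0 < y < 1 ->
      circular (fun t => sqmod (dil f x t) + sqmod (dil g y t)).
    by move=> x01 y01; apply: circularD; exact: cd.
  apply: circular_le; [by apply: circularD => //; exact: cc..|].
  move=> t St; have df w : normc w < 1 -> cdiff (slice f t) w by exact: slice_cdiff.
  have dg w : normc w < 1 -> cdiff (slice g t) w by exact: slice_cdiff.
  have [_ _ c1'] := c1; have [_ _ c2'] := c2.
  have ccf x : 0 < x < 1 -> ccont (fun th => sqmod (dil f x (crot th t))).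
    by move=> x01; have [_ _] := cd f x hf x01; exact.
  have ccg x : 0 < x < 1 -> ccont (fun th => sqmod (dil g x (crot th t))).
    by move=> x01; have [_ _] := cd g x hg x01; exact.
  rewrite cmeanD; [|exact: c1'|by apply: segcontD; [exact: ccf|exact: ccg]].
  rewrite cmeanD; [|exact: ccf|exact: ccg].
  rewrite [leRHS]cmeanD; [|exact: c2'|by apply: segcontD; [exact: ccf|exact: ccg]].
  rewrite [X in _ <= _ + X]cmeanD; [|exact: ccf|exact: ccg].
  have e1 f' x : 0 < x < 1 -> cmean (fun th => sqmod (dil f' x (crot th t))) =
      cmean (fun th => sqmod (slice f' t (circ x th))).
    by move=> /W x01; apply: eq_cmean => th; rewrite dil_rot.
  have e2 x y : 0 < x < 1 -> 0 < y < 1 ->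
      cmean (fun th => sqmod (dil f x (crot th t) + dil g y (crot th t))) =
      cmean (fun th => sqmod (slice f t (circ x th) + slice g t (circ y th))).
    by move=> /W x01 /W y01; apply: eq_cmean => th; rewrite !dil_rot.
  have P x y (x01 : 0 < x < 1) (y01 : 0 < y < 1) := cmean_polar df dg x01 y01.
  rewrite (e2 p q p01 q01) (e2 p' q' p01' q01') (P p q p01 q01) (P p' q' p01' q01').
  rewrite (e1 f p p01) (e1 g q q01) (e1 f p' p01') (e1 g q' q01').
  rewrite (circ_pairing df dg p01 q01 p01' q01' e).
  move: (cmean _) (cmean _) (cmean _) (cmean _) (cmean _) => x1 x2 x3 x4 x5.
  by lra.
have sum (x y x' y' : R) : 0 < x < 1 -> 0 < y < 1 -> 0 < x' < 1 -> 0 < y' < 1 ->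
  (\int[sg]_(t in S) (sqmod (dil f x t + dil g y t) +
      (sqmod (dil f x' t) + sqmod (dil g y' t)))%:E =
   sqint sg S (fun t => dil f x t + dil g y t)%R + (dilnorm f x' + dilnorm g y'))%E.
  move=> x01 y01 x01' y01'.
  rewrite circular_integralD ?circular_integralD//.
  - exact: cd.
  - exact: cd.
  - by apply: circular_pair => //; exact: W.
  - by apply: circularD; exact: cd.
by rewrite -!sum//; apply/eqP; rewrite eq_le !half.
Qed.

End dilations.

(** * Fast Cauchy sequences and almost everywhere limits *)

Section geometric_convergence.
Context d (T : measurableType d) (R : realType) (mu : {measure set T -> \bar R}).
Implicit Types (D : set T) (F : nat -> T -> R[i]).

(* If [sqint (F j) <= 8^-j], this sum has a finite integral; where it is finite,
   [normc (F j t)] decays like [2^-j]. *)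
Definition geosum F t : \bar R := (\sum_(0 <= j <oo) (4 ^+ j * sqmod (F j t))%:E)%E.

Let geo0 F j t : (0 <= (4 ^+ j * sqmod (F j t))%:E)%E.
Proof. by rewrite lee_fin mulr_ge0 ?sqmod_ge0// exprn_ge0. Qed.

Let meas_term D F j : cmeas D (F j) -> measurable_fun D (fun t => (4 ^+ j * sqmod (F j t))%:E).
Proof.
move=> [m1 m2]; apply/measurable_EFinP; apply: measurable_funM => //.
exact: measurable_sqmod.
Qed.

Lemma cmeasT D (G : T -> R[i]) : cmeas setT G -> cmeas D G.
Proof. by move=> [? ?]; split; exact: measurable_funTS. Qed.

Lemma measurable_geosum D F : (forall j, cmeas D (F j)) -> measurable_fun D (geosum F).
Proof.
move=> mF; apply: (@ge0_emeasurable_sum _ _ _ D (fun j t => (4 ^+ j * sqmod (F j t))%:E) xpredT).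
  by move=> k x _ _; exact: geo0.
by move=> k _; exact: meas_term.
Qed.

Lemma geosum_bound F t : geosum F t \is a fin_num ->
  exists2 A : R, 0 <= A & forall j, normc (F j t) <= A * 2^-1 ^+ j.
Proof.
move=> fin; have U0 : (0 <= geosum F t)%E by apply: nneseries_ge0 => j _ _; exact: geo0.
exists (Num.sqrt (fine (geosum F t))); first exact: sqrtr_ge0.
move=> j; rewrite -ler_sqr ?nnegrE ?normc_ge0 ?mulr_ge0 ?sqrtr_ge0 ?exprn_ge0 ?invr_ge0//.
rewrite exprMn sqr_sqrtr ?fine_ge0// -exprM mulnC exprM.
have e4 : 2^-1 ^+ 2 = 4^-1 :> R by field.
rewrite e4 exprVn ler_pdivlMr ?exprn_gt0// mulrC -[leLHS]/(4 ^+ j * sqmod (F j t)).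
rewrite -lee_fin fineK//.
apply: le_trans (@nneseries_lim_ge _ _ xpredT 0 j.+1 _); last by move=> k _ _; exact: geo0.
rewrite big_nat_recr//= leeDr//; apply: sume_ge0 => i _; exact: geo0.
Qed.

Lemma geosum_ae D F : measurable D -> (forall j, cmeas D (F j)) ->
  (forall j, sqint mu D (F j) <= (8^-1 ^+ j)%:E)%E ->
  {ae mu, forall t, D t -> geosum F t \is a fin_num}.
Proof.
move=> mD mF hF; apply: integrable_ae => //.
have U0 t : (0 <= geosum F t)%E by apply: nneseries_ge0 => j _ _; exact: geo0.
apply/integrableP; split; first exact: measurable_geosum.
under eq_integral do rewrite gee0_abs//.
apply: (@le_lt_trans _ _ 2%:E); last exact: ltry.
rewrite integral_nneseries//; last by move=> j; exact: meas_term.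
apply: lime_le.
  by apply: is_cvg_nneseries => j _ _; apply: integral_ge0 => t _; exact: geo0.
apply: nearW => k.
apply: (@le_trans _ _ (\sum_(0 <= j < k) (2^-1 ^+ j)%:E)%E).
  apply: lee_sum => j _; under eq_integral do rewrite EFinM.
  rewrite ge0_integralZl//; try exact: cmeas_sqmod;
    try (by move=> t _; rewrite lee_fin sqmod_ge0); try by rewrite lee_fin exprn_ge0.
  apply: (@le_trans _ _ ((4 ^+ j)%:E * (8^-1 ^+ j)%:E)%E).
    by apply: lee_wpmul2l; [rewrite lee_fin exprn_ge0|exact: hF].
  rewrite -EFinM lee_fin -exprMn le_eqVlt; apply/orP; left; apply/eqP.
  by congr (_ ^+ _); field.
rewrite sumEFin lee_fin big_mkord.
have -> : \sum_(i < k) (2^-1 : R) ^+ i = 2 - 2 * 2^-1 ^+ k.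
  elim: k => [|k IH]; first by rewrite big_ord0 expr0; ring.
  by rewrite big_ord_recr/= IH exprS; field.
by rewrite lerBlDr lerDl mulr_ge0// exprn_ge0// invr_ge0.
Qed.

Lemma ae_normc_geometric D F : measurable D -> (forall j, cmeas D (F j)) ->
  (forall j, sqint mu D (F j) <= (8^-1 ^+ j)%:E)%E ->
  {ae mu, forall t, D t -> exists2 A : R, 0 <= A & forall j, normc (F j t) <= A * 2^-1 ^+ j}.
Proof.
move=> mD mF hF; apply: filterS (geosum_ae mD mF hF) => t h Dt.
exact/geosum_bound/h.
Qed.

Lemma geometric_small (A e : R) : 0 <= A -> 0 < e -> \forall j \near \oo, A * 2^-1 ^+ j <= e.
Proof.
move=> A0 e0.
have : (fun j => A * 2^-1 ^+ j : R) @ \oo --> (A * 0 : R).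
  apply: cvgMr; apply: cvg_expr; rewrite ger0_norm ?invr_ge0//; lra.
rewrite mulr0 => /cvgrPdist_le /(_ e e0); apply: filterS => j /=.
by rewrite sub0r normrN ger0_norm// mulr_ge0// exprn_ge0// invr_ge0.
Qed.

Lemma geometric_cauchy (u : nat -> R[i]) (A : R) : 0 <= A ->
  (forall j, normc (u j.+1 - u j) <= A * 2^-1 ^+ j) ->
  exists l : R[i], forall j, normc (u j - l) <= 2 * A * 2^-1 ^+ j.
Proof.
move=> A0 hu.
(* The subtracted term makes the induction work: from k to k + 1 it decreases by exactly A 2^-(j +
   k). *)
have step j k : normc (u (j + k)%N - u j) <= 2 * A * 2^-1 ^+ j - 2 * A * 2^-1 ^+ (j + k).
  elim: k => [|k IH]; first by rewrite addn0 !subrr Normc.normc0.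
  rewrite addnS; have := normcD (u (j + k).+1 - u (j + k)%N) (u (j + k)%N - u j).
  rewrite addrA subrK => h; apply: le_trans h _; have := hu (j + k)%N.
  have -> : 2^-1 ^+ (j + k).+1 = 2^-1 ^+ (j + k) / 2 :> R by rewrite exprS mulrC.
  by lra.
have p0 j : 0 <= 2 * A * 2^-1 ^+ j by rewrite !mulr_ge0// exprn_ge0// invr_ge0.
have stepj j i : (j <= i)%N -> normc (u i - u j) <= 2 * A * 2^-1 ^+ j.
  by move=> /subnKC <-; apply: le_trans (step j _) _; rewrite lerBlDr lerDl.
have [G [GU Goo]] := @ultraFilterLemma _ (\oo : set_system nat) _.
have [|l Hl] := @ultra_bounded_cvg _ _ G u (2 * A + normc (u 0%N)) _ _.
  move=> i; have := normcD (u i - u 0%N) (u 0%N); rewrite subrK => h.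
  by apply: le_trans h _; rewrite lerD2r; have := stepj 0%N i (leq0n _); rewrite expr0 mulr1.
exists l => j; rewrite normc_distC.
apply: (@lim_normc_le _ _ G (fun i => u i - u j)).
  move=> e e0; apply: filterS (Hl e e0) => i.
  by rewrite (_ : u i - u j - (l - u j) = u i - l)//; ring.
by apply: Goo; exists j => // i; exact: stepj.
Qed.

(** The Riesz-Fischer argument for a sequence whose differences are summable fast enough for almost
    everywhere convergence. *)
Lemma L2_complete D F : measurable D -> (forall j, cmeas setT (F j)) ->
  (forall j, sqint mu D (fun t => F j.+1 t - F j t)%R <= (8^-1 ^+ j)%:E)%E ->
  exists2 G, cmeas setT G & {ae mu, forall t, D t ->
    forall e : R, 0 < e -> \forall j \near \oo, normc (F j t - G t) <= e}.
Proof.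
move=> mD mF hF; pose dF j t := F j.+1 t - F j t.
have mdF j : cmeas setT (dF j).
  have [m1 m2] := mF j; have [m3 m4] := mF j.+1.
  split; [under eq_fun do rewrite /dF ReD ReN|under eq_fun do rewrite /dF ImD ImN];
    exact: measurable_funB.
have mU := measurable_geosum mdF.
pose E := [set t | geosum dF t \is a fin_num].
have mE : measurable E.
  by rewrite -[E]setTI; apply: emeasurable_fin_num.
(* Cutting off outside E makes the sequence converge everywhere on the space, so its limit G is
   measurable on the whole space. *)
pose F' j t := (\1_E t)%:C%C * F j t.
have mF' j : cmeas setT (F' j).
  apply: cmeasM => //; split; last exact: measurable_cst.
  exact: measurable_indic.
have lim t : exists l, forall e : R, 0 < e -> \forall j \near \oo, normc (F' j t - l) <= e.
  have [Et|Et] := pselect (E t); last first.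
    exists 0 => e e0; apply: nearW => j.
    by rewrite /F' indicE memNset// mul0r subr0 Normc.normc0 ltW.
  have [A A0 HA] := geosum_bound Et.
  have [l Hl] := geometric_cauchy A0 HA.
  exists l => e e0; apply: filterS (geometric_small (mulr_ge0 (ler0n _ 2) A0) e0) => j.
  by rewrite /F' indicE mem_set// mul1r; exact: le_trans (Hl j).
have [G HG] := choice lim; exists G.
  split; [apply: (@measurable_fun_cvg _ _ _ _ (fun j t => complex.Re (F' j t)))
         |apply: (@measurable_fun_cvg _ _ _ _ (fun j t => complex.Im (F' j t)))].
  - by move=> j; have [] := mF' j.
  - move=> t _; apply/cvgrPdist_le => e e0; apply: filterS (HG t e e0) => j h.
    by rewrite distrC -ReN -ReD; exact: le_trans (normc_geRe _) h.
  - by move=> j; have [] := mF' j.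
  - move=> t _; apply/cvgrPdist_le => e e0; apply: filterS (HG t e e0) => j h.
    by rewrite distrC -ImN -ImD; exact: le_trans (normc_geIm _) h.
have := geosum_ae mD (fun j => cmeasT D (mdF j)) hF.
apply: filterS => t Et Dt e e0; apply: filterS (HG t e e0) => j.
by rewrite /F' indicE mem_set ?mul1r//; exact: Et.
Qed.

End geometric_convergence.

(** * Left limits at radius 1 and auxiliary limit facts *)

Section limits.
Variable R : realType.

Lemma left1_nearP (P : R -> Prop) : (\forall r \near (1 : R)^'-, P r) <->
  exists2 r0, 0 < r0 < 1 & forall r, r0 <= r < 1 -> P r.
Proof.
split=> [/nbhs_ballP[e /= e0 He]|[r0 /andP[r00 r01] Hr]].
  exists (Num.max 2^-1 (1 - e / 2)).
    by rewrite lt_max gt_max invr_gt0 ltr0n/= gtrBl divr_gt0// andbT invf_lt1// ltr1n.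
  move=> r /andP[]; rewrite ge_max => /andP[_ h] r1; apply: He => //.
  by rewrite /ball /= ger0_norm ?subr_ge0 ?(ltW r1)//; lra.
apply/nbhs_ballP; exists (1 - r0); first by rewrite /= subr_gt0.
move=> r /=; rewrite /ball /= => h r1; apply: Hr; rewrite r1 andbT.
by move: h; rewrite ger0_norm ?subr_ge0 ?(ltW r1)//; lra.
Qed.

Lemma ereal_left1_cvg0P (u : R -> \bar R) : (forall r, 0 <= u r)%E ->
  (u r @[r --> (1 : R)^'-] --> 0%E) <->
  forall e, 0 < e -> exists2 r0, 0 < r0 < 1 & forall r, r0 <= r < 1 -> (u r <= e%:E)%E.
Proof.
move=> u0; split=> [/fine_cvgP[fin /cvgrPdist_le h] e e0|h].
  have /left1_nearP[r0 r01 H] : \forall r \near (1 : R)^'-, (u r <= e%:E)%E.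
    apply: filterS2 fin (h e e0) => r /= fr; rewrite sub0r normrN.
    by rewrite ger0_norm ?fine_ge0// -lee_fin fineK.
  by exists r0.
apply/fine_cvgP; split.
  apply/left1_nearP; have [r0 r01 H] := h 1 ltr01; exists r0 => // r hr.
  by rewrite ge0_fin_numE//; apply: le_lt_trans (H r hr) (ltry _).
apply/cvgrPdist_le => e e0; apply/left1_nearP.
have [r0 r01 H] := h e e0; exists r0 => // r hr /=.
rewrite sub0r normrN ger0_norm ?fine_ge0// -lee_fin fineK ?H//.
by rewrite ge0_fin_numE//; apply: le_lt_trans (H r hr) (ltry _).
Qed.

Lemma common_threshold (P Q : R -> Prop) :
  (exists2 r0, 0 < r0 < 1 & forall r, r0 <= r < 1 -> P r) ->
  (exists2 r0, 0 < r0 < 1 & forall r, r0 <= r < 1 -> Q r) ->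
  exists2 r0, 0 < r0 < 1 & forall r, r0 <= r < 1 -> P r /\ Q r.
Proof. by move=> /left1_nearP p /left1_nearP q; apply/left1_nearP/filterI. Qed.

End limits.

Section almost_everywhere.
Context d (T : measurableType d) (R : realType) (mu : {measure set T -> \bar R}).
Variables (D : set T) (mD : measurable D).

Lemma fatou_sqint_ae (F : nat -> T -> R[i]) (G : T -> R[i]) (K : \bar R) :
  (forall j, cmeas D (F j)) -> cmeas D G ->
  {ae mu, forall t, D t -> forall e : R, 0 < e -> \forall j \near \oo, normc (F j t - G t) <= e} ->
  (forall j, sqint mu D (F j) <= K)%E -> (sqint mu D G <= K)%E.
Proof.
move=> mF mG [N [mN N0 HN]] hK.
have cut (F0 : T -> R[i]) : cmeas D F0 -> sqint mu D F0 = sqint mu (D `\` N) F0.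
  move=> mF0; apply: ge0_negligible_integral => //; first exact: cmeas_sqmod.
  by move=> t _; rewrite lee_fin sqmod_ge0.
have mDN : measurable (D `\` N) by exact: measurableD.
have sub F0 : cmeas D F0 -> cmeas (D `\` N) F0.
  by move=> [m1 m2]; split; apply: measurable_funS mD _ _ => //; exact: subDsetl.
rewrite cut//; apply: (@fatou_sqint _ _ _ mu _ mDN F) => [j|t [Dt Nt]|j].
- exact: sub.
- by apply: contrapT => h; apply: Nt; apply: HN => /= /(_ Dt).
- by rewrite -cut.
Qed.

Lemma sqnm_eps (F G : T -> R[i]) e : 0 < e -> L2 mu D F -> L2 mu D G ->
  sqnm mu D F <= (1 + e) * sqnm mu D G +
    (1 + e^-1) * sqnm mu D (fun t => F t + (-1) * G t).
Proof.
move=> e0 LF LG; have LD := L2_lin mD (-1) LF LG.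
set Dl := (fun t => _) in LD *.
have -> : F = (fun t => G t + 1 * Dl t) by apply/funext => t; rewrite /Dl; ring.
have h1 := sqnmD mD 1 LG LD; rewrite {}h1.
(* The squared norm of Dl - e G being nonnegative bounds the cross term by e |G|^2 + |Dl|^2 / e. *)
have := sqnm_ge0 mu D (fun t => Dl t + (- e%:C%C) * G t).
rewrite sqnmD// (ip_conj mD LG LD); move: (ip mu D G Dl) => [A B].
rewrite sqmodN sqmod_real sqmod1 !(ReN, ImN, Re_conj, Im_conj) /=.
move: (sqnm _ _ Dl) (sqnm _ _ G) => X Y h.
have : 2 * A <= e * Y + e^-1 * X.
  rewrite -(ler_pM2l e0) [leRHS]mulrDr [e * (e^-1 * X)]mulrA divff ?gt_eqF// mul1r.
  by rewrite expr2 in h; lra.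
by lra.
Qed.

Lemma Re_ipE (F G : T -> R[i]) : L2 mu D F -> L2 mu D G ->
  2 * complex.Re (ip mu D F G) =
  sqnm mu D (fun t => F t + 1 * G t) - sqnm mu D F - sqnm mu D G.
Proof.
move=> LF LG; rewrite sqnmD//; move: (ip _ _ _ _) => [A B]; rewrite sqmod1 /=.
by move: (sqnm _ _ F) (sqnm _ _ G) => X Y; lra.
Qed.

End almost_everywhere.

Section sequences.
Variable R : realType.
Local Notation C := R[i].
Implicit Types (u v : nat -> C) (l m : C).

Definition tends_to u l := forall e : R, 0 < e -> \forall j \near \oo, normc (u j - l) <= e.

Lemma tends_to_cst l : tends_to (fun=> l) l.
Proof. by move=> e e0; apply: nearW => j; rewrite subrr Normc.normc0 ltW. Qed.

Lemma tends_toD u v l m : tends_to u l -> tends_to v m -> tends_to (fun j => u j + v j) (l + m).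
Proof.
move=> hu hv e e0; have e2 : 0 < e / 2 by rewrite divr_gt0.
apply: filterS2 (hu _ e2) (hv _ e2) => j h1 h2.
rewrite (_ : _ - _ = (u j - l) + (v j - m)); last by ring.
by apply: le_trans (normcD _ _) _; lra.
Qed.

Lemma tends_toM u v l m : tends_to u l -> tends_to v m -> tends_to (fun j => u j * v j) (l * m).
Proof.
move=> hu hv e e0; have l0 := normc_ge0 l; have m0 := normc_ge0 m.
pose s := 1 + normc l + normc m; have s0 : 0 < s by rewrite /s; lra.
pose d := Num.min 1 (e / s).
have d0 : 0 < d by rewrite lt_min ltr01 divr_gt0.
have d1 : d <= 1 by rewrite ge_min lexx.
have de : d * s <= e by rewrite -ler_pdivlMr// ge_min lexx orbT.
apply: filterS2 (hu _ d0) (hv _ d0) => j h1 h2.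
rewrite (_ : _ - _ = (u j - l) * (v j - m) + l * (v j - m) + (u j - l) * m); last by ring.
apply: le_trans (normcD _ _) _; have := normcD ((u j - l) * (v j - m)) (l * (v j - m)).
rewrite !Normc.normcM => h3.
have a1 := normc_ge0 (u j - l); have a2 := normc_ge0 (v j - m).
have b1 : normc (u j - l) * normc (v j - m) <= d * 1 by apply: ler_pM => //; lra.
have b2 : normc l * normc (v j - m) <= normc l * d by apply: ler_wpM2l.
have b3 : normc (u j - l) * normc m <= d * normc m by apply: ler_wpM2r.
apply: le_trans de; rewrite /s; lra.
Qed.

Lemma tends_to_unique u l m : tends_to u l -> tends_to u m -> l = m.
Proof. exact: ultra_lim_unique. Qed.

(** The running maximum of thresholds that need not be monotone. It need not tend to 1: beyond its
    j-th threshold a function is already determined up to the j-th error. *)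
Lemma dominating_sequence (rr : nat -> R) : (forall j, 0 < rr j < 1) ->
  exists2 rho : nat -> R, forall j, 0 < rho j < 1 & forall i j, (i <= j)%N -> rr i <= rho j.
Proof.
move=> h; exists (fun j => \big[Num.max/0]_(i < j.+1) rr i).
  move=> j; apply/andP; split.
    have := @le_bigmax _ _ 'I_j.+1 0 (fun i => rr i) ord0.
    by apply: lt_le_trans; case/andP: (h 0%N).
  by apply: bigmax_lt => // i _; case/andP: (h i).
move=> i j ij; have ij' : (i < j.+1)%N by [].
exact: (@le_bigmax _ _ 'I_j.+1 0 (fun i => rr i) (Ordinal ij')).
Qed.

End sequences.

(** * Dilates and boundary values of Hardy functions *)

Section hardy_space.
Variables (R : realType) (n : nat).
Local Notation C := R[i].
Local Notation vec := 'rV[R[i]]_n.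
Local Notation coords := (n.-tuple (plane R)).
Local Notation S := (@coord_sphere R n).
Local Notation sg := (sphere_measure R n).
Local Notation H2 := (fs_mem (hardy R n)).
Local Notation bv := (@boundary_value R n).
Let mS := @measurable_coord_sphere R n.
Implicit Types (f g : vec -> C) (t : coords) (z : vec) (r s : R).

Let W r : 0 < r < 1 -> 0 <= r < 1. Proof. by case/andP => /ltW -> ->. Qed.

Lemma hardyP f : H2 f <-> holomorphic f /\
  exists B : R, forall r, 0 < r < 1 -> (dilnorm f r <= B%:E)%E.
Proof.
by split=> -[hf [B HB]]; split => //; exists B => r r01; have := HB r r01; rewrite dilnormE// W.
Qed.

Lemma hardy_hol f : H2 f -> holomorphic f. Proof. by case. Qed.

Lemma L2_dil f r : H2 f -> 0 < r < 1 -> L2 sg S (dil f r).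
Proof.
move=> /hardyP[hf [B HB]] r01; split; first exact/cmeasT/cmeas_dil.
exact: le_lt_trans (HB r r01) (ltry _).
Qed.

Definition dilsq f r : R := sqnm sg S (dil f r).

Lemma dilnorm_fin f r : H2 f -> 0 < r < 1 -> dilnorm f r = (dilsq f r)%:E.
Proof. by move=> mf r01; exact/sqintE/L2_dil. Qed.

Lemma dilsq_bounded f : H2 f -> exists2 B : R, 0 <= B & forall r, 0 < r < 1 -> dilsq f r <= B.
Proof.
move=> mf; have [hf [B HB]] := (hardyP f).1 mf; exists (Num.max 0 B); first by rewrite le_max lexx.
move=> r r01; have := HB r r01; rewrite dilnorm_fin// lee_fin => h.
by rewrite le_max h orbT.
Qed.

Lemma dilsq_homo f r s : H2 f -> 0 < r -> r <= s -> s < 1 -> dilsq f r <= dilsq f s.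
Proof.
move=> mf r0 rs s1; rewrite -lee_fin -!dilnorm_fin ?r0 ?(le_lt_trans rs)//.
  exact: dilnorm_homo (hardy_hol mf) r0 rs s1.
by rewrite (lt_le_trans r0 rs).
Qed.

Lemma Re_pairing f g r s r' s' : H2 f -> H2 g ->
  0 < r < 1 -> 0 < s < 1 -> 0 < r' < 1 -> 0 < s' < 1 -> r * s = r' * s' ->
  complex.Re (ip sg S (dil f r) (dil g s)) = complex.Re (ip sg S (dil f r') (dil g s')).
Proof.
move=> mf mg r01 s01 r01' s01' E.
have Lf x : 0 < x < 1 -> L2 sg S (dil f x) by exact: L2_dil.
have Lg x : 0 < x < 1 -> L2 sg S (dil g x) by exact: L2_dil.
have e x y (x01 : 0 < x < 1) (y01 : 0 < y < 1) :
    sqint sg S (fun t => dil f x t + dil g y t) =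
    (sqnm sg S (fun t => dil f x t + 1 * dil g y t))%:E.
  rewrite -(sqintE (L2_lin mS 1 (Lf x x01) (Lg y y01))).
  by congr sqint; apply/funext => t; rewrite mul1r.
have := dil_pairing (hardy_hol mf) (hardy_hol mg) r01 s01 r01' s01' E.
rewrite (e r s r01 s01) (e r' s' r01' s01') !dilnorm_fin// -!EFinD => -[h].
have h1 := Re_ipE mS (Lf r r01) (Lg s s01).
have h2 := Re_ipE mS (Lf r' r01') (Lg s' s01').
move: h h1 h2; rewrite /dilsq; move: (complex.Re _) (complex.Re _) => A B.
move: (sqnm _ _ (fun t => _)) (sqnm _ _ (fun t => dil f r' t + _)) => X Y.
by move: (sqnm _ _ _) (sqnm _ _ _) (sqnm _ _ _) (sqnm _ _ _) => ? ? ? ?; lra.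
Qed.

Lemma dil_dist f r s p : H2 f -> 0 < r < 1 -> 0 < s < 1 -> 0 < p < 1 -> r * s = p * p ->
  sqnm sg S (fun t => dil f r t + (-1) * dil f s t) = dilsq f r + dilsq f s - 2 * dilsq f p.
Proof.
move=> mf r01 s01 p01 E; rewrite (sqnmD mS)//; try exact: L2_dil.
have := Re_pairing mf mf r01 s01 p01 p01 E; rewrite ip_self// -/(dilsq f p).
move: (ip _ _ _ _) => [A B] /= ->; rewrite sqmodN sqmod1 -/(dilsq f r) -/(dilsq f s).
by rewrite ?oppr0 /=; ring.
Qed.

(** Beyond r0 the increasing function [dilsq f] is within e / 2 of its supremum. The geometric mean
    p of r and s is beyond r0 as well, so N(r) + N(s) - 2 N(p) <= e. *)
Lemma dil_cauchy f e : H2 f -> 0 < e -> exists2 r0, 0 < r0 < 1 &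
  forall r s, r0 <= r < 1 -> r0 <= s < 1 ->
    sqnm sg S (fun t => dil f r t + (-1) * dil f s t) <= e.
Proof.
move=> mf e0; have [B B0 HB] := dilsq_bounded mf.
pose E := [set dilsq f r | r in [set r | 0 < r < 1]].
have h2 : 0 < (2^-1 : R) < 1 by rewrite invr_gt0 ltr0n/= invf_lt1// ltr1n.
have ubE : has_ubound E by exists B => _ [r r01 <-]; exact: HB.
have supE : has_sup E by split => //; exists (dilsq f 2^-1), 2^-1.
have e2 : 0 < e / 2 by rewrite divr_gt0.
have [_ [r0 r01 <-] hr0] := sup_adherent e2 supE.
exists r0 => // r s /andP[rr r1] /andP[ss s1].
have [r00 _] := andP r01.
have r_01 : 0 < r < 1 by rewrite (lt_le_trans r00 rr).
have s_01 : 0 < s < 1 by rewrite (lt_le_trans r00 ss).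
have [rp _] := andP r_01; have [sp _] := andP s_01.
pose p := Num.sqrt (r * s).
have pp : r * s = p * p by rewrite -expr2 sqr_sqrtr// mulr_ge0// ltW.
have p0 : 0 < p by rewrite sqrtr_gt0 mulr_gt0.
have p1 : p < 1.
  rewrite -ltr_sqr ?nnegrE ?(ltW p0)// expr1n expr2 -pp.
  by rewrite mulr_ilt1// ltW.
have pr0 : r0 <= p.
  rewrite -ler_sqr ?nnegrE ?(ltW p0) ?(ltW r00)// !expr2 -pp.
  by apply: ler_pM => //; exact: ltW.
have p01 : 0 < p < 1 by rewrite p0.
rewrite (dil_dist mf r_01 s_01 p01 pp).
have := dilsq_homo mf r00 pr0 p1.
have /(_ (dilsq f r)) hr := ub_le_sup ubE; have {}hr := hr (ex_intro2 _ _ r r_01 erefl).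
have /(_ (dilsq f s)) hs := ub_le_sup ubE; have {}hs := hs (ex_intro2 _ _ s s_01 erefl).
by lra.
Qed.

Lemma boundary_valueP f (g : coords -> C) : is_boundary_value f g <->
  cmeas setT g /\ forall e, 0 < e -> exists2 r0, 0 < r0 < 1 &
    forall r, r0 <= r < 1 -> (sqint sg S (fun t => dil f r t + (-1) * g t)%R <= e%:E)%E.
Proof.
pose u r := (\int[sg]_(t in S) (sqmod (f (r%:C%C *: complex_point t) - g t))%:E)%E.
have u0 r : (0 <= u r)%E by apply: integral_ge0 => t _; rewrite lee_fin sqmod_ge0.
have uE r : 0 <= r < 1 -> u r = sqint sg S (fun t => dil f r t + (-1) * g t).
  by move=> r01; apply: eq_integral => t /set_mem St; rewrite dilE// mulN1r.
have le01 (r0 r : R) : 0 < r0 < 1 -> r0 <= r < 1 -> 0 <= r < 1.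
  by move=> /andP[a _] /andP[b ->]; rewrite (le_trans (ltW a) b).
split=> [[m1 m2 /(ereal_left1_cvg0P u0) h]|[[m1 m2] h]].
  split => // e /h[r0 r01 H]; exists r0 => // r hr.
  by rewrite -uE ?H//; exact: le01 hr.
split => //; apply/(ereal_left1_cvg0P u0) => e /h[r0 r01 H]; exists r0 => // r hr.
by rewrite uE ?H//; exact: le01 hr.
Qed.

(** The dilates along rho converge almost everywhere to some G. Fatou's lemma, applied along rho
    with r fixed, turns the Cauchy estimate into convergence in norm of all dilates to G. *)
Lemma boundary_value_exists f : H2 f -> exists g : coords -> C, is_boundary_value f g.
Proof.
move=> mf; have hf := hardy_hol mf.
have h8 j : 0 < (8^-1 : R) ^+ j by rewrite exprn_gt0// invr_gt0.
have ex j : exists r0, 0 < r0 < 1 /\ forall r s, r0 <= r < 1 -> r0 <= s < 1 ->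
    sqnm sg S (fun t => dil f r t + (-1) * dil f s t) <= 8^-1 ^+ j.
  by have [r0 ? ?] := dil_cauchy mf (h8 j); exists r0.
have [rr Hrr] := choice ex.
have rr01 j : 0 < rr j < 1 by have [] := Hrr j.
have [rho rho01 rhoge] := dominating_sequence rr01.
have rho1 i j : (i <= j)%N -> rr i <= rho j < 1.
  by move=> ij; rewrite rhoge//; case/andP: (rho01 j).
have LD r s : 0 < r < 1 -> 0 < s < 1 -> L2 sg S (fun t => dil f r t + (-1) * dil f s t).
  by move=> r01 s01; apply: L2_lin => //; exact: L2_dil.
have [|G mG HG] := @L2_complete _ _ _ sg S (fun j => dil f (rho j)) mS (fun j => cmeas_dil _ hf).
  move=> j; rewrite (_ : (fun t => _) = (fun t => dil f (rho j.+1) t + (-1) * dil f (rho j) t)).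
    rewrite (sqintE (LD _ _ (rho01 _) (rho01 _))) lee_fin.
    by have [_] := Hrr j; apply; exact: rho1.
  by apply/funext => t; rewrite mulN1r.
exists G; apply/boundary_valueP; split => // e e0.
have [j Hj] : exists j, (8^-1 : R) ^+ j <= e.
  have [J _ HJ] := geometric_small ler01 e0; exists J; apply: le_trans (HJ J (leqnn J)).
  by rewrite mul1r; apply: lerXn2r; rewrite ?nnegrE ?invr_ge0// lef_pV2 ?posrE// ler_nat.
exists (rr j) => // r hr.
have r01 : 0 < r < 1.
  by case/andP: hr => h ->; case/andP: (rr01 j) => h' _; rewrite (lt_le_trans h' h).
apply: (@fatou_sqint_ae _ _ _ sg _ mS (fun i t => dil f r t + (-1) * dil f (rho (j + i)%N) t)).
- by move=> i; have [] := LD r (rho (j + i)%N) r01 (rho01 _).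
- by apply: cmeas_lin; [exact/cmeasT/cmeas_dil|exact: cmeasT].
- apply: filterS HG => t Ht St d d0.
  have [J _ HJ] := Ht St d d0; exists J => // i /= Ji.
  rewrite (_ : _ - _ = G t - dil f (rho (j + i)%N) t); last by ring.
  by rewrite normc_distC; apply: HJ => /=; rewrite (leq_trans Ji)// leq_addl.
- move=> i; rewrite (sqintE (LD _ _ r01 (rho01 _))) lee_fin; apply: le_trans Hj.
  by have [_] := Hrr j; apply => //; exact: rho1 (leq_addr _ _).
Qed.

Lemma bvP f : H2 f -> cmeas setT (bv f) /\ forall e, 0 < e -> exists2 r0, 0 < r0 < 1 &
  forall r, r0 <= r < 1 -> (sqint sg S (fun t => dil f r t + (-1) * bv f t)%R <= e%:E)%E.
Proof.
move=> /boundary_value_exists ex; apply/boundary_valueP.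
exact: (@xgetPex _ _ [set g | is_boundary_value f g]).
Qed.

Lemma L2_bv f : H2 f -> L2 sg S (bv f).
Proof.
move=> mf; have [mb Hb] := bvP mf; have [r0 r01 H] := Hb 1 ltr01.
have Ld := L2_dil mf r01; have [md _] := Ld.
have LD : L2 sg S (fun t => dil f r0 t + (-1) * bv f t).
  split; first by apply: cmeas_lin => //; exact: cmeasT.
  by apply: le_lt_trans (H r0 _) (ltry _); case/andP: r01 => _ ->; rewrite lexx.
have := L2_lin mS (-1) Ld LD.
rewrite (_ : (fun t => _) = bv f)//; apply/funext => t; ring.
Qed.

(* An L^2 limit is attained almost everywhere along a sequence; the sequence can be
   chosen for three functions at once. *)
Lemma bv_common f g h : H2 f -> H2 g -> H2 h ->
  exists2 rho : nat -> R, forall j, 0 < rho j < 1 &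
  {ae sg, forall t, S t -> [/\ tends_to (fun j => dil f (rho j) t) (bv f t),
    tends_to (fun j => dil g (rho j) t) (bv g t) &
    tends_to (fun j => dil h (rho j) t) (bv h t)]}.
Proof.
move=> mf mg mh.
pose near f0 j r := (sqint sg S (fun t => dil f0 r t + (-1) * bv f0 t)%R <= (8^-1 ^+ j)%:E)%E.
have h8 j : 0 < (8^-1 : R) ^+ j by rewrite exprn_gt0// invr_gt0.
have ex j : exists r, 0 < r < 1 /\ (near f j r /\ (near g j r /\ near h j r)).
  have [_ /(_ _ (h8 j)) Hf] := bvP mf; have [_ /(_ _ (h8 j)) Hg] := bvP mg.
  have [_ /(_ _ (h8 j)) Hh] := bvP mh.
  have [r0 r01 H] := common_threshold Hf (common_threshold Hg Hh).
  by exists r0; split => //; apply: H; case/andP: r01 => _ ->; rewrite lexx.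
have [rho Hrho] := choice ex; exists rho; first by move=> j; have [] := Hrho j.
have aux f0 : H2 f0 -> (forall j, near f0 j (rho j)) ->
    {ae sg, forall t, S t -> tends_to (fun j => dil f0 (rho j) t) (bv f0 t)}.
  move=> m0 H0; have [mb _] := bvP m0.
  have mm j : cmeas S (fun t => dil f0 (rho j) t + (-1) * bv f0 t).
    by apply: cmeas_lin; [apply/cmeasT/cmeas_dil; exact: hardy_hol|exact: cmeasT].
  apply: filterS (ae_normc_geometric mS mm H0) => t Ht St e e0.
  have [A A0 HA] := Ht St; apply: filterS (geometric_small A0 e0) => j.
  by apply: le_trans; have := HA j; rewrite mulN1r.
have Af := aux f mf (fun j => (Hrho j).2.1).
have Ag := aux g mg (fun j => (Hrho j).2.2.1).
have Ah := aux h mh (fun j => (Hrho j).2.2.2).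
by apply: filterS3 Af Ag Ah => t h1 h2 h3 St; split; [exact: h1|exact: h2|exact: h3].
Qed.

End hardy_space.

(** * The Hardy space as a Hilbert space of holomorphic functions *)

Section hardy_model.
Variables (R : realType) (n : nat).
Local Notation C := R[i].
Local Notation vec := 'rV[R[i]]_n.
Local Notation coords := (n.-tuple (plane R)).
Local Notation S := (@coord_sphere R n).
Local Notation sg := (sphere_measure R n).
Local Notation H2 := (fs_mem (hardy R n)).
Local Notation bv := (@boundary_value R n).
Local Notation bsq f := (sqnm sg S (bv f)).
Let mS := @measurable_coord_sphere R n.
Implicit Types (f g : vec -> C) (t : coords) (z : vec) (r s : R) (c : C).

Let W r : 0 < r < 1 -> 0 <= r < 1. Proof. by case/andP => /ltW -> ->. Qed.

Lemma dil_linE f g c r :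
  dil (fun z => f z + c * g z) r = (fun t => dil f r t + c * dil g r t).
Proof. by apply/funext => t; rewrite /dil /fhat; case: ifP => // _; rewrite mulr0 addr0. Qed.

Lemma dil_mulE f g r : dil (fun z => f z * g z) r = (fun t => dil f r t * dil g r t).
Proof. by apply/funext => t; rewrite /dil /fhat; case: ifP => // _; rewrite mulr0. Qed.

Lemma hardy_lin f g c : H2 f -> H2 g -> H2 (fun z => f z + c * g z).
Proof.
move=> mf mg; have hf := hardy_hol mf; have hg := hardy_hol mg.
have [Bf Bf0 HBf] := dilsq_bounded mf; have [Bg Bg0 HBg] := dilsq_bounded mg.
apply/hardyP; split; first exact: holomorphic_lin.
exists (2 * Bf + 2 * sqmod c * Bg) => r r01; rewrite /dilnorm dil_linE.
apply: le_trans (@sqint_lin_le _ _ _ sg _ mS _ _ c _ _) _; try exact/cmeasT/cmeas_dil.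
rewrite -!/(dilnorm _ _) !dilnorm_fin// -!EFinM -EFinD lee_fin.
apply: lerD; apply: ler_wpM2l => //; [exact: HBf|by rewrite mulr_ge0 ?sqmod_ge0|exact: HBg].
Qed.

Lemma dil_bounded f r (K : R) t : (forall z, unit_ball z -> sqmod (f z) <= K) ->
  S t -> 0 < r < 1 -> sqmod (dil f r t) <= K.
Proof.
move=> HK St r01; rewrite dilE ?W//; apply: HK; apply/unit_ballE.
by apply: dil_ball => //; exact: W.
Qed.

Lemma hardy_Hinfty f : Hinfty f -> H2 f.
Proof.
move=> [hf [B HB]]; apply/hardyP; split => //; exists (B ^+ 2) => r r01.
have HB2 z : unit_ball z -> sqmod (f z) <= B ^+ 2.
  move=> bz; have h := HB z bz.
  by rewrite /sqmod ler_sqr ?nnegrE ?normc_ge0// (le_trans (normc_ge0 _) h).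
apply: (@le_trans _ _ (\int[sg]_(t in S) ((B ^+ 2)%:E * 1))%E).
  apply: ge0_le_integral => //.
  - by move=> t _; rewrite lee_fin sqmod_ge0.
  - by apply: cmeas_sqmod; exact/cmeasT/cmeas_dil.
  - by move=> t St; rewrite mule1 lee_fin; exact: dil_bounded.
rewrite ge0_integralZl// ?lee_fin ?sqr_ge0//.
rewrite -[leRHS]mule1; apply: lee_wpmul2l; first by rewrite lee_fin sqr_ge0.
exact: sphere_measure_le1.
Qed.

Lemma bv_lin f g c : H2 f -> H2 g ->
  ae_eq sg S (bv (fun z => f z + c * g z)) (fun t => bv f t + c * bv g t).
Proof.
move=> mf mg; have [rho r01] := bv_common mf mg (hardy_lin c mf mg).
apply: filterS => t ht St; have [h1 h2 h3] := ht St.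
apply: (tends_to_unique h3); under eq_fun do rewrite dil_linE.
by apply: tends_toD => //; apply: tends_toM => //; exact: tends_to_cst.
Qed.

Lemma bv_bounded f (K : R) : Hinfty f -> (forall z, unit_ball z -> sqmod (f z) <= K) ->
  {ae sg, forall t, S t -> sqmod (bv f t) <= K}.
Proof.
move=> /hardy_Hinfty mf HK; have [rho r01] := bv_common mf mf mf.
apply: filterS => t ht St; have [h1 _ _] := ht St.
have K0 : 0 <= K.
  by apply: le_trans (sqmod_ge0 _) (HK 0 _); apply/unit_ballE; rewrite enorm0 ltr01.
rewrite /sqmod -(sqr_sqrtr K0) ler_sqr ?nnegrE ?normc_ge0 ?sqrtr_ge0//.
apply: (@lim_normc_le _ _ (\oo : set_system nat) _ _ _ _ h1); apply: nearW => j.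
by rewrite sqmod_normc; apply: ler_wsqrtr; exact: dil_bounded.
Qed.

Lemma dilsq_cvg f e : H2 f -> 0 < e -> exists2 r0, 0 < r0 < 1 &
  forall r, r0 <= r < 1 -> `|dilsq f r - bsq f| <= e.
Proof.
move=> mf e0; have [B B0 HB] := dilsq_bounded mf; have Lb := L2_bv mf.
have q0 := sqnm_ge0 sg S (bv f); pose M := B + bsq f + 1.
have M0 : 0 < M by rewrite /M; lra.
(* In both directions of [sqnm_eps] the relative error contributes at most eta M = e / 2 and the
   distance term at most (1 + 1 / eta) d = e / 2. *)
pose eta := e / (2 * M); have eta0 : 0 < eta by rewrite divr_gt0// mulr_gt0.
have etaM : eta * M = e / 2 by rewrite /eta; field; rewrite gt_eqF.
have ie : 0 < 1 + eta^-1 by rewrite addr_gt0// invr_gt0.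
pose d := (e / 2) / (1 + eta^-1); have d0 : 0 < d by rewrite !divr_gt0.
have de : (1 + eta^-1) * d = e / 2 by rewrite mulrC /d divfK// gt_eqF.
have [_ /(_ d d0)[r0 r01 H]] := bvP mf; exists r0 => // r hr.
have rr : 0 < r < 1 by case/andP: hr => a ->; case/andP: r01 => b _; rewrite (lt_le_trans b a).
have Ld := L2_dil mf rr; have LD := L2_lin mS (-1) Ld Lb.
have := H r hr; rewrite (sqintE LD) lee_fin => hd.
have h1 := sqnm_eps mS eta0 Ld Lb; have h2 := sqnm_eps mS eta0 Lb Ld.
rewrite -/(dilsq f r) in h1 h2.
have eD : sqnm sg S (fun t => bv f t + (-1) * dil f r t) =
          sqnm sg S (fun t => dil f r t + (-1) * bv f t).
  apply: eq_Rintegral => t _; rewrite -[RHS]sqmodN; congr sqmod; ring.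
rewrite eD in h2; have hB := HB r rr.
have hd' := ler_wpM2l (ltW ie) hd; rewrite de in hd'.
have N0 : 0 <= dilsq f r by exact: sqnm_ge0.
have k1 : eta * bsq f <= eta * M by apply: ler_wpM2l; [exact: ltW|rewrite /M; lra].
have k2 : eta * dilsq f r <= eta * M by apply: ler_wpM2l; [exact: ltW|rewrite /M; lra].
rewrite etaM in k1 k2; rewrite mulrDl mul1r in h1; rewrite mulrDl mul1r in h2.
by rewrite ler_norml; apply/andP; split; lra.
Qed.

Lemma dilsq_le f r : H2 f -> 0 < r < 1 -> dilsq f r <= bsq f.
Proof.
move=> mf /andP[r0 r1]; apply/ler_addgt0Pr => e e0.
have [s0 /andP[s00 s01] H] := dilsq_cvg mf e0.
have s1 : Num.max r s0 < 1 by rewrite gt_max r1.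
apply: (@le_trans _ _ (dilsq f (Num.max r s0))).
  by apply: dilsq_homo => //; rewrite le_max lexx.
have := H (Num.max r s0); rewrite s1 le_max lexx orbT => /(_ isT).
by rewrite ler_norml => /andP[]; lra.
Qed.

Lemma bsq_le f (K : R) : H2 f -> (forall r, 0 < r < 1 -> dilsq f r <= K) -> bsq f <= K.
Proof.
move=> mf HK; apply/ler_addgt0Pr => e e0.
have [s0 s01 H] := dilsq_cvg mf e0; have := HK s0 s01.
have := H s0; rewrite lexx/=; have [_ ->] := andP s01 => /(_ isT).
by rewrite ler_norml => /andP[]; lra.
Qed.

Lemma holomorphic_scale f (r : R) : holomorphic f -> 0 <= r <= 1 ->
  holomorphic (fun z => f (r%:C%C *: z)).
Proof.
move=> hf /andP[r0 r1] z bz.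
have bz' : unit_ball (r%:C%C *: z).
  apply/unit_ballE; rewrite enormZ normc_real ger0_norm//.
  have := (unit_ballE z).1 bz; apply: le_lt_trans.
  by rewrite -[leRHS]mul1r; apply: ler_wpM2r => //; exact: enorm_ge0.
apply: (@differentiable_comp _ _ _ _ (fun z : vec => r%:C%C *: z) (f : vec -> R[i]^o)).
  exact: differentiableZ.
exact: hf.
Qed.

(** The Bergman point estimate for z -> f(rho z), whose Bergman norm is at most the mean of |f|^2 on
    the sphere of radius rho. As rho lies strictly between x and 1, the point z / rho stays in a
    fixed smaller ball. *)
Lemma hardy_point (r : R) : (0 < n)%N -> r < 1 -> exists2 K : R, 0 < K & forall f z,
  H2 f -> enorm z <= r -> sqmod (f z) <= K * bsq f.
Proof.
move=> n0 r1; pose x := Num.max r 0; pose rho := (1 + x) / 2.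
have x0 : 0 <= x by rewrite le_max lexx orbT.
have x1 : x < 1 by rewrite gt_max r1 ltr01.
have rho0 : 0 < rho by rewrite /rho; lra.
have rho1 : rho < 1 by rewrite /rho; lra.
have xr : x / rho < 1 by rewrite ltr_pdivrMr// mul1r /rho; lra.
have rho01 : 0 < rho < 1 by rewrite rho0.
have [K [K0 HK]] := @ball_point_bound R n _ xr; exists K => // f z mf zr.
have hf := hardy_hol mf.
have hs : holomorphic (fun z => f (rho%:C%C *: z)).
  by apply: holomorphic_scale => //; rewrite (ltW rho0) (ltW rho1).
have zE : z = rho%:C%C *: ((rho^-1)%:C%C *: z).
  by rewrite scalerA -rmorphM divff ?gt_eqF// scale1r.
have zr' : enorm ((rho^-1)%:C%C *: z) <= x / rho.
  rewrite enormZ normc_real ger0_norm ?invr_ge0 ?(ltW rho0)// mulrC.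
  by apply: ler_wpM2r; [rewrite invr_ge0 ltW|apply: le_trans zr _; rewrite le_max lexx].
have := HK _ _ hs zr'; rewrite -zE => h; rewrite -lee_fin; apply: le_trans h _.
rewrite EFinM; apply: lee_wpmul2l; first by rewrite lee_fin ltW.
apply: (@le_trans _ _ (dilnorm f rho)); last by rewrite dilnorm_fin// lee_fin dilsq_le.
have [mc c0 _] := circular_dil hf (W rho01).
rewrite (_ : (\int[ball_measure R n]_(t in @coord_ball R n) _)%E =
   (\int[ball_measure R n]_(t in @coord_ball R n) (sqmod (dil f rho t))%:E)%E); last first.
  apply: eq_integral => t /set_mem/coord_ballE tb; rewrite /dil fhatE complex_point_scale//.
  rewrite enormZ normc_real gtr0_norm//.
  by rewrite mulr_ilt1 ?(ltW rho0)// enorm_ge0.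
apply: ball_sphere_average_le => //.
- exact/measurable_EFinP.
- exact/measurable_EFinP.
(* In the slice through t the inner circle has radius rho |t| and the outer one rho; mean squares
   grow with the radius. *)
move=> t /coord_ballE tb t0; set y := enorm (complex_point t).
have y0 : 0 < y by rewrite lt_def t0 enorm_ge0.
have Sp : S (radial_proj t) by exact/radial_sphereE.
have ty : complex_point t = y%:C%C *: complex_point (radial_proj t).
  by rewrite radial_projE scalerA -rmorphM divff ?scale1r.
have ry0 : 0 < rho * y by rewrite mulr_gt0.
have ryr : rho * y <= rho by rewrite -[leRHS]mulr1 ler_pM2l// ltW.
have ry01 : 0 <= rho * y < 1 by rewrite (ltW ry0) (le_lt_trans ryr).
have e1 th : (sqmod (dil f rho (crot th t)))%:E =
    (sqmod (slice f (radial_proj t) (circ (rho * y) th)))%:E.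
  have eP : complex_point (cscale rho (crot th t)) =
      circ (rho * y) th *: complex_point (radial_proj t).
    rewrite complex_point_scale complex_point_rot {1}ty !scalerA /circ.
    by rewrite [_ * cis th * _]mulrAC -rmorphM.
  rewrite /dil fhatE eP// enormZ ((coord_sphereE _).1 Sp) mulr1 normc_circ ?(ltW ry0)//.
  by case/andP: ry01.
have e2 th : (sqmod (dil f rho (crot th (radial_proj t))))%:E =
    (sqmod (slice f (radial_proj t) (circ rho th)))%:E.
  by rewrite dil_rot// W.
rewrite (eq_theta_int e1) (eq_theta_int e2); apply: le_theta_int.
- apply: circ_sqmod_ccont; first exact: ltW.
  by move=> w wr; apply: slice_cdiff => //; rewrite wr; case/andP: ry01.
- apply: circ_sqmod_ccont; first exact: ltW.
  by move=> w wr; apply: slice_cdiff => //; rewrite wr.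
- apply: (@cmean_sqmod_homo _ 1) => // w; exact: slice_cdiff.
Qed.

(** Boundary functions need not converge pointwise, so Fatou's lemma is applied to the dilates of
    each radius r < 1, which converge on the whole sphere. *)
Lemma hardy_limit (fs : nat -> vec -> C) f (K : R) : (forall j, H2 (fs j)) ->
  (forall j, bsq (fs j) <= K) -> holomorphic f ->
  (forall z, enorm z < 1 -> tends_to (fs^~ z) (f z)) -> H2 f /\ bsq f <= K.
Proof.
move=> mfs hK hf cv.
have HN r : 0 < r < 1 -> (dilnorm f r <= K%:E)%E.
  move=> r01; apply: (@fatou_sqint _ _ _ sg _ mS (fun j => dil (fs j) r)).
  - by move=> j; apply/cmeasT/cmeas_dil; exact: hardy_hol.
  - move=> t St e e0; have := cv _ (dil_ball St (W r01)) e e0.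
    by apply: filterS => j; rewrite !dilE ?W.
  - move=> j; rewrite -/(dilnorm _ _) dilnorm_fin// lee_fin.
    exact: le_trans (dilsq_le (mfs j) r01) (hK j).
have mf : H2 f by apply/hardyP; split => //; exists K.
split => //; apply: bsq_le => // r r01.
by rewrite -lee_fin -dilnorm_fin// HN.
Qed.

Lemma hardy_model : (0 < n)%N -> hilbert_model (hardy R n).
Proof.
move=> n0; split.
- exact: mS.
- exact: sphere_measure_le1.
- exact: hardy_hol.
- by move=> f g c; exact: hardy_lin.
- by move=> f g c; exact: bv_lin.
- exact: L2_bv.
- by move=> r; exact: hardy_point.
- by move=> fs f K h1 h2 h3 h4; exact: hardy_limit h1 h2 h3 h4.
- exact: hardy_Hinfty.
- by move=> f K; exact: bv_bounded.
Qed.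

End hardy_model.

(** * Dilations and the Hardy kernel *)

Section hardy_kernel.
Variables (R : realType) (n : nat) (n0 : (0 < n)%N).
Local Notation C := R[i].
Local Notation vec := 'rV[R[i]]_n.
Local Notation coords := (n.-tuple (plane R)).
Local Notation S := (@coord_sphere R n).
Local Notation sg := (sphere_measure R n).
Local Notation Hd := (hardy R n).
Local Notation H2 := (fs_mem (hardy R n)).
Local Notation bv := (@boundary_value R n).
Local Notation bsq f := (sqnm sg S (bv f)).
Let mS := @measurable_coord_sphere R n.
Let hm := hardy_model R n0.
Implicit Types (f g k : vec -> C) (t : coords) (z : vec) (r s : R) (c : C).

Definition scaled (rho : R) f z : C := f (rho%:C%C *: z).

Lemma dil_scaled (rho : R) f r t : 0 < rho < 1 -> 0 < r < 1 -> S t ->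
  dil (scaled rho f) r t = dil f (rho * r) t.
Proof.
move=> /andP[p0 p1] /andP[r0 r1] St.
rewrite !dilE ?(ltW r0) ?r1//; first by rewrite /scaled scalerA rmorphM.
by rewrite mulr_ge0 ?(ltW p0) ?(ltW r0)//= mulr_ilt1// ltW.
Qed.

Lemma scaled01 (rho r : R) : 0 < rho < 1 -> 0 < r < 1 -> 0 < rho * r < 1.
Proof.
by move=> /andP[p0 p1] /andP[r0 r1]; rewrite mulr_gt0//= mulr_ilt1// ltW.
Qed.

Lemma hardy_scaled (rho : R) f : 0 < rho < 1 -> H2 f -> H2 (scaled rho f).
Proof.
move=> rho01 /hardyP[hf [B HB]]; apply/hardyP; split.
  by apply: holomorphic_scale => //; case/andP: rho01 => /ltW -> /ltW ->.
exists B => r r01; apply: le_trans (HB _ (scaled01 rho01 r01)).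
rewrite le_eqVlt; apply/orP; left; apply/eqP; apply: eq_integral => t /set_mem St.
by rewrite dil_scaled.
Qed.

(** By polarization the real part of the inner product is a combination of the squared norms of f, g
    and f + g, each of which is the limit of those of the dilates. *)
Lemma Re_inner_cvg f g e : H2 f -> H2 g -> 0 < e -> exists2 r0, 0 < r0 < 1 &
  forall r, r0 <= r < 1 ->
    `|complex.Re (ip sg S (dil f r) (dil g r)) - complex.Re (inner Hd f g)| <= e.
Proof.
move=> mf mg e0.
have key (A B X1 X2 X3 Y1 Y2 Y3 : R) : 2 * A = X1 - X2 - X3 -> 2 * B = Y1 - Y2 - Y3 ->
    `|X1 - Y1| <= e / 2 -> `|X2 - Y2| <= e / 2 -> `|X3 - Y3| <= e / 2 -> `|A - B| <= e.
  rewrite !ler_norml => ? ? /andP[? ?] /andP[? ?] /andP[? ?].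
  by apply/andP; split; lra.
have mfg := hardy_lin 1 mf mg.
have e3 : 0 < e / 2 by rewrite divr_gt0.
have [r0 r01 H] := common_threshold (dilsq_cvg mfg e3)
  (common_threshold (dilsq_cvg mf e3) (dilsq_cvg mg e3)).
exists r0 => // r hr; have [h1 [h2 h3]] := H r hr.
have rr : 0 < r < 1 by case/andP: hr => a ->; case/andP: r01 => b _; rewrite (lt_le_trans b a).
have k1 := Re_ipE mS (L2_dil mf rr) (L2_dil mg rr).
have k2 := Re_ipE mS (L2_bv mf) (L2_bv mg).
have Lb := L2_bv mfg; have LL := L2_lin mS 1 (L2_bv mf) (L2_bv mg).
have eb : sqnm sg S (fun t => bv f t + 1 * bv g t) = bsq (fun z => f z + 1 * g z).
  congr fine; apply/esym/(eq_sqint mS); last exact: bv_lin.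
  - by case: Lb.
  - by case: LL.
rewrite eb in k2; rewrite -[ip sg S (bv f) (bv g)]/(inner Hd f g) in k2.
rewrite -(dil_linE f g 1 r) in k1.
exact: key k1 k2 h1 h2 h3.
Qed.

(* On each circle the pairing of [f (r .)] with [g (s .)] depends on [r * s] only,
   so dilation by a real factor is self-adjoint. *)
Lemma Re_inner_scaled (rho : R) f g : 0 < rho < 1 -> H2 f -> H2 g ->
  complex.Re (inner Hd f (scaled rho g)) = complex.Re (inner Hd (scaled rho f) g).
Proof.
have key (e A B X Y : R) : `|A - X| <= e / 2 -> `|B - Y| <= e / 2 -> A = B -> `|X - Y| <= e.
  move=> k1 k2 k3; move: k1 k2; rewrite k3 !ler_norml => /andP[? ?] /andP[? ?].
  by apply/andP; split; lra.
move=> rho01 mf mg; have mfs := hardy_scaled rho01 mf; have mgs := hardy_scaled rho01 mg.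
apply/eqP; rewrite -subr_eq0 -normr_le0; apply/ler_addgt0Pr => e e0; rewrite add0r.
have e2 : 0 < e / 2 by rewrite divr_gt0.
have [r0 r01 H] := common_threshold (Re_inner_cvg mf mgs e2) (Re_inner_cvg mfs mg e2).
have [|h1 h2] := H r0; first by rewrite lexx; case/andP: r01.
have E1 : ip sg S (dil f r0) (dil (scaled rho g) r0) = ip sg S (dil f r0) (dil g (rho * r0)).
  by congr (_ +i* _)%C; apply: eq_Rintegral => t /set_mem St; rewrite (dil_scaled _ rho01 r01 St).
have E2 : ip sg S (dil (scaled rho f) r0) (dil g r0) = ip sg S (dil f (rho * r0)) (dil g r0).
  by congr (_ +i* _)%C; apply: eq_Rintegral => t /set_mem St; rewrite (dil_scaled _ rho01 r01 St).
have s01 := scaled01 rho01 r01.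
apply: (key _ _ _ _ _ h1 h2).
apply: etrans (congr1 _ E1) (etrans _ (esym (congr1 _ E2))).
exact: (Re_pairing mf mg r01 s01 s01 r01 (mulrC _ _)).
Qed.

Lemma scaled_kernel (rho : R) a' g : 0 < rho < 1 -> enorm a' < 1 ->
  is_reproducing_kernel Hd a' g ->
  is_reproducing_kernel Hd (rho%:C%C *: a') (scaled rho g).
Proof.
move=> rho01 a1 [mg rg]; have mgs := hardy_scaled rho01 mg.
split; [exact: mgs|move=> f mf].
have re f' : H2 f' -> complex.Re (f' (rho%:C%C *: a')) = complex.Re (inner Hd f' (scaled rho g)).
  by move=> mf'; rewrite (Re_inner_scaled rho01 mf' mg) -(rg _ (hardy_scaled rho01 mf')).
apply: complex_ext; first exact: (re f mf).
(* So far only real parts are known to agree. The imaginary part of f is the real part of - i f,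
   here written as f + (- i - 1) f. *)
have mi := hardy_lin (- 'i%C - 1) mf mf.
have := re _ mi.
rewrite (inner_conj hm mgs mi) (inner_linr hm _ mgs mf mf) conjcD conjcM conjcK.
rewrite -(inner_conj hm mgs mf).
move: (inner Hd f _) (f _) => [A B] [X Y].
rewrite !(ReD, ReM, ReN, ImD, ImN) /=; lra.
Qed.

(* If [a = rho a'], the kernel at [a] is the dilate by [rho] of the kernel at [a']. *)
Lemma kernel_bounded a k : enorm a < 1 -> is_reproducing_kernel Hd a k -> Hinfty k.
Proof.
move=> a1 [mk rk]; pose rho := (1 + enorm a) / 2; have a0 := enorm_ge0 a.
have rho0 : 0 < rho by rewrite /rho; lra.
have rho1 : rho < 1 by rewrite /rho; lra.
have rho01 : 0 < rho < 1 by rewrite rho0.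
pose a' := (rho^-1)%:C%C *: a.
have aE : a = rho%:C%C *: a' by rewrite scalerA -rmorphM divff ?gt_eqF// scale1r.
have a'1 : enorm a' < 1.
  rewrite enormZ normc_real ger0_norm ?invr_ge0 ?(ltW rho0)// mulrC ltr_pdivrMr// mul1r.
  by rewrite /rho; lra.
have [g kg] := kernel_exists hm a'1.
have [mgs rgs] := scaled_kernel rho01 a'1 kg; have [mg _] := kg.
have [K K0 HK] := hm_point hm rho1.
split; first exact: hardy_hol.
exists (Num.sqrt (K * bsq g)) => z bz; have z1 := (unit_ballE z).1 bz.
have [kz [mkz rkz]] := kernel_exists hm z1.
(* Both functions represent evaluation at a. Pairing each with the kernel at z gives its value at z,
   and by conjugate symmetry both values are the conjugate of kz(a). *)
have -> : k z = scaled rho g z.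
  rewrite (rkz k mk) (rkz (scaled rho g) mgs) (inner_conj hm mkz mk).
  by rewrite (inner_conj hm mkz mgs) -(rk kz mkz) -(rgs kz mkz) -aE.
rewrite sqmod_normc; apply: ler_wsqrtr; apply: (HK g (rho%:C%C *: z) mg).
rewrite enormZ normc_real gtr0_norm// -[leRHS]mulr1.
by apply: ler_wpM2l; exact: ltW.
Qed.

Lemma hardy_jensen : kernel_jensen Hd.
Proof.
move=> a f k ba mf rk; have [mk rk2] := rk.
have [hk [K HK]] := kernel_bounded ((unit_ballE a).1 ba) rk.
have HK2 z : unit_ball z -> sqmod (k z) <= K ^+ 2.
  move=> bz; have h := HK z bz.
  by rewrite /sqmod ler_sqr ?nnegrE ?normc_ge0// (le_trans (normc_ge0 _) h).
have mfk : H2 (fun z => f z * k z).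
  have [hf [B HB]] := (hardyP f).1 mf.
  apply/hardyP; split; first exact: holomorphicM.
  exists (K ^+ 2 * B) => r r01; rewrite /dilnorm dil_mulE EFinM.
  have mfr : cmeas S (dil f r) by exact/cmeasT/cmeas_dil.
  have mkr : cmeas S (dil k r) by exact/cmeasT/cmeas_dil.
  apply: (@le_trans _ _ ((K ^+ 2)%:E * dilnorm f r)%E); last first.
    by apply: lee_wpmul2l; [rewrite lee_fin sqr_ge0|exact: HB].
  have f0 t : (0 <= (sqmod (dil f r t))%:E)%E by rewrite lee_fin sqmod_ge0.
  rewrite /dilnorm /sqint -ge0_integralZl ?lee_fin ?sqr_ge0//; last exact: cmeas_sqmod.
  apply: ge0_le_integral => //.
  - by move=> t _; rewrite lee_fin sqmod_ge0.
  - by apply: cmeas_sqmod; exact: cmeasM.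
  - by apply: measurable_funeM; exact: cmeas_sqmod.
  move=> t St; rewrite -EFinM lee_fin sqmodM mulrC.
  by apply: ler_wpM2r; [exact: sqmod_ge0|exact: dil_bounded].
have Lf := L2_bv mf; have Lk := L2_bv mk; have Lfk := L2_bv mfk.
apply: (@jensen_of_product _ _ Hd a f k (bv (fun z => f z * k z)) mS rk Lk Lfk).
(* Along a common sequence of radii the dilates of f, k and f k converge almost everywhere, so the
   boundary function of the product is the product of the boundary functions. *)
- have [rho r01] := bv_common mf mk mfk; apply: filterS => t ht St.
  have [h1 h2 h3] := ht St; rewrite -sqmodM; congr sqmod.
  apply: (tends_to_unique h3); under eq_fun do rewrite dil_mulE.
  exact: (tends_toM h1 h2).
- have [[m1 m2] _] := Lf; have [[m3 m4] _] := Lk.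
  exact: (measurable_funM (measurable_sqmod m1 m2) (measurable_sqmod m3 m4)).
- exact: (rk2 (fun z => f z * k z) mfk).
Qed.

End hardy_kernel.

Theorem corollary33 (R : realType) (n : nat) (n_ge1 : (1 <= n)%N) :
  (corona_property R n <-> convex_poisson_property (bergman R n)) /\
  (convex_poisson_property (bergman R n) <->
     convex_poisson_property (hardy R n)).
Proof.
have hb := corona_iff_cpp (bergman_model R n) (@bergman_jensen R n).
have hh := corona_iff_cpp (hardy_model R n_ge1) (@hardy_jensen R n n_ge1).
by split => //; rewrite -hb -hh.
Qed.
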